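(* For every $p \in (1,\infty)$ there exist finite positive constants $c_p, C_p$ (depending only on $p$) such that for every integer $n \geq 1$, $$c_p\, F(n,p') \leq J(n,p) \leq C_p\, F(n,p'),$$ where $p' = \frac{p}{p-1}$ is the dual exponent to $p$, and $F(n,\cdot)$, $J(n,\cdot)$ are the constants defined in the context.
   Context: Let $d\gamma_n(x) = (2\pi)^{-n/2} e^{-|x|^2/2}\,dx$ be the standard Gaussian measure on $\mathbb{R}^n$, with $|\cdot|$ the Euclidean norm (also on $\mathbb{C}^n$, $|w|=\sqrt{|w_1|^2+\dots+|w_n|^2}$). For $1\le p<\infty$ and measurable $f:\mathbb{R}^n\to\mathbb{C}$, $\|f\|_{L^p(d\gamma_n)} = (\int_{\mathbb{R}^n} |f|^p\, d\gamma_n)^{1/p}$; for the gradient $\nabla f = (\partial_{x_1} f,\dots,\partial_{x_n} f)$, $\|\nabla f\|_{L^p(d\gamma_n)}$ denotes the $L^p(d\gamma_n)$ norm of $|\nabla f| = (\sum_j |\partial_{x_j} f|^2)^{1/2}$. For a multi-index $\alpha\in(\mathbb{Z}_+)^n$ (nonnegative integers), $|\alpha|=\alpha_1+\dots+\alpha_n$, and the Hermite polynomial is $H_\alpha(x) = \int_{\mathbb{R}^n} \prod_{j=1}^n (x_j+iy_j)^{\alpha_j}\, d\gamma_n(y)$. For an integer $d\ge 0$, $\mathcal{P}^{\leq d}$ is the complex span of the monomials $x^\alpha$ with $|\alpha|\le d$ (equivalently of the $H_\alpha$ with $|\alpha|\leq d$), and $\mathcal{P}^{\geq d}$ is the space of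 all finite sums $\sum_{|\alpha|\ge d} c_\alpha H_\alpha$ with $c_\alpha\in\mathbb{C}$. Fix $p\in(1,\infty)$ and $n\ge1$. - $F(n,p)$ is the smallest constant such that $\sqrt{d+1}\,\|f\|_{L^p(d\gamma_n)} \leq F(n,p)\, \|\nabla f\|_{L^p(d\gamma_n)}$ for all integers $d\ge 0$ and all $f\in\mathcal{P}^{\geq d+1}$. - $J(n,p)$ is the smallest constant such that $\inf_{\varphi\in\mathcal{P}^{\leq d}} \|g-\varphi\|_{L^p(d\gamma_n)} \leq \frac{J(n,p)}{\sqrt{d}}\, \|\nabla g\|_{L^p(d\gamma_n)}$ for all integers $d\ge1$ and all polynomials $g:\mathbb{R}^n\to\mathbb{C}$. Each of these constants is understood as an element of $[0,\infty]$, equal to $+\infty$ if no finite constant works. *)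

(* Defs.v *)
From HB Require Import structures.
From mathcomp Require Import all_boot all_order all_algebra.
From mathcomp Require Import -(notations) mpoly.
From mathcomp Require Import all_classical all_reals all_analysis.
From mathcomp Require Import measurable_realfun complex.

Set Implicit Arguments.
Unset Strict Implicit.
Unset Printing Implicit Defensive.

Import Order.TTheory GRing.Theory Num.Theory.

Local Open Scope classical_set_scope.
Local Open Scope ring_scope.

(* R^n with the product Borel sigma-algebra. *)
Notation Rn R n := (n.-tuple (measurableTypeR R)).
(* A polynomial function R^n -> C is represented by its formal polynomial,
   which it determines since R is infinite; its partial derivatives are then
   the formal ones. *)
Notation cpoly R n := (mpoly n R[i]).

Section cons_measure.
Context {d : measure_display} {T : measurableType d} {R : realType} {n : nat}.

Definition cons_pair (z : T * n.-tuple T) : n.+1.-tuple T :=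
  [the n.+1.-tuple T of z.1 :: z.2].

Let uncons (t : n.+1.-tuple T) : T * n.-tuple T :=
  (thead t, [tuple of behead t]).

Let cons_pairK : cancel cons_pair uncons.
Proof. by case=> x t; congr pair; apply/val_inj. Qed.

Let measurable_uncons : measurable_fun [set: n.+1.-tuple T] uncons.
Proof.
apply/measurable_fun_pairP; split.
- exact: measurable_tnth.
- exact: measurable_behead.
Qed.

Let measurable_cons_pair : measurable_fun [set: T * n.-tuple T] cons_pair.
Proof. exact: measurable_cons. Qed.

Variables (m1 : {sigma_finite_measure set T -> \bar R})
  (m2 : {sigma_finite_measure set (n.-tuple T) -> \bar R}).

Definition cons_measure : set (n.+1.-tuple T) -> \bar R :=
  pushforward (m1 \x m2)%E cons_pair.

Let cons_measure0 : cons_measure set0 = 0%E.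
Proof. by rewrite /cons_measure /pushforward preimage_set0 measure0. Qed.

Let cons_measure_ge0 A : (0 <= cons_measure A)%E.
Proof. exact: integral_ge0. Qed.

Let cons_measure_sigma_additive : semi_sigma_additive cons_measure.
Proof.
exact: (@measure_semi_sigma_additive _ _ _
  (measure_function_pushforward__canonical__measure_function_Measure
    (m1 \x m2)%E measurable_cons_pair)).
Qed.

HB.instance Definition _ := isMeasure.Build _ _ _ cons_measure
  cons_measure0 cons_measure_ge0 cons_measure_sigma_additive.

Let sigma_finite_cons_measure : sigma_finite setT cons_measure.
Proof.
have /sigma_finiteP[F [TF ndF Foo]] := sigma_finiteT m1.
have /sigma_finiteP[G [TG ndG Goo]] := sigma_finiteT m2.
exists (fun k => uncons @^-1` (F k `*` G k)).
  rewrite -preimage_bigcup -(preimage_setT uncons); congr (_ @^-1` _).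
  rewrite -setXTT TF TG predeqE => -[x y]; split.
    move=> [/= [i _ Fxi] [k _ Gky]]; exists (maxn i k) => //; split.
    - by move: x Fxi; exact/subsetPset/ndF/leq_maxl.
    - by move: y Gky; exact/subsetPset/ndG/leq_maxr.
  by move=> [i _ []/= ? ?]; split; exists i.
move=> k; have [? ?] := Foo k; have [? ?] := Goo k; split.
  by rewrite -[X in measurable X]setTI; apply: measurable_uncons => //;
    exact: measurableX.
rewrite /cons_measure /pushforward -comp_preimage.
rewrite [X in (X @^-1` _)](_ : _ = id); last first.
  by apply/funext => z /=; rewrite cons_pairK.
by rewrite product_measure1E// lte_mul_pinfty// ge0_fin_numE.
Qed.

HB.instance Definition _ := Measure_isSigmaFinite.Build _ _ _ cons_measure
  sigma_finite_cons_measure.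

End cons_measure.

(* Lebesgue measure on R^n, as the iterated product of the measure on R. *)
Fixpoint lebesgue_n {R : realType} (n : nat) :
    {sigma_finite_measure set (Rn R n) -> \bar R} :=
  match n with
  | 0 => \d_([tuple] : Rn R 0)
  | n'.+1 => cons_measure lebesgue_measure (lebesgue_n n')
  end.

Section gaussian.
Context {R : realType}.
Variable n : nat.

Definition gaussian_pdf (x : Rn R n) : R :=
  (2 * pi) `^ (- (n%:R / 2)) * expR (- (\sum_(j < n) tnth x j ^+ 2) / 2).

Definition gaussian : set (Rn R n) -> \bar R :=
  fun A => (\int[lebesgue_n n]_(x in A) (gaussian_pdf x)%:E)%E.

Let gaussian_pdf_ge0 x : 0 <= gaussian_pdf x.
Proof. by rewrite mulr_ge0// ?powR_ge0// expR_ge0. Qed.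

Let measurable_gaussian_pdf : measurable_fun setT gaussian_pdf.
Proof.
apply: measurable_funM => //; apply: measurableT_comp => //.
apply: measurable_funM => //; apply: measurableT_comp => //.
apply: measurable_sum => j; apply: measurable_funX.
exact: measurable_tnth.
Qed.

Let gaussian0 : gaussian set0 = 0%E.
Proof. by rewrite /gaussian integral_set0. Qed.

Let gaussian_ge0 A : (0 <= gaussian A)%E.
Proof. by apply: integral_ge0 => x _; rewrite lee_fin. Qed.

Let gaussian_sigma_additive : semi_sigma_additive gaussian.
Proof.
apply: semi_sigma_additive_nng_induced.
- exact/measurable_EFinP.
- by move=> x; rewrite lee_fin.
Qed.

HB.instance Definition _ := isMeasure.Build _ _ _ gaussian
  gaussian0 gaussian_ge0 gaussian_sigma_additive.

End gaussian.
Arguments gaussian R n : clear implicits.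

Section polynomials.
Context {R : realType} {n : nat}.
Implicit Types (f g : cpoly R n) (a : multinom n) (x y : Rn R n).

Definition peval f x : R[i] := meval (fun j => real_complex R (tnth x j)) f.

Definition complex_integral (h : Rn R n -> R[i]) : R[i] :=
  Complex (\int[gaussian R n]_y complex.Re (h y))
          (\int[gaussian R n]_y complex.Im (h y)).

Definition hermite a x : R[i] :=
  complex_integral (fun y => \prod_(j < n) Complex (tnth x j) (tnth y j) ^+ a j).

Definition P_le (d : nat) : set (cpoly R n) :=
  [set f | forall a, a \in msupp f -> (mdeg a <= d)%N].

(* The equality of f with the finite sum is stated between functions on R^n,
   because hermite is defined by its integral formula as a function. *)
Definition P_ge (d : nat) : set (cpoly R n) :=
  [set f | exists (s : seq (multinom n)) (c : multinom n -> R[i]),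
     (forall a, a \in s -> (d <= mdeg a)%N) /\
     (forall x, peval f x = \sum_(a <- s) c a * hermite a x)].

Definition Lp_norm (p : R) (h : Rn R n -> R) : \bar R :=
  'N[gaussian R n]_(p%:E)[EFin \o h].

Definition norm_poly f x : R := ComplexField.Normc.normc (peval f x).

Definition norm_grad f x : R :=
  Num.sqrt (\sum_(j < n) norm_poly (mderiv j f) x ^+ 2).

End polynomials.

(* In both constants below the infimum is +oo when no finite C is admissible;
   otherwise it is itself admissible, as the norms of polynomials are finite. *)
Definition F_const {R : realType} (n : nat) (p : R) : \bar R :=
  ereal_inf [set C%:E | C in [set C : R | 0 <= C /\
    forall (d : nat) (f : cpoly R n), P_ge d.+1 f ->
      ((Num.sqrt d.+1%:R)%:E * Lp_norm p (norm_poly f)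
       <= C%:E * Lp_norm p (norm_grad f))%E]].

Definition J_const {R : realType} (n : nat) (p : R) : \bar R :=
  ereal_inf [set C%:E | C in [set C : R | 0 <= C /\
    forall (d : nat) (g : cpoly R n), (0 < d)%N ->
      (ereal_inf [set Lp_norm p (norm_poly (g - phi)%R) | phi in P_le d]
       <= (C / Num.sqrt d%:R)%:E * Lp_norm p (norm_grad g))%E]].

(* Main.v *)
Require Import Defs.
From HB Require Import structures.
From mathcomp Require Import all_boot all_order all_algebra.
From mathcomp Require Import -(notations) mpoly.
From mathcomp Require Import all_classical all_reals all_analysis.
From mathcomp Require Import measurable_realfun complex zify ring lra.

Set Implicit Arguments.
Unset Strict Implicit.
Unset Printing Implicit Defensive.

Import Order.TTheory GRing.Theory Num.Theory.
Import numFieldNormedType.Exports.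

Local Open Scope classical_set_scope.
Local Open Scope ring_scope.

(** Write [||.||_r] for the norms of [L^r] of the Gaussian measure [G], and let
    [q = p / (p - 1)].  Both inequalities are proved by testing with the
    bilinear pairing [<f, g> = E (f g)] and by moving between the two sides with
    the Mehler transform [P_t f x = E_y (f (x cos t + y sin t))].  It is
    self-adjoint for the pairing, hence preserves orthogonality to low degrees,
    and it satisfies two bounds whose constant depends only on [r]:
    - [||g - P_t g||_r <= K_r t ||grad g||_r] ([mehler_close]), because the curve
      [t |-> x cos t + y sin t] has a Gaussian velocity independent of its
      position;
    - [sin t ||grad (P_t f)||_r <= cos t K_r' ||f||_r], with [r'] dual to [r]
      ([grad_mehler]), by integration by parts in [y].
    Both rest on the fact that a linear form [y |-> v . y] has norm at most
    [K_r |v|] in every dimension.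

    From F to J: choose [t] with [tan t] of order [F / sqrt (d + 1)].  On
    polynomials [f] orthogonal to the degrees at most [d], the second bound and
    the definition of F give [||P_t f||_q <= ||f||_q / 2].  In
    [<f, g> = <f, g - P_t g> + <P_t f, g>] the first term is at most
    [K_p t ||f||_q ||grad g||_p] and the second is of the same form with half the
    norm, so the geometric series bounds [|<f, g>|] ([pairing_le_F]).  As the
    polynomials [f] norm the quotient of [L^p] by the degrees at most [d]
    ([dist_le_dual]), this bounds the distance from [g] to them.

    From J to F: with [tan t] of order [J / sqrt d], in
    [<f, g> = <f - P_t f, g> + <f, P_t g>] the first term is at most
    [K_q t ||grad f||_q ||g||_p]; in the second [P_t g] may be replaced by its
    difference with a polynomial of degree at most [d], and is then at most
    [||f||_q ||g||_p / 2].  Taking the supremum over [g] ([norm_le_dual]) and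
    absorbing gives the bound on [||f||_q] ([F_of_J_pos]).  For [d = 0] the angle
    [pi / 2] gives a Poincare inequality ([poincare]), which suffices since J
    is bounded below by a positive number that depends only on [p], as the second
    Hermite polynomial in one variable shows ([J_feasible_lb]).

    The two duality statements avoid the dual space of [L^p]: both use the extremal
    functions [conj u |u|^(p - 2)], [u] a polynomial, which are approximated by
    polynomials in all norms ([approximable_psi]).  For the distance,
    [u = g - phi] nearly realizes the distance from [g] to the low degrees; its
    extremal function is then nearly orthogonal to them ([near_critical]), so
    that removing the low degrees from an approximating polynomial costs little. *)

Local Notation nc := ComplexField.Normc.normc.
Local Notation C_ R := (real_complex R).

Lemma le_of_eq {R : numDomainType} (x y : R) : x = y -> x <= y.
Proof. by move=> ->. Qed.

(** * Translations of Lebesgue measure and rotations of Gaussian measure *)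

Section density.
Import HBNNSimple.
Local Open Scope ereal_scope.
Context d (T : measurableType d) (R : realType).
Variables (mu nu : {measure set T -> \bar R}) (g : T -> R).
Hypothesis mg : measurable_fun setT g.
Hypothesis g0 : forall x, (0 <= g x)%R.
Hypothesis nuE : forall A, measurable A -> nu A = \int[mu]_(x in A) (g x)%:E.

Lemma ge0_integral_density (f : T -> \bar R) :
  measurable_fun setT f -> (forall x, 0 <= f x) ->
  \int[nu]_x f x = \int[mu]_x (f x * (g x)%:E).
Proof.
move=> mf f0; pose h := nnsfun_approx measurableT mf.
have mgE : measurable_fun setT (EFin \o g) by exact/measurable_EFinP.
have -> : \int[nu]_x f x = limn (fun n => \int[nu]_x (h n x)%:E).
  rewrite -monotone_convergence//.
  - apply: eq_integral => x _; apply/esym/cvg_lim => //.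
    exact: cvg_nnsfun_approx.
  - by move=> n; exact/measurable_EFinP/measurable_funP.
  - by move=> n x _; rewrite lee_fin.
  - by move=> x _ a b ab; rewrite lee_fin; exact/lefP/nd_nnsfun_approx.
have -> : \int[mu]_x (f x * (g x)%:E) =
    limn (fun n => \int[mu]_x ((h n x)%:E * (g x)%:E)).
  rewrite -monotone_convergence//.
  - apply: eq_integral => x _; apply/esym/cvg_lim => //.
    by apply: cvgeZr => //; exact: cvg_nnsfun_approx.
  - by move=> n; apply: emeasurable_funM => //; exact/measurable_EFinP.
  - by move=> n x _; rewrite mule_ge0 ?lee_fin.
  - move=> x _ a b ab; rewrite lee_wpmul2r ?lee_fin//.
    exact/lefP/nd_nnsfun_approx.
congr (limn _); apply/funext => n.
transitivity (\int[nu]_x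
   (\sum_(y \in range (h n)) (y * \1_(h n @^-1` [set y]) x)%:E)).
  by apply: eq_integral => t _; rewrite /= fimfunE -fsumEFin.
rewrite ge0_integral_fsum//; last 2 first.
  - by move=> r; apply/measurable_EFinP; exact: measurable_funM.
  - by move=> r x _; exact: nnfun_muleindic_ge0.
transitivity (\int[mu]_x (\sum_(y \in range (h n))
    (y * \1_(h n @^-1` [set y]) x)%:E * (g x)%:E)); last first.
  apply: eq_integral => x _.
  rewrite -ge0_mule_fsuml => [|y]; last exact: nnfun_muleindic_ge0.
  by rewrite fsumEFin // -(fimfunE _ x).
rewrite ge0_integral_fsum//; last 2 first.
  - move=> y; apply: emeasurable_funM => //; apply/measurable_EFinP.
    exact: measurable_funM.
  - by move=> r x _; rewrite mule_ge0 ?lee_fin// -lee_fin nnfun_muleindic_ge0.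
apply: eq_fsbigr => r rhn.
rewrite integralZl_indic_nnsfun => //.
under [RHS]eq_integral do rewrite EFinM -muleA.
rewrite ge0_integralZl//.
- congr (_ * _); under [RHS]eq_integral do rewrite muleC.
  rewrite [RHS](eq_integral ((EFin \o g) \_ (h n @^-1` [set r]))); last first.
    by move=> x xE; rewrite epatch_indic.
  by rewrite -integral_mkcond integral_indic// setIT nuE.
- by apply: emeasurable_funM => //; exact/measurable_EFinP.
- by move=> x _; rewrite mule_ge0 ?lee_fin.
- by move: rhn; rewrite inE => -[t _ <-]; rewrite lee_fin.
Qed.

End density.

Section lebesgue_translation.
Context {R : realType}.
Local Notation leb := (@lebesgue_measure R).

Lemma measurable_shift (v : R) :
  measurable_fun setT (fun x : measurableTypeR R => x + v : measurableTypeR R).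
Proof. exact: measurable_funD. Qed.

Lemma lebesgue_measure_shift (v : R) A : measurable A ->
  pushforward leb (fun x : measurableTypeR R => x + v : measurableTypeR R) A =
  leb A.
Proof.
move=> mA; apply/esym.
apply: (@lebesgue_measure_unique R
  (measure_function_pushforward__canonical__measure_function_Measure
    leb (measurable_shift v))) => // X [[a b] _ <-] /=.
rewrite /pushforward.
have -> : (fun x => x + v) @^-1` [set` `]a, b]] = [set` `](a - v), (b - v)]].
  apply/seteqP; split => x /=; rewrite !in_itv/=.
    by rewrite ltrBlDr lerBrDr.
  by rewrite ltrBlDr lerBrDr.
rewrite !lebesgue_measure_itv/= !lte_fin ltrD2r.
by case: ifP => // _; rewrite -!EFinB; congr EFin; ring.
Qed.

Lemma ge0_integral_shift (v : R) (f : measurableTypeR R -> \bar R) :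
  measurable_fun setT f -> (forall x, (0 <= f x)%E) ->
  (\int[leb]_x f (x + v)%R = \int[leb]_x f x)%E.
Proof.
move=> mf f0.
transitivity (\int[pushforward leb (fun x : measurableTypeR R =>
   (x + v)%R : measurableTypeR R)]_x f x)%E.
  by rewrite ge0_integral_pushforward//; exact: measurable_shift.
exact: (@eq_measure_integral _ _ R setT leb
  (measure_function_pushforward__canonical__measure_function_Measure
    leb (measurable_shift v)) f (fun A mA _ => lebesgue_measure_shift v mA)).
Qed.

End lebesgue_translation.

Section tuples.
Context {R : realType} {n : nat}.
Implicit Types x y : Rn R n.

Definition lincomb (a b : R) x y : Rn R n :=
  [tuple a * tnth x i + b * tnth y i | i < n].

Lemma tnth_lincomb a b x y i :
  tnth (lincomb a b x y) i = a * tnth x i + b * tnth y i.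
Proof. by rewrite tnth_mktuple. Qed.

Lemma measurable_lincomb a b :
  measurable_fun setT (fun z : Rn R n * Rn R n => lincomb a b z.1 z.2).
Proof.
apply/measurable_fun_tnthP => i.
rewrite (_ : _ \o _ = fun z : Rn R n * Rn R n => a * tnth z.1 i + b * tnth z.2 i).
  apply: measurable_funD; apply: measurable_funM => //.
    exact: (measurableT_comp (measurable_tnth i)).
  exact: (measurableT_comp (measurable_tnth i)).
by apply/funext => z /=; rewrite tnth_lincomb.
Qed.

Lemma measurable_lincombl a b y :
  measurable_fun setT (fun x : Rn R n => lincomb a b x y).
Proof.
exact: (measurableT_comp (measurable_lincomb a b) (measurable_pair2 y)).
Qed.

End tuples.

Section lebesgue_n_translation.
Context {R : realType}.
Local Open Scope ereal_scope.

Lemma ge0_integral_lebesgue_nS n (f : Rn R n.+1 -> \bar R) :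
  measurable_fun setT f -> (forall x, 0 <= f x) ->
  \int[lebesgue_n n.+1]_x f x =
  \int[lebesgue_n n]_t \int[lebesgue_measure]_a f (cons_pair (a, t)).
Proof.
move=> mf f0 /=.
have mc : measurable_fun setT
    (@cons_pair _ (measurableTypeR R) n) by exact: measurable_cons.
rewrite ge0_integral_pushforward//=.
by rewrite fubini_tonelli2//=; exact: measurableT_comp.
Qed.

Lemma ge0_integral_lebesgue_n_shift n (f : Rn R n -> \bar R) c v :
  measurable_fun setT f -> (forall x, 0 <= f x) ->
  \int[lebesgue_n n]_x f (lincomb 1 c x v) = \int[lebesgue_n n]_x f x.
Proof.
elim: n f v => [|n IH] f v mf f0.
  by apply: eq_integral => x _; congr f; apply: eq_from_tnth => -[].
have mc : measurable_fun setT
    (@cons_pair _ (measurableTypeR R) n) by exact: measurable_cons.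
rewrite ge0_integral_lebesgue_nS//; last first.
  by apply: measurableT_comp => //; exact: measurable_lincombl.
rewrite ge0_integral_lebesgue_nS//.
transitivity (\int[lebesgue_n n]_t \int[lebesgue_measure]_a
    f (cons_pair (a, lincomb 1 c t [tuple of behead v]))).
  apply: eq_integral => t _.
  rewrite -(@ge0_integral_shift _ (c * thead v)%R (fun a =>
     f (cons_pair (a, lincomb 1 c t [tuple of behead v]))))//; last first.
    apply: measurableT_comp => //.
    exact: (measurableT_comp mc (measurable_pair2 _)).
  apply: eq_integral => a _; congr f; apply: eq_from_tnth => i.
  rewrite tnth_lincomb mul1r.
  case: (unliftP ord0 i) => [j|] ->.
    by rewrite !tnthS tnth_lincomb mul1r [in LHS](tuple_eta v) tnthS.
  by rewrite !tnth0.
rewrite (IH (fun t => \int[lebesgue_measure]_a f (cons_pair (a, t))))//.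
- apply: (@measurable_fun_fubini_tonelli_G _ _ _ _ R lebesgue_measure
    (f \o cons_pair)) => [|z]; last exact: f0.
  exact: measurableT_comp.
- by move=> x; exact: integral_ge0.
Qed.

End lebesgue_n_translation.

Section gaussian_density.
Context {R : realType} {n : nat}.
Implicit Types x y v : Rn R n.

Lemma gaussian_pdf_ge0 x : 0 <= gaussian_pdf x.
Proof. by rewrite mulr_ge0// ?powR_ge0// expR_ge0. Qed.

Lemma measurable_gaussian_pdf : measurable_fun setT (@gaussian_pdf R n).
Proof.
apply: measurable_funM => //; apply: measurableT_comp => //.
apply: measurable_funM => //; apply: measurableT_comp => //.
by apply: measurable_sum => j; apply: measurable_funX; exact: measurable_tnth.
Qed.

Local Open Scope ereal_scope.

Lemma ge0_integral_gaussian (f : Rn R n -> \bar R) :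
  measurable_fun setT f -> (forall x, 0 <= f x) ->
  \int[gaussian R n]_x f x = \int[lebesgue_n n]_x (f x * (gaussian_pdf x)%:E).
Proof.
move=> mf f0; apply: ge0_integral_density => //.
- exact: measurable_gaussian_pdf.
- exact: gaussian_pdf_ge0.
Qed.

(** The Cameron-Martin formula. *)
Lemma ge0_integral_gaussian_shift (f : Rn R n -> \bar R) (c : R) v :
  measurable_fun setT f -> (forall x, 0 <= f x) ->
  \int[gaussian R n]_x f (lincomb 1 c x v) =
  \int[gaussian R n]_x (f x * (expR (c * (\sum_j tnth v j * tnth x j)
     - c ^+ 2 * (\sum_j tnth v j ^+ 2) / 2))%:E).
Proof.
move=> mf f0.
have ml (a b : R) (w : Rn R n) : measurable_fun setT (fun x => lincomb a b x w).
  exact: measurable_lincombl.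
have me : measurable_fun setT (fun x : Rn R n =>
   expR (c * (\sum_j tnth v j * tnth x j) - c ^+ 2 * (\sum_j tnth v j ^+ 2) / 2)).
  apply: measurableT_comp => //; apply: measurable_funB => //.
  apply: measurable_funM => //; apply: measurable_sum => j.
  by apply: measurable_funM => //; exact: measurable_tnth.
rewrite ge0_integral_gaussian//; last exact: measurableT_comp.
rewrite ge0_integral_gaussian//; last 2 first.
- by apply: emeasurable_funM => //; exact/measurable_EFinP.
- by move=> x; rewrite mule_ge0 ?lee_fin ?expR_ge0.
pose h x := f x * (expR (c * (\sum_j tnth v j * tnth x j)
  - c ^+ 2 * (\sum_j tnth v j ^+ 2) / 2))%:E * (gaussian_pdf x)%:E.
have mh : measurable_fun setT h.
  apply: emeasurable_funM.
    by apply: emeasurable_funM => //; exact/measurable_EFinP.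
  by apply/measurable_EFinP; exact: measurable_gaussian_pdf.
have h0 x : 0 <= h x.
  by rewrite !mule_ge0 ?lee_fin ?expR_ge0 ?gaussian_pdf_ge0.
rewrite -[RHS](ge0_integral_lebesgue_n_shift c v mh h0) {mh h0}/h.
apply: eq_integral => x _; rewrite -muleA; congr (_ * _).
rewrite -EFinM; congr EFin; rewrite /gaussian_pdf mulrCA; congr (_ * _)%R.
rewrite -expRD; congr expR.
under [in RHS]eq_bigr do rewrite tnth_lincomb mul1r mulrDr mulrCA.
rewrite big_split/= -!mulr_sumr.
under [X in _ = (_ + - X / 2)%R]eq_bigr do
  rewrite tnth_lincomb mul1r sqrrD exprMn.
rewrite !big_split/= -mulr_sumr.
have -> : (\sum_(i < n) tnth x i * (c * tnth v i) =
   c * \sum_(i < n) tnth v i * tnth x i)%R.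
  by rewrite mulr_sumr; apply: eq_bigr => i _; ring.
under [X in (c * (_ + c * X))%R]eq_bigr do rewrite -expr2.
by field.
Qed.

(** The density depends only on the norm of the pair, which is preserved. *)
Lemma gaussian_pdf_rot (c s : R) x y : (c ^+ 2 + s ^+ 2 = 1)%R ->
  (gaussian_pdf (lincomb c s x y) * gaussian_pdf (lincomb (- s) c x y) =
   gaussian_pdf x * gaussian_pdf y)%R.
Proof.
move=> cs; rewrite /gaussian_pdf mulrACA [RHS]mulrACA; congr (_ * _)%R.
rewrite -!expRD; congr expR; rewrite -!mulrDl -!opprD; congr (- _ / _)%R.
rewrite -!big_split/=; apply: eq_bigr => i _; rewrite !tnth_lincomb.
transitivity ((c ^+ 2 + s ^+ 2) * (tnth x i ^+ 2 + tnth y i ^+ 2))%R; first by ring.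
by rewrite cs mul1r.
Qed.

Local Notation lam := (@lebesgue_n R n).
Local Notation T := (Rn R n * Rn R n)%type.

Lemma ge0_integral_shear1 (a : R) (f : T -> \bar R) :
  measurable_fun setT f -> (forall z, 0 <= f z) ->
  \int[lam \x lam]_z f (lincomb 1 a z.1 z.2, z.2) = \int[lam \x lam]_z f z.
Proof.
move=> mf f0.
have mF : measurable_fun setT (fun z : T => f (lincomb 1 a z.1 z.2, z.2)).
  apply: measurableT_comp => //; apply: measurable_fun_pair => //.
  exact: measurable_lincomb.
rewrite (@fubini_tonelli2 _ _ _ _ R lam lam _ mF (fun z => f0 _)).
rewrite (@fubini_tonelli2 _ _ _ _ R lam lam _ mf f0).
apply: eq_integral => y _; rewrite /fubini_G/=.
rewrite (ge0_integral_lebesgue_n_shift a y (f := fun x => f (x, y)))//.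
exact: (measurableT_comp mf (measurable_pair2 y)).
Qed.

Lemma ge0_integral_shear2 (a : R) (f : T -> \bar R) :
  measurable_fun setT f -> (forall z, 0 <= f z) ->
  \int[lam \x lam]_z f (z.1, lincomb a 1 z.1 z.2) = \int[lam \x lam]_z f z.
Proof.
move=> mf f0.
have mF : measurable_fun setT (fun z : T => f (z.1, lincomb a 1 z.1 z.2)).
  apply: measurableT_comp => //; apply: measurable_fun_pair => //.
  exact: measurable_lincomb.
rewrite (@fubini_tonelli1 _ _ _ _ R lam lam _ mF (fun z => f0 _)).
rewrite (@fubini_tonelli1 _ _ _ _ R lam lam _ mf f0).
apply: eq_integral => x _; rewrite /fubini_F/=.
rewrite -[RHS](ge0_integral_lebesgue_n_shift a x (f := fun y => f (x, y)))//.
  apply: eq_integral => y _; congr (f (_, _)); apply: eq_from_tnth => i.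
  by rewrite !tnth_lincomb addrC.
exact: (measurableT_comp mf (measurable_pair1 x)).
Qed.

(** A rotation is a product of three shears, and a shear is on each line a
    translation; this avoids the general linear change of variables. *)
Lemma ge0_integral_lebesgue_rot (c s : R) (f : T -> \bar R) :
  (c ^+ 2 + s ^+ 2 = 1)%R -> (0 <= c)%R ->
  measurable_fun setT f -> (forall z, 0 <= f z) ->
  \int[lam \x lam]_z f (lincomb c s z.1 z.2, lincomb (- s) c z.1 z.2) =
  \int[lam \x lam]_z f z.
Proof.
(* [a] is the tangent of half the angle. *)
move=> cs c0 mf f0; pose a := (s / (1 + c))%R.
have ab : (1 + a * - s = c)%R.
  have c1 : (1 + c != 0)%R by rewrite gt_eqF// ltr_pwDl.
  have -> : (1 + a * - s = (1 + c - s ^+ 2) / (1 + c))%R.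
    by rewrite /a; field.
  have -> : (1 + c - s ^+ 2 = c * (1 + c))%R by rewrite -[in LHS]cs; ring.
  by rewrite mulfK.
have aab : (a + c * a = s)%R.
  have c1 : (1 + c != 0)%R by rewrite gt_eqF// ltr_pwDl.
  by rewrite /a; field.
pose F1 z := f (lincomb 1 a z.1 z.2, z.2).
have mF1 : measurable_fun setT F1.
  apply: measurableT_comp => //; apply: measurable_fun_pair => //.
  exact: measurable_lincomb.
pose F2 z := F1 (z.1, lincomb (- s)%R 1 z.1 z.2).
have mF2 : measurable_fun setT F2.
  apply: (measurableT_comp mF1); apply: measurable_fun_pair => //.
  exact: measurable_lincomb.
have F10 z : 0 <= F1 z by exact: f0.
have F20 z : 0 <= F2 z by exact: f0.
transitivity (\int[lam \x lam]_z F1 z); last exact: ge0_integral_shear1.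
transitivity (\int[lam \x lam]_z F2 z); last exact: (ge0_integral_shear2 _ mF1).
rewrite -(ge0_integral_shear1 a mF2 F20).
apply: eq_integral => -[x y] _; rewrite /F2 /F1/=; congr (f (_, _)).
  apply: eq_from_tnth => i; rewrite !tnth_lincomb !mul1r.
  rewrite -[X in (X * _ + _)%R]ab -[X in (_ + X * _)%R]aab -ab; ring.
apply: eq_from_tnth => i; rewrite !tnth_lincomb !mul1r -{1}ab; ring.
Qed.

End gaussian_density.

Section gaussian_probability.
Context {R : realType}.
Local Open Scope ereal_scope.

Lemma gaussian_pdf_cons n (a : R) (t : Rn R n) :
  gaussian_pdf (cons_pair (a, t) : Rn R n.+1) =
  (normal_pdf 0 1 a * gaussian_pdf t)%R.
Proof.
rewrite normal_pdfE ?oner_eq0// /normal_peak /normal_fun /gaussian_pdf.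
rewrite [RHS]mulrACA; congr (_ * _)%R.
  rewrite -[n.+1%:R]natr1 (mulrDl n%:R) opprD powRD; last first.
    by apply/implyP => _; rewrite mulf_neq0// gt_eqF// pi_gt0.
  rewrite mulrC; congr (_ * _)%R; rewrite mul1r powRN.
  by rewrite powR12_sqrt ?mulr_ge0 ?pi_ge0// expr1n mul1r mulrC mulr_natr.
rewrite -expRD; congr expR; rewrite big_ord_recl/= tnth0.
under eq_bigr do rewrite tnthS.
by rewrite expr1n subr0 /=; field.
Qed.

Lemma gaussian_setT n : gaussian R n setT = 1.
Proof.
rewrite /gaussian; elim: n => [|n IH].
  rewrite integral_dirac//= ?diracT ?mul1e /gaussian_pdf.
    by rewrite big_ord0 mul0r !oppr0 powRr0 mul0r expR0 mulr1.
  by apply/measurable_EFinP; exact: measurable_gaussian_pdf.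
rewrite ge0_integral_lebesgue_nS; last 2 first.
- by apply/measurable_EFinP; exact: measurable_gaussian_pdf.
- by move=> x; rewrite lee_fin gaussian_pdf_ge0.
rewrite -[RHS]IH; apply: eq_integral => t _.
under eq_integral do rewrite gaussian_pdf_cons EFinM.
rewrite ge0_integralZr//=.
- by rewrite integral_normal_pdf mul1e.
- by apply/measurable_EFinP; exact: measurable_normal_pdf.
- by move=> x _; rewrite lee_fin normal_pdf_ge0.
- by rewrite lee_fin gaussian_pdf_ge0.
Qed.

HB.instance Definition _ n :=
  @Measure_isProbability.Build _ _ R (gaussian R n) (gaussian_setT n).

Context {n : nat}.
Local Notation G := (gaussian R n).
Local Notation T := (Rn R n * Rn R n)%type.

Lemma ge0_integral_gaussian2 (f : T -> \bar R) :
  measurable_fun setT f -> (forall z, 0 <= f z) ->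
  \int[G \x G]_z f z =
  \int[lebesgue_n n \x lebesgue_n n]_z
    (f z * (gaussian_pdf z.1 * gaussian_pdf z.2)%:E).
Proof.
move=> mf f0.
have mg1 : measurable_fun setT (fun z : T => (gaussian_pdf z.1)%:E).
  by apply/measurable_EFinP; exact: (measurableT_comp measurable_gaussian_pdf).
have mg2 : measurable_fun setT (fun z : T => (gaussian_pdf z.2)%:E).
  by apply/measurable_EFinP; exact: (measurableT_comp measurable_gaussian_pdf).
rewrite fubini_tonelli1// fubini_tonelli1//; last 2 first.
- by apply: emeasurable_funM => //=; under eq_fun do rewrite EFinM;
   exact: emeasurable_funM.
- by move=> z; rewrite mule_ge0// lee_fin mulr_ge0// gaussian_pdf_ge0.
rewrite ge0_integral_gaussian; last 2 first.
- exact: measurable_fun_fubini_tonelli_F.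
- by move=> x; exact: integral_ge0.
apply: eq_integral => x _; rewrite /fubini_F/=.
have mfx : measurable_fun setT (fun y => f (x, y)).
  exact: (measurableT_comp mf (measurable_pair1 x)).
rewrite ge0_integral_gaussian//.
rewrite -ge0_integralZr//.
- by apply: eq_integral => y _; rewrite -muleA -EFinM mulrC.
- by apply: emeasurable_funM => //;
   apply/measurable_EFinP; exact: measurable_gaussian_pdf.
- by move=> y _; rewrite mule_ge0// lee_fin gaussian_pdf_ge0.
- by rewrite lee_fin gaussian_pdf_ge0.
Qed.

Lemma ge0_integral_gaussian_rot (c s : R) (f : T -> \bar R) :
  (c ^+ 2 + s ^+ 2 = 1)%R -> (0 <= c)%R ->
  measurable_fun setT f -> (forall z, 0 <= f z) ->
  \int[G \x G]_z f (lincomb c s z.1 z.2, lincomb (- s) c z.1 z.2) =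
  \int[G \x G]_z f z.
Proof.
move=> cs c0 mf f0.
have mr : measurable_fun setT
   (fun z : T => (lincomb c s z.1 z.2, lincomb (- s) c z.1 z.2)).
  by apply: measurable_fun_pair; exact: measurable_lincomb.
pose h z := f z * (gaussian_pdf z.1 * gaussian_pdf z.2)%:E.
have mh : measurable_fun setT h.
  apply: emeasurable_funM => //; apply/measurable_EFinP.
  by apply: measurable_funM; exact: (measurableT_comp measurable_gaussian_pdf).
have h0 z : 0 <= h z.
  by rewrite mule_ge0// lee_fin mulr_ge0// gaussian_pdf_ge0.
rewrite (ge0_integral_gaussian2 mf f0).
rewrite (ge0_integral_gaussian2 (measurableT_comp mf mr) (fun z => f0 _)).
transitivity (\int[lebesgue_n n \x lebesgue_n n]_z
    h (lincomb c s z.1 z.2, lincomb (- s) c z.1 z.2)).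
  by apply: eq_integral => z _; rewrite /h/= gaussian_pdf_rot.
exact: (ge0_integral_lebesgue_rot cs c0 mh h0).
Qed.

End gaussian_probability.

(** * Functions of at most exponential growth *)

(** A weight all of whose exponentials are integrable makes integrable every
    function that they dominate. *)
Class exp_integrable {d} {T : measurableType d} {R : realType}
    (mu : {measure set T -> \bar R}) (w : T -> R) : Prop := ExpIntegrable {
  expint_measurable : measurable_fun setT w;
  expint_ge0 : forall x, 0 <= w x;
  expint_integrable : forall K, mu.-integrable setT (fun x => (expR (K * w x))%:E);
  expint_setT : mu setT = 1%E }.

Section tame.
Context {d} {T : measurableType d} {R : realType}
  {mu : {measure set T -> \bar R}} {w : T -> R} {muw : exp_integrable mu w}.
Implicit Types f g : T -> R.

(** A class closed under the algebraic operations, powers and partial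
    integration, hence large enough for all the functions below; one constant
    serves both as factor and as exponent. *)
Definition tame f := measurable_fun setT f /\
  exists2 K, 0 <= K & forall x, `|f x| <= K * expR (K * w x).

Let w0 x : 0 <= w x. Proof. exact: expint_ge0. Qed.

Lemma tame_measurable f : tame f -> measurable_fun setT f. Proof. by case. Qed.

Lemma tame_bound f (K K' : R) : measurable_fun setT f ->
  (forall x, `|f x| <= K * expR (K' * w x)) -> tame f.
Proof.
move=> mf fK; split=> //; exists (`|K| + `|K'|); first exact: addr_ge0.
move=> x; apply: (le_trans (fK x)).
apply: (@le_trans _ _ (`|K| * expR (K' * w x))).
  by rewrite ler_wpM2r ?expR_ge0// ler_norm.
rewrite ler_pM ?expR_ge0//; first by rewrite lerDl.
by rewrite ler_expR ler_wpM2r// (le_trans (ler_norm _))// lerDr.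
Qed.

Lemma tame_le f g : measurable_fun setT f -> tame g ->
  (forall x, `|f x| <= `|g x|) -> tame f.
Proof.
move=> mf [_ [K K0 gK]] fg; apply: (@tame_bound _ K K) => // x.
exact: le_trans (gK x).
Qed.

Lemma tame_cst (c : R) : tame (fun=> c).
Proof.
apply: (@tame_bound _ `|c| 0) => // x.
by rewrite mul0r expR0 mulr1.
Qed.

Lemma tame_expw (K : R) : tame (fun x => expR (K * w x)).
Proof.
apply: (@tame_bound _ 1 K) => [|x].
  apply: measurableT_comp => //; apply: measurable_funM => //.
  exact: expint_measurable.
by rewrite ger0_norm ?expR_ge0// mul1r.
Qed.

Lemma tame_w : tame w.
Proof.
apply: (@tame_bound _ 1 1) => [|x]; first exact: expint_measurable.
by rewrite ger0_norm// !mul1r (le_trans _ (expR_ge1Dx _))// lerDr.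
Qed.

Lemma tameD f g : tame f -> tame g -> tame (fun x => f x + g x).
Proof.
move=> [mf [K K0 fK]] [mg [L L0 gL]].
apply: (@tame_bound _ (K + L) (K + L)) => [|x].
  exact: measurable_funD.
rewrite (le_trans (ler_normD _ _))// mulrDl lerD//.
  rewrite (le_trans (fK x))// ler_wpM2l// ler_expR ler_wpM2r//.
  by rewrite lerDl.
rewrite (le_trans (gL x))// ler_wpM2l// ler_expR ler_wpM2r//.
by rewrite lerDr.
Qed.

Lemma tameM f g : tame f -> tame g -> tame (fun x => f x * g x).
Proof.
move=> [mf [K K0 fK]] [mg [L L0 gL]].
apply: (@tame_bound _ (K * L) (K + L)) => [|x].
  exact: measurable_funM.
by rewrite normrM mulrDl expRD mulrACA ler_pM.
Qed.

Lemma tameZ (c : R) f : tame f -> tame (fun x => c * f x).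
Proof. by apply: tameM; exact: tame_cst. Qed.

Lemma tameN f : tame f -> tame (fun x => - f x).
Proof.
move=> tf; apply: (tame_le _ tf) => [|x]; last by rewrite normrN.
by apply: measurableT_comp => //; exact: tame_measurable.
Qed.

Lemma tameB f g : tame f -> tame g -> tame (fun x => f x - g x).
Proof. by move=> tf tg; apply: tameD => //; exact: tameN. Qed.

Lemma tame_norm f : tame f -> tame (fun x => `|f x|).
Proof.
move=> tf; apply: (tame_le _ tf) => [|x]; last by rewrite normr_id.
by apply: measurableT_comp => //; exact: tame_measurable.
Qed.

Lemma tame_sum (I : Type) (s : seq I) (f : I -> T -> R) :
  (forall i, tame (f i)) -> tame (fun x => \sum_(i <- s) f i x).
Proof.
move=> tf; elim: s => [|i s IH].
  by under eq_fun do rewrite big_nil; exact: tame_cst.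
by under eq_fun do rewrite big_cons; exact: tameD.
Qed.

Lemma tame_powR (r : R) f : 0 <= r -> tame f -> tame (fun x => `|f x| `^ r).
Proof.
move=> r0 [mf [K K0 fK]].
apply: (@tame_bound _ (K `^ r) (K * r)) => [|x].
  apply: (@measurableT_comp _ _ _ _ _ _ (@powR R ^~ r)) => //.
  exact: measurableT_comp.
rewrite ger0_norm ?powR_ge0// mulrAC expRM -powRM ?expR_ge0//.
by rewrite ge0_ler_powR// ?nnegrE ?mulr_ge0 ?expR_ge0.
Qed.

Lemma tame_sqrt f : tame f -> tame (fun x => Num.sqrt (f x)).
Proof.
move=> tf.
have t1 : tame (fun x => 1 + `|f x|).
  by apply: tameD; [exact: tame_cst|exact: tame_norm].
apply: (tame_le _ t1) => [|x].
  apply: measurableT_comp (tame_measurable tf).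
  by apply: continuous_measurable_fun; exact: sqrt_continuous.
rewrite ger0_norm ?sqrtr_ge0// ger0_norm ?addr_ge0//.
rewrite (le_trans (_ : _ <= Num.sqrt ((1 + `|f x|) ^+ 2)))//.
  apply: ler_wsqrtr; rewrite (le_trans (ler_norm _))//.
  by have := normr_ge0 (f x); nra.
by rewrite sqrtr_sqr ger0_norm// addr_ge0.
Qed.

Lemma tame_integrable f : tame f -> mu.-integrable setT (EFin \o f).
Proof.
move=> [mf [K K0 fK]].
have iK : mu.-integrable setT (fun x => K%:E * (expR (K * w x))%:E)%E.
  by apply: integrableZl => //; exact: expint_integrable.
apply: le_integrable iK => //; first exact/measurable_EFinP.
move=> x _ /=; rewrite lee_fin normrM (ger0_norm K0) ger0_norm ?expR_ge0//.
Qed.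

Local Notation E := (Rintegral mu setT).

Lemma expectD f g : tame f -> tame g ->
  E (fun x => f x + g x) = E f + E g.
Proof. by move=> tf tg; rewrite RintegralD//; exact: tame_integrable. Qed.

Lemma expectB f g : tame f -> tame g ->
  E (fun x => f x - g x) = E f - E g.
Proof. by move=> tf tg; rewrite RintegralB//; exact: tame_integrable. Qed.

Lemma expectZ (c : R) f : tame f -> E (fun x => c * f x) = c * E f.
Proof. by move=> tf; rewrite RintegralZl//; exact: tame_integrable. Qed.

Lemma expect_cst (c : R) : E (fun=> c) = c.
Proof. by rewrite Rintegral_cst// expint_setT mulr1. Qed.

Lemma expect_le f g : tame f -> tame g -> (forall x, f x <= g x) -> E f <= E g.
Proof. by move=> tf tg fg; apply: le_Rintegral => //; exact: tame_integrable. Qed.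

Lemma expect_ge0 f : (forall x, 0 <= f x) -> 0 <= E f.
Proof. by move=> f0; exact: Rintegral_ge0. Qed.

(** ** Moments *)

Fact Nr_key : unit. Proof. exact: tt. Qed.

(** The norm of [L^r] as a real number: tame functions have all moments. *)
Definition Nr : R -> (T -> R) -> R :=
  locked_with Nr_key (fun r f => (E (fun x => `|f x| `^ r)) `^ r^-1).

Lemma NrE r f : Nr r f = (E (fun x => `|f x| `^ r)) `^ r^-1.
Proof. by rewrite /Nr unlock. Qed.

Lemma Nr_ge0 r f : 0 <= Nr r f. Proof. by rewrite NrE; exact: powR_ge0. Qed.

Lemma eq_Nr r f g : f =1 g -> Nr r f = Nr r g.
Proof. by move=> /funext ->. Qed.

Lemma expect_fin f : tame f -> ((E f)%:E = \int[mu]_x (f x)%:E)%E.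
Proof.
move=> tf; rewrite /Rintegral fineK//; apply: integrable_fin_num => //.
exact: tame_integrable.
Qed.

Lemma Lnorm_Nr r f : 0 < r -> tame f ->
  'N[mu]_(r%:E)[EFin \o f]%E = (Nr r f)%:E.
Proof.
move=> r0 tf; rewrite unlock NrE -poweR_EFin expect_fin//; last first.
  by apply: tame_powR => //; exact: ltW.
Qed.

Lemma Nr_powR r f : 0 < r -> Nr r f `^ r = E (fun x => `|f x| `^ r).
Proof.
move=> r0; rewrite NrE -powRrM mulVf ?gt_eqF// powRr1//.
by apply: expect_ge0 => x; exact: powR_ge0.
Qed.

Lemma hoelder_Nr p q f g : 0 < p -> 0 < q -> p^-1 + q^-1 = 1 ->
  tame f -> tame g -> E (fun x => `|f x| * `|g x|) <= Nr p f * Nr q g.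
Proof.
move=> p0 q0 pq tf tg.
have := hoelder mu (tame_measurable tf) (tame_measurable tg) p0 q0 pq.
rewrite !Lnorm_Nr//; last exact: tameM.
rewrite -EFinM lee_fin; apply: le_trans; rewrite NrE invr1 powRr1; last first.
  by apply: expect_ge0 => x; exact: powR_ge0.
by apply: le_of_eq; apply: eq_Rintegral => x _;
  rewrite powRr1// normrM.
Qed.

Lemma minkowski_Nr r f g : 1 <= r -> tame f -> tame g ->
  Nr r (fun x => f x + g x) <= Nr r f + Nr r g.
Proof.
move=> r1 tf tg; have r0 : 0 < r by exact: lt_le_trans r1.
have := minkowski_EFin mu (tame_measurable tf) (tame_measurable tg) r1.
by rewrite !Lnorm_Nr//; exact: tameD.
Qed.

Lemma Nr_le r f g : 0 < r -> tame f -> tame g -> (forall x, `|f x| <= `|g x|) ->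
  Nr r f <= Nr r g.
Proof.
move=> r0 tf tg fg; rewrite !NrE ge0_ler_powR ?invr_ge0 ?(ltW r0) ?nnegrE//.
- by apply: expect_ge0 => x; exact: powR_ge0.
- by apply: expect_ge0 => x; exact: powR_ge0.
apply: expect_le; [exact/tame_powR/tf/ltW|exact/tame_powR/tg/ltW|].
by move=> x; rewrite ge0_ler_powR ?(ltW r0) ?nnegrE.
Qed.

Lemma NrZ r (c : R) f : 0 < r -> tame f -> Nr r (fun x => c * f x) = `|c| * Nr r f.
Proof.
move=> r0 tf; rewrite !NrE.
have -> : E (fun x => `|c * f x| `^ r) = `|c| `^ r * E (fun x => `|f x| `^ r).
  rewrite -expectZ; last exact/tame_powR/tf/ltW.
  by apply: eq_Rintegral => x _; rewrite normrM powRM.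
rewrite powRM ?powR_ge0//; last by apply: expect_ge0 => x; exact: powR_ge0.
by rewrite -powRrM divff ?gt_eqF// powRr1.
Qed.

Lemma Nr_cst r (c : R) : 0 < r -> Nr r (fun=> c) = `|c|.
Proof.
by move=> r0; rewrite NrE expect_cst -powRrM divff ?gt_eqF// powRr1.
Qed.

End tame.
Arguments tame {d T R} w f.
Arguments Nr {d T R} mu r f.

(** ** Complex-valued functions *)

Section modulus.
Context {R : realType}.
Implicit Types (z t : R[i]) (r : R).

Lemma cReD z t : complex.Re (z + t) = complex.Re z + complex.Re t.
Proof. by case: z => ? ?; case: t. Qed.
Lemma cImD z t : complex.Im (z + t) = complex.Im z + complex.Im t.
Proof. by case: z => ? ?; case: t. Qed.
Lemma cReM z t : complex.Re (z * t) =
  complex.Re z * complex.Re t - complex.Im z * complex.Im t.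
Proof. by case: z => ? ?; case: t. Qed.
Lemma cImM z t : complex.Im (z * t) =
  complex.Re z * complex.Im t + complex.Im z * complex.Re t.
Proof. by case: z => ? ?; case: t. Qed.
Lemma eq_ReIm z t : complex.Re z = complex.Re t ->
  complex.Im z = complex.Im t -> z = t.
Proof. by case: z => ? ?; case: t => ? ? /= -> ->. Qed.

Lemma nc_sqr z : nc z ^+ 2 = complex.Re z ^+ 2 + complex.Im z ^+ 2.
Proof. by case: z => a b /=; rewrite sqr_sqrtr// addr_ge0// sqr_ge0. Qed.

Lemma nc_ge0 z : 0 <= nc z. Proof. by case: z => a b; exact: sqrtr_ge0. Qed.
Lemma ncM z t : nc (z * t) = nc z * nc t. Proof. exact: ComplexField.Normc.normcM. Qed.
Lemma ncD z t : nc (z + t) <= nc z + nc t. Proof. exact: le_normcD. Qed.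
Lemma ncN z : nc (- z) = nc z. Proof. exact: normcN. Qed.
Lemma ncB z t : nc (z - t) <= nc z + nc t.
Proof. by rewrite -(ncN t); exact: ncD. Qed.
Lemma nc0 : nc (0 : R[i]) = 0. Proof. exact: ComplexField.Normc.normc0. Qed.
Lemma nc1 : nc (1 : R[i]) = 1. Proof. exact: ComplexField.Normc.normc1. Qed.
Lemma ncV z : nc z^-1 = (nc z)^-1. Proof. exact: ComplexField.Normc.normcV. Qed.
Lemma nc_eq0 z : (nc z == 0) = (z == 0).
Proof.
by apply/eqP/eqP => [/ComplexField.Normc.eq0_normc|->]//; exact: nc0.
Qed.
Lemma nc_real r : nc (real_complex R r) = `|r|.
Proof. by rewrite /= expr0n/= addr0 sqrtr_sqr. Qed.
Lemma nc_conj z : nc (conjc z) = nc z.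
Proof. by case: z => a b /=; rewrite sqrrN. Qed.
Lemma nc_Re z : `|complex.Re z| <= nc z.
Proof.
rewrite -[leLHS]sqrtr_sqr; case: z => a b /=.
by apply: ler_wsqrtr; rewrite lerDl sqr_ge0.
Qed.
Lemma nc_Im z : `|complex.Im z| <= nc z.
Proof.
rewrite -[leLHS]sqrtr_sqr; case: z => a b /=.
by apply: ler_wsqrtr; rewrite lerDr sqr_ge0.
Qed.
Lemma nc_leD z : nc z <= `|complex.Re z| + `|complex.Im z|.
Proof.
rewrite -(@ler_pXn2r _ 2)// ?nnegrE ?nc_ge0 ?addr_ge0// nc_sqr sqrrD !real_normK ?num_real//.
by rewrite addrAC lerDl mulrn_wge0// mulr_ge0.
Qed.
Lemma nc_dist z t : nc z - nc t <= nc (z - t).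
Proof. by rewrite lerBlDr (le_trans _ (ncD _ _))// subrK. Qed.

Lemma conjcM z : conjc z * z = real_complex R (nc z ^+ 2).
Proof.
apply: eq_ReIm; rewrite ?nc_sqr; case: z => a b /=; by ring.
Qed.

Lemma nc_norm_conj z : nc z != 0 ->
  exists2 t, nc t = 1 & t * z = real_complex R (nc z).
Proof.
move=> z0; exists (conjc z * real_complex R (nc z)^-1).
  rewrite ncM nc_conj nc_real ger0_norm ?invr_ge0 ?nc_ge0//.
  by rewrite divff.
rewrite mulrAC conjcM -rmorphM/=.
by congr (real_complex R _); rewrite expr2 mulfK.
Qed.

End modulus.

Section ctame.
Context {d} {T : measurableType d} {R : realType}
  {mu : {measure set T -> \bar R}} {w : T -> R} {muw : exp_integrable mu w}.
Implicit Types (F H : T -> R[i]) (c : R[i]).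
Local Notation E := (Rintegral mu setT).

Definition ctame F :=
  tame w (fun x => complex.Re (F x)) /\ tame w (fun x => complex.Im (F x)).

Lemma eq_ctame F H : F =1 H -> ctame F -> ctame H.
Proof. by move=> /funext ->. Qed.

Lemma ctame_cst c : ctame (fun=> c).
Proof. by split; exact: tame_cst. Qed.

Lemma ctame_real (f : T -> R) : tame w f -> ctame (fun x => real_complex R (f x)).
Proof. by move=> tf; split => //=; exact: tame_cst. Qed.

Lemma ctameD F H : ctame F -> ctame H -> ctame (fun x => F x + H x).
Proof.
by move=> [a b] [a' b']; split; [under eq_fun do rewrite cReD|
  under eq_fun do rewrite cImD]; exact: tameD.
Qed.

Lemma ctameM F H : ctame F -> ctame H -> ctame (fun x => F x * H x).
Proof.
move=> [a b] [a' b']; split.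
  by under eq_fun do rewrite cReM; apply: tameB; exact: tameM.
by under eq_fun do rewrite cImM; apply: tameD; exact: tameM.
Qed.

Lemma ctameZ c F : ctame F -> ctame (fun x => c * F x).
Proof. by apply: ctameM; exact: ctame_cst. Qed.

Lemma ctameN F : ctame F -> ctame (fun x => - F x).
Proof. by move=> /(ctameZ (-1)); apply: eq_ctame => x; rewrite mulN1r. Qed.

Lemma ctameB F H : ctame F -> ctame H -> ctame (fun x => F x - H x).
Proof. by move=> tF tH; apply: ctameD => //; exact: ctameN. Qed.

Lemma ctame_conj F : ctame F -> ctame (fun x => conjc (F x)).
Proof.
move=> [a b]; split.
  by apply: (eq_ind _ (tame w) a); apply/funext => x; case: (F x).
by apply: (eq_ind _ (tame w) (tameN b)); apply/funext => x; case: (F x).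
Qed.

Lemma ctame_sum (I : Type) (s : seq I) (F : I -> T -> R[i]) :
  (forall i, ctame (F i)) -> ctame (fun x => \sum_(i <- s) F i x).
Proof.
move=> tF; elim: s => [|i s IH].
  by apply: eq_ctame (ctame_cst 0) => x; rewrite big_nil.
by apply: eq_ctame (ctameD (tF i) IH) => x; rewrite big_cons.
Qed.

Lemma tame_nc F : ctame F -> tame w (fun x => nc (F x)).
Proof.
move=> [a b].
have -> : (fun x => nc (F x)) =
   (fun x => Num.sqrt (complex.Re (F x) ^+ 2 + complex.Im (F x) ^+ 2)).
  by apply/funext => x; rewrite -nc_sqr sqrtr_sqr ger0_norm// nc_ge0.
by apply: tame_sqrt; apply: tameD; exact: tameM.
Qed.

Definition EC F : R[i] :=
  Complex (E (fun x => complex.Re (F x))) (E (fun x => complex.Im (F x))).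

Lemma eq_EC F H : F =1 H -> EC F = EC H.
Proof. by move=> /funext ->. Qed.

Lemma EC_cst c : EC (fun=> c) = c.
Proof. by apply: eq_ReIm; exact: expect_cst. Qed.

Lemma EC_D F H : ctame F -> ctame H -> EC (fun x => F x + H x) = EC F + EC H.
Proof.
move=> [a b] [a' b']; apply: eq_ReIm; rewrite ?cReD ?cImD/= -expectD//.
  by apply: eq_Rintegral => x _; rewrite cReD.
by apply: eq_Rintegral => x _; rewrite cImD.
Qed.

Lemma EC_Z c F : ctame F -> EC (fun x => c * F x) = c * EC F.
Proof.
move=> [a b]; apply: eq_ReIm; rewrite ?cReM ?cImM/= -!expectZ//.
  by rewrite -expectB//; [apply: eq_Rintegral => x _; rewrite cReM|
    exact: tameZ|exact: tameZ].
by rewrite -expectD//; [apply: eq_Rintegral => x _; rewrite cImM|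
  exact: tameZ|exact: tameZ].
Qed.

Lemma EC_N F : ctame F -> EC (fun x => - F x) = - EC F.
Proof.
by move=> tF; rewrite -mulN1r -EC_Z//; apply: eq_EC => x; rewrite mulN1r.
Qed.

Lemma EC_B F H : ctame F -> ctame H -> EC (fun x => F x - H x) = EC F - EC H.
Proof. by move=> tF tH; rewrite EC_D ?EC_N//; exact: ctameN. Qed.

Lemma EC_sum (I : Type) (s : seq I) (F : I -> T -> R[i]) :
  (forall i, ctame (F i)) ->
  EC (fun x => \sum_(i <- s) F i x) = \sum_(i <- s) EC (F i).
Proof.
move=> tF; elim: s => [|i s IH].
  by rewrite big_nil -[RHS]EC_cst; apply: eq_EC => x; rewrite big_nil.
rewrite big_cons -IH -EC_D//; last exact: ctame_sum.
by apply: eq_EC => x; rewrite big_cons.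
Qed.

Lemma EC_real (f : T -> R) : EC (fun x => real_complex R (f x)) = real_complex R (E f).
Proof. by apply: eq_ReIm => //=; rewrite expect_cst. Qed.

(** Multiplying by a unit complex number makes the expectation real. *)
Lemma nc_EC F : ctame F -> nc (EC F) <= E (fun x => nc (F x)).
Proof.
move=> tF; have [->|z0] := eqVneq (nc (EC F)) 0.
  by apply: expect_ge0 => x; exact: nc_ge0.
have [t t1 tz] := nc_norm_conj z0.
have : complex.Re (EC (fun x => t * F x)) = nc (EC F) by rewrite EC_Z// tz.
move=> <-; apply: expect_le; [by case: (ctameZ t tF)|exact: tame_nc|].
by move=> x; rewrite (le_trans (ler_norm _))// (le_trans (nc_Re _))// ncM t1 mul1r.
Qed.

Lemma nc_EC_hoelder p q F H : 0 < p -> 0 < q -> p^-1 + q^-1 = 1 ->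
  ctame F -> ctame H ->
  nc (EC (fun x => F x * H x)) <=
  Nr mu p (fun x => nc (F x)) * Nr mu q (fun x => nc (H x)).
Proof.
move=> p0 q0 pq tF tH; apply: le_trans (nc_EC (ctameM tF tH)) _.
apply: le_trans (hoelder_Nr p0 q0 pq (tame_nc tF) (tame_nc tH)).
apply: le_of_eq; apply: eq_Rintegral => x _.
by rewrite ncM !ger0_norm ?nc_ge0.
Qed.

Lemma Nr_ncD r F H : 1 <= r -> ctame F -> ctame H ->
  Nr mu r (fun x => nc (F x + H x)) <=
  Nr mu r (fun x => nc (F x)) + Nr mu r (fun x => nc (H x)).
Proof.
move=> r1 tF tH; apply: le_trans (minkowski_Nr r1 (tame_nc tF) (tame_nc tH)).
apply: Nr_le; first exact: lt_le_trans r1.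
- exact: (tame_nc (ctameD tF tH)).
- by apply: tameD; exact: tame_nc.
- by move=> x; rewrite !ger0_norm ?addr_ge0 ?nc_ge0// ncD.
Qed.

Lemma Nr_ncZ r c F : 0 < r -> ctame F ->
  Nr mu r (fun x => nc (c * F x)) = nc c * Nr mu r (fun x => nc (F x)).
Proof.
move=> r0 tF; have E1 := NrZ (mu := mu) (nc c) r0 (tame_nc tF).
rewrite (ger0_norm (nc_ge0 c)) in E1.
rewrite -E1; apply: eq_Nr => x.
exact: ncM.
Qed.

End ctame.
Arguments ctame {d T R} w F.
Arguments EC {d T R} mu F.

(** * Gaussian expectations *)

Section gaussian_expectation.
Context {R : realType} {n : nat}.
Implicit Types x y v : Rn R n.
Local Notation G := (gaussian R n).
Local Notation T := (Rn R n * Rn R n)%type.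

Definition wt x : R := \sum_i `|tnth x i|.
Definition wt2 (z : T) : R := wt z.1 + wt z.2.

Lemma measurable_wt : measurable_fun setT wt.
Proof.
apply: measurable_sum => i; apply: measurableT_comp => //.
exact: measurable_tnth.
Qed.

Lemma wt_ge0 x : 0 <= wt x. Proof. exact: sumr_ge0. Qed.

(** The Cameron-Martin formula for the constant function [1]. *)
Lemma gaussian_exp_moment v :
  (\int[G]_x (expR (\sum_j tnth v j * tnth x j))%:E =
   (expR ((\sum_j tnth v j ^+ 2) / 2))%:E)%E.
Proof.
have := @ge0_integral_gaussian_shift R n (fun=> 1%E) 1 v
  (measurable_cst _) (fun=> lee01).
have -> : (\int[G]_x 1 = 1)%E by rewrite integral_cst// mul1e; exact: gaussian_setT.
move=> /esym; rewrite expr1n !mul1r.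
under eq_integral do rewrite mul1e mul1r.
have -> : (fun x => (expR (\sum_j tnth v j * tnth x j -
    (\sum_j tnth v j ^+ 2) / 2))%:E) =
   (fun x => (expR (- ((\sum_j tnth v j ^+ 2) / 2)))%:E *
     (expR (\sum_j tnth v j * tnth x j))%:E)%E.
  by apply/funext => x; rewrite -EFinM -expRD addrC.
have mv : measurable_fun setT
    (fun x : Rn R n => (expR (\sum_j tnth v j * tnth x j))%:E).
  apply/measurable_EFinP; apply: measurableT_comp => //.
  apply: measurable_sum => j.
  by apply: measurable_funM => //; exact: measurable_tnth.
rewrite (ge0_integralZl G measurableT mv)//.
set I := (\int[G]_x _)%E; set q := (_ / 2) => H.
have -> : I = ((expR q)%:E * ((expR (- q))%:E * I))%E.
  by rewrite muleA -EFinM -expRD subrr expR0 mul1e.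
by rewrite H mule1.
Qed.

(** The exponential of a sum of absolute values is one of the [2 ^ n]
    exponentials of linear forms with the same coefficients up to signs. *)
Lemma integrable_exp_wt (K : R) :
  G.-integrable setT (fun x => (expR (K * wt x))%:E).
Proof.
pose v (s : {ffun 'I_n -> bool}) : Rn R n := [tuple K * (-1) ^+ (s i : bool) | i < n].
have mv s : measurable_fun setT
   (fun x : Rn R n => expR (\sum_j tnth (v s) j * tnth x j)).
  apply: measurableT_comp => //; apply: measurable_sum => j.
  by apply: measurable_funM => //; exact: measurable_tnth.
have iv : G.-integrable setT
   (fun x => (\sum_s expR (\sum_j tnth (v s) j * tnth x j))%:E).
  under eq_fun do rewrite -sumEFin.
  apply: integrable_sum => // s _.
  apply/integrableP; split; first exact/measurable_EFinP.
  under eq_integral do rewrite gee0_abs ?lee_fin ?expR_ge0//.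
  by rewrite gaussian_exp_moment ltry.
apply: le_integrable iv => //.
  apply/measurable_EFinP; apply: measurableT_comp => //.
  by apply: measurable_funM => //; exact: measurable_wt.
move=> x _ /=; rewrite lee_fin ger0_norm ?expR_ge0// ger0_norm; last first.
  by apply: sumr_ge0 => s _; exact: expR_ge0.
pose s0 : {ffun 'I_n -> bool} := [ffun i => tnth x i < 0].
rewrite (bigD1 s0)//= -[leLHS]addr0 lerD//; last first.
  by apply: sumr_ge0 => s _; exact: expR_ge0.
rewrite ler_expR.
apply: le_of_eq.
rewrite /wt mulr_sumr; apply: eq_bigr => i _.
rewrite tnth_mktuple ffunE -mulrA; congr (_ * _).
have [x0|x0] := ltP (tnth x i) 0; first by rewrite ltr0_norm// expr1 mulN1r.
by rewrite ger0_norm// expr0 mul1r.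
Qed.

#[export] Instance gaussian_exp_integrable : exp_integrable G wt.
Proof.
split; [exact: measurable_wt|exact: wt_ge0|exact: integrable_exp_wt|].
exact: gaussian_setT.
Qed.

#[export] Instance gaussian2_exp_integrable : exp_integrable (G \x G)%E wt2.
Proof.
have mw : measurable_fun setT wt2.
  by apply: measurable_funD; exact: (measurableT_comp measurable_wt).
split => //.
- by move=> z; rewrite addr_ge0// wt_ge0.
- move=> K; apply/integrableP; split.
    apply/measurable_EFinP; apply: measurableT_comp => //.
    exact: measurable_funM.
  have mF : measurable_fun setT (fun z => `|(expR (K * wt2 z))%:E|%E).
    apply/measurableT_comp => //; apply/measurable_EFinP.
    by apply: measurableT_comp => //; exact: measurable_funM.
  rewrite (@fubini_tonelli1 _ _ _ _ R G G _ mF)//= /fubini_F/=.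
  set C := (\int[G]_y (expR (K * wt y))%:E)%E.
  have CE x : (\int[G]_y `|expR (K * wt2 (x, y))|%:E = (expR (K * wt x))%:E * C)%E.
    rewrite -ge0_integralZl//=.
    - apply: eq_integral => y _; rewrite ger0_norm ?expR_ge0//.
      by rewrite /wt2/= mulrDr expRD EFinM.
    - apply/measurable_EFinP; apply: measurableT_comp => //.
      by apply: measurable_funM => //; exact: measurable_wt.
  under eq_integral do rewrite CE.
  have C0 : (0 <= C)%E by apply: integral_ge0 => y _; rewrite lee_fin expR_ge0.
  have Cf : (C < +oo)%E.
    have /integrableP[_] := integrable_exp_wt K.
    by under eq_integral do rewrite gee0_abs ?lee_fin ?expR_ge0//.
  rewrite ge0_integralZr//=.
  + by rewrite lte_mul_pinfty// ge0_fin_numE.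
  + apply/measurable_EFinP; apply: measurableT_comp => //.
    by apply: measurable_funM => //; exact: measurable_wt.
- have := @product_measure1E _ _ _ _ R G G _ _ measurableT measurableT.
  rewrite setXTT => E1; apply: (etrans E1).
  by transitivity (1 * 1 : \bar R)%E; [congr (_ * _)%E; exact: gaussian_setT|exact: mul1e].
Qed.

Local Notation E := (Rintegral G setT).
Local Notation E2 := (Rintegral (G \x G)%E setT).

Lemma tame_coord i : tame wt (fun x => tnth x i).
Proof.
apply: (tame_le _ (tame_w (mu := G))) => [|x]; first exact: measurable_tnth.
rewrite [leRHS]ger0_norm ?wt_ge0// /wt (bigD1 i)//= lerDl.
exact: sumr_ge0.
Qed.

Lemma tame_lincomb (a b a' b' : R) (h : T -> R) : tame wt2 h ->
  tame wt2 (fun z => h (lincomb a b z.1 z.2, lincomb a' b' z.1 z.2)).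
Proof.
move=> [mh [K K0 hK]].
have wl (c e : R) x y : wt (lincomb c e x y) <= `|c| * wt x + `|e| * wt y.
  rewrite /wt !mulr_sumr -big_split/= ler_sum// => i _.
  by rewrite tnth_lincomb (le_trans (ler_normD _ _))// !normrM.
apply: (@tame_bound _ _ _ _ _ gaussian2_exp_integrable _ K
   (K * (`|a| + `|b| + (`|a'| + `|b'|)))).
  apply: measurableT_comp => //.
  by apply: measurable_fun_pair; exact: measurable_lincomb.
move=> [x y]; rewrite (le_trans (hK _))// ler_wpM2l// ler_expR -mulrA ler_wpM2l//.
rewrite /wt2/= (le_trans (lerD (wl _ _ _ _) (wl _ _ _ _)))//.
have := wt_ge0 x; have := wt_ge0 y.
have := normr_ge0 a; have := normr_ge0 b; have := normr_ge0 a'.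
have := normr_ge0 b'; nra.
Qed.

Lemma tame_fst (h : Rn R n -> R) : tame wt h -> tame wt2 (fun z => h z.1).
Proof.
move=> [mh [K K0 hK]].
apply: (@tame_bound _ _ _ _ _ gaussian2_exp_integrable _ K K).
  exact: measurableT_comp.
move=> [x y]; rewrite (le_trans (hK _))// ler_wpM2l// ler_expR ler_wpM2l//.
by rewrite lerDl wt_ge0.
Qed.

Lemma tame_snd (h : Rn R n -> R) : tame wt h -> tame wt2 (fun z => h z.2).
Proof.
move=> [mh [K K0 hK]].
apply: (@tame_bound _ _ _ _ _ gaussian2_exp_integrable _ K K).
  exact: measurableT_comp.
move=> [x y]; rewrite (le_trans (hK _))// ler_wpM2l// ler_expR ler_wpM2l//.
by rewrite lerDr wt_ge0.
Qed.

Lemma tame_section (h : T -> R) x : tame wt2 h -> tame wt (fun y => h (x, y)).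
Proof.
move=> [mh [K K0 hK]].
apply: (@tame_bound _ _ _ _ _ gaussian_exp_integrable _ (K * expR (K * wt x)) K).
  exact: measurableT_comp mh (measurable_pair1 x).
by move=> y; rewrite (le_trans (hK _))// -mulrA ler_wpM2l// -expRD -mulrDr.
Qed.

Lemma tame_expect_section (h : T -> R) : tame wt2 h ->
  tame wt (fun x => E (fun y => h (x, y))).
Proof.
move=> th; have [mh [K K0 hK]] := th.
pose proof (tame_integrable (mu := (G \x G)%E) th) as ih.
pose proof (tame_expw (mu := G) (w := wt) K) as te.
apply: (@tame_bound _ _ _ _ _ gaussian_exp_integrable _
   (K * E (fun y => expR (K * wt y))) K).
  have := measurable_fubini_F ih.
  rewrite /fubini_F.
  have -> : (fun x => \int[G]_y (EFin \o h) (x, y))%E =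
      EFin \o (fun x => E (fun y => h (x, y))).
    by apply/funext => x; rewrite /= -expect_fin//; exact: tame_section.
  by move/measurable_EFinP.
move=> x; have ts := tame_section x th.
rewrite (le_trans (le_normr_Rintegral _ (tame_integrable ts)))//.
have -> : K * E (fun y => expR (K * wt y)) * expR (K * wt x) =
  E (fun y => (K * expR (K * wt x)) * expR (K * wt y)).
  by rewrite expectZ// mulrAC.
apply: expect_le; [exact: tame_norm|exact: tameZ|] => y.
by rewrite (le_trans (hK _))// -mulrA -expRD -mulrDr.
Qed.

Lemma expect_pair (h : T -> R) : tame wt2 h ->
  E2 h = E (fun x => E (fun y => h (x, y))).
Proof.
move=> th; pose proof (tame_integrable (mu := (G \x G)%E) th) as ih.
apply: EFin_inj; rewrite expect_fin// -(integral12_prod_meas1 ih).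
rewrite expect_fin; last exact: tame_expect_section.
by apply: eq_integral => x _; rewrite expect_fin//; exact: tame_section.
Qed.

Lemma expect_rot (c s : R) (h : T -> R) : c ^+ 2 + s ^+ 2 = 1 -> 0 <= c ->
  tame wt2 h ->
  E2 (fun z => h (lincomb c s z.1 z.2, lincomb (- s) c z.1 z.2)) = E2 h.
Proof.
move=> cs c0 th; have mh := tame_measurable th.
have mhE : measurable_fun setT (EFin \o h) by exact/measurable_EFinP.
have mp := measurable_funepos mhE; have mn := measurable_funeneg mhE.
have p0 z : (0 <= (EFin \o h)^\+ z)%E by exact: funepos_ge0.
have n0 z : (0 <= (EFin \o h)^\- z)%E by exact: funeneg_ge0.
congr fine; rewrite integralE [RHS]integralE; congr (_ - _)%E.
  apply: (etrans _ (ge0_integral_gaussian_rot cs c0 mp p0)).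
  by apply: eq_integral => z _; rewrite !funeposE.
apply: (etrans _ (ge0_integral_gaussian_rot cs c0 mn n0)).
by apply: eq_integral => z _; rewrite !funenegE.
Qed.

Lemma expect_shift (c : R) v (h : Rn R n -> R) :
  tame wt h ->
  E (fun x => h (lincomb 1 c x v)) =
  E (fun x => h x * expR (c * (\sum_j tnth v j * tnth x j)
     - c ^+ 2 * (\sum_j tnth v j ^+ 2) / 2)).
Proof.
move=> th; have mh := tame_measurable th.
have mhE : measurable_fun setT (EFin \o h) by exact/measurable_EFinP.
have mp := measurable_funepos mhE; have mn := measurable_funeneg mhE.
have p0 z : (0 <= (EFin \o h)^\+ z)%E by exact: funepos_ge0.
have n0 z : (0 <= (EFin \o h)^\- z)%E by exact: funeneg_ge0.
congr fine; rewrite integralE [RHS]integralE; congr (_ - _)%E.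
  transitivity (\int[G]_x ((EFin \o h)^\+ (lincomb 1 c x v))%E)%E.
    by apply: eq_integral => x _; rewrite !funeposE.
  apply: (etrans (ge0_integral_gaussian_shift c v mp p0)).
  apply: eq_integral => x _; rewrite !funeposE/= EFinM.
  by rewrite maxe_pMl ?mul0e// lee_fin expR_ge0.
transitivity (\int[G]_x ((EFin \o h)^\- (lincomb 1 c x v))%E)%E.
  by apply: eq_integral => x _; rewrite !funenegE.
apply: (etrans (ge0_integral_gaussian_shift c v mn n0)).
apply: eq_integral => x _; rewrite !funenegE/=.
by rewrite maxe_pMl ?mul0e -?EFinM ?mulNr// lee_fin expR_ge0.
Qed.

End gaussian_expectation.

Section complex_gaussian.
Context {R : realType} {n : nat}.
Local Notation G := (gaussian R n).
Local Notation T := (Rn R n * Rn R n)%type.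
Local Notation wt := (@wt R n).
Local Notation wt2 := (@wt2 R n).

Lemma ctame_section (F : T -> R[i]) x : ctame wt2 F ->
  ctame wt (fun y => F (x, y)).
Proof.
by move=> [a b]; split; [exact: (tame_section x a)|exact: (tame_section x b)].
Qed.

Lemma EC_pair (F : T -> R[i]) : ctame wt2 F ->
  EC (G \x G)%E F = EC G (fun x => EC G (fun y => F (x, y))).
Proof.
by move=> [a b]; apply: eq_ReIm; [exact: (expect_pair a)|exact: (expect_pair b)].
Qed.

Lemma EC_rot (c s : R) (F : T -> R[i]) : c ^+ 2 + s ^+ 2 = 1 -> 0 <= c ->
  ctame wt2 F ->
  EC (G \x G)%E (fun z => F (lincomb c s z.1 z.2, lincomb (- s) c z.1 z.2)) =
  EC (G \x G)%E F.
Proof.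
move=> cs c0 [a b].
by apply: eq_ReIm; [exact: (expect_rot cs c0 a)|exact: (expect_rot cs c0 b)].
Qed.

Lemma EC_shift (c : R) (v : Rn R n) (F : Rn R n -> R[i]) : ctame wt F ->
  EC G (fun x => F (lincomb 1 c x v)) =
  EC G (fun x => F x * C_ R (expR (c * (\sum_j tnth v j * tnth x j)
     - c ^+ 2 * (\sum_j tnth v j ^+ 2) / 2))).
Proof.
move=> [a b]; apply: eq_ReIm.
  apply: (etrans (expect_shift c v a)); apply: eq_Rintegral => x _.
  by rewrite cReM/= mulr0 subr0.
apply: (etrans (expect_shift c v b)); apply: eq_Rintegral => x _.
by rewrite cImM/= mulr0 add0r.
Qed.

Lemma ctame_fst (F : Rn R n -> R[i]) : ctame wt F -> ctame wt2 (fun z => F z.1).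
Proof. by move=> [a b]; split; [exact: (tame_fst a)|exact: (tame_fst b)]. Qed.

Lemma ctame_snd (F : Rn R n -> R[i]) : ctame wt F -> ctame wt2 (fun z => F z.2).
Proof. by move=> [a b]; split; [exact: (tame_snd a)|exact: (tame_snd b)]. Qed.

Lemma ctame_coord j : ctame wt (fun x : Rn R n => C_ R (tnth x j)).
Proof. by apply: ctame_real; exact: tame_coord. Qed.

End complex_gaussian.

(** * Polynomials *)

Section polynomials.
Context {R : realType} {n : nat}.
Implicit Types (f g : cpoly R n) (z v : 'I_n -> R[i]).

Definition Xvar (j : 'I_n) : cpoly R n := @mpolyX n R[i] (mnm1 j).

(** Induction over the ring operations rather than over monomials. *)
Lemma mpoly_ring_ind (P : cpoly R n -> Prop) :
  (forall c, P (mpolyC n c)) -> (forall j, P (Xvar j)) ->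
  (forall f g, P f -> P g -> P (f + g)) ->
  (forall f g, P f -> P g -> P (f * g)) -> forall f, P f.
Proof.
move=> PC PX PD PM f; rewrite (mpolyE f).
apply: (big_ind P) => [|//|m _]; first by rewrite -(mpolyC0 n R[i]).
rewrite -mul_mpolyC; apply: (PM) => //; rewrite mpolyXE_id.
apply: (big_ind P) => [|f' g'|j _]; first by rewrite -(mpolyC1 n R[i]).
  exact: PM.
elim: (m j) => [|k IH]; first by rewrite expr0 -(mpolyC1 n R[i]).
by rewrite exprS; apply: (PM) => //; exact: PX.
Qed.

Lemma mevalXvar v j : meval v (Xvar j) = v j. Proof. exact: mevalXU. Qed.

Lemma mderivXvar i j : mderiv i (Xvar j) = mpolyC n ((i == j)%:R : R[i]).
Proof.
rewrite /Xvar mderivX mnm1E eq_sym; case: eqVneq => [->|_].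
  rewrite scale1r (_ : mnm_sub _ _ = mnm0) ?mpolyX0 ?mpolyC1//.
  by apply/mnmP => k; rewrite mnmBE mnm0E subnn.
by rewrite scale0r mpolyC0.
Qed.

Lemma ctame_meval {d} {T : measurableType d} {mu : {measure set T -> \bar R}}
    {w : T -> R} {muw : exp_integrable mu w} (z : T -> 'I_n -> R[i]) f :
  (forall j, ctame w (fun x => z x j)) -> ctame w (fun x => meval (z x) f).
Proof.
move=> tz; elim/mpoly_ring_ind: f => [c|j|f g tf tg|f g tf tg].
- by under eq_fun do rewrite mevalC; exact: ctame_cst.
- by under eq_fun do rewrite mevalXvar; exact: tz.
- by under eq_fun do rewrite mevalD; exact: ctameD.
- by under eq_fun do rewrite mevalM; exact: ctameM.
Qed.

Lemma ctame_peval f : ctame (@wt R n) (peval f).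
Proof. by apply: ctame_meval => j; exact: ctame_coord. Qed.

(** ** First-order Taylor expansion *)

(** One parameter for both the size and the degree of a polynomial bound. *)
Let pb (K : nat) (M : R) := K%:R * M ^+ K.

Let pb_ge0 K M : 1 <= M -> 0 <= pb K M.
Proof. by move=> M1; rewrite mulr_ge0// exprn_ge0// (le_trans ler01). Qed.

Let pbD K L M : 1 <= M -> pb K M + pb L M <= pb (K + L) M.
Proof.
move=> M1; rewrite /pb natrD mulrDl lerD// ler_wpM2l// ler_weXn2l//.
  exact: leq_addr.
exact: leq_addl.
Qed.

Let pbM K L M : 1 <= M -> pb K M * pb L M <= pb (K * L + (K + L)) M.
Proof.
move=> M1; rewrite /pb mulrACA -natrM -exprD ler_pM//.
- by rewrite exprn_ge0// (le_trans ler01).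
- by rewrite ler_nat leq_addr.
- by rewrite ler_weXn2l// leq_addl.
Qed.

Lemma meval_bound f : exists K : nat, forall z (M : R), 1 <= M ->
  (forall j, nc (z j) <= M) -> nc (meval z f) <= K%:R * M ^+ K.
Proof.
elim/mpoly_ring_ind: f => [c|j|f g [K fK] [L gL]|f g [K fK] [L gL]].
- have [k ck] : exists k : nat, nc c <= k%:R.
    by exists (Num.bound (nc c)); rewrite ltW// archi_boundP// nc_ge0.
  exists k => z M M1 _; rewrite mevalC (le_trans ck)// ler_peMr//.
  exact: exprn_ege1.
- by exists 1%N => z M M1 zM; rewrite mevalXvar mul1r expr1.
- exists (K + L)%N => z M M1 zM; rewrite mevalD (le_trans (ncD _ _))//.
  by rewrite (le_trans _ (pbD K L M1))// lerD ?fK ?gL.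
- exists (K * L + (K + L))%N => z M M1 zM; rewrite mevalM ncM.
  by rewrite (le_trans _ (pbM K L M1))// ler_pM ?nc_ge0 ?fK ?gL.
Qed.

Definition dir_deriv f z v : R[i] := \sum_j meval z (mderiv j f) * v j.

Lemma dir_deriv_bound f : exists K : nat, forall z v (M : R), 1 <= M ->
  (forall j, nc (z j) <= M) -> (forall j, nc (v j) <= M) ->
  nc (dir_deriv f z v) <= K%:R * M ^+ K.
Proof.
rewrite /dir_deriv; elim: (index_enum _) => [|j s [K sK]].
  by exists 0%N => z v M M1 _ _; rewrite big_nil nc0 mul0r.
have [L jL] := meval_bound (mderiv j f).
exists ((L * 1 + (L + 1)) + K)%N => z v M M1 zM vM; rewrite big_cons.
rewrite (le_trans (ncD _ _))// (le_trans _ (pbD _ _ M1))// lerD//; last first.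
  exact: sK.
rewrite ncM (le_trans _ (pbM _ _ M1))// ler_pM ?nc_ge0 ?jL//.
by rewrite /pb mul1r expr1.
Qed.

Lemma dir_derivM f g z v : dir_deriv (f * g) z v =
  dir_deriv f z v * meval z g + meval z f * dir_deriv g z v.
Proof.
rewrite /dir_deriv mulr_suml mulr_sumr -big_split/=; apply: eq_bigr => j _.
by rewrite mderivM mevalD !mevalM mulrDl mulrAC mulrA.
Qed.

Let taylor_mul_identity (A : comRingType) (f' f df g' g dg t : A) :
  f' * g' - f * g - t * (df * g + f * dg) =
  (f' - f - t * df) * g' + f * (g' - g - t * dg) + t * df * (g' - g).
Proof. ring. Qed.

(** The point [z'] need not lie on the line through [z] directed by [v]: an
    error of second order is allowed, since the expansion is also used along a
    circle. The bound is polynomial in the size [M] of the data, so that it can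
    be integrated. *)
Lemma taylor1 f : exists K : nat, forall z v z' (M t : R), 1 <= M -> `|t| <= 1 ->
  (forall j, nc (z j) <= M) -> (forall j, nc (v j) <= M) ->
  (forall j, nc (z' j) <= M) ->
  (forall j, nc (z' j - z j - C_ R t * v j) <= t ^+ 2 * M) ->
  nc (meval z' f - meval z f - C_ R t * dir_deriv f z v) <= t ^+ 2 * (K%:R * M ^+ K).
Proof.
have t20 (t : R) : 0 <= t ^+ 2 by exact: sqr_ge0.
elim/mpoly_ring_ind: f => [c|j|f g [K fK] [L gL]|f g [K fK] [L gL]].
- exists 0%N => z v z' M t M1 t1 zM vM z'M zz'.
  rewrite !mevalC subrr sub0r ncN ncM /dir_deriv big1 ?nc0 ?mulr0 ?mul0r ?mulr0//.
  by move=> j _; rewrite mderivC meval0 mul0r.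
- exists 1%N => z v z' M t M1 t1 zM vM z'M zz'.
  rewrite !mevalXvar /dir_deriv (bigD1 j)//= big1 => [|i ij].
    by rewrite addr0 mderivXvar eqxx mevalC mul1r mul1r expr1.
  by rewrite mderivXvar (negPf ij) mevalC mul0r.
- exists (K + L)%N => z v z' M t M1 t1 zM vM z'M zz'.
  have -> : meval z' (f + g) - meval z (f + g) - C_ R t * dir_deriv (f + g) z v =
     (meval z' f - meval z f - C_ R t * dir_deriv f z v) +
     (meval z' g - meval z g - C_ R t * dir_deriv g z v).
    rewrite !mevalD (_ : dir_deriv (f + g) z v = dir_deriv f z v + dir_deriv g z v).
      by rewrite opprD addrACA mulrDr opprD [RHS]addrACA.
    rewrite /dir_deriv -big_split/=; apply: eq_bigr => j _.
    by rewrite mderivD mevalD mulrDl.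
  rewrite (le_trans (ncD _ _))// (le_trans _ (ler_wpM2l (t20 t) (pbD K L M1)))//.
  by rewrite mulrDr lerD// ?fK ?gL.
have [Bf fB] := meval_bound f; have [Bg gB] := meval_bound g.
have [Df fD] := dir_deriv_bound f; have [Dg gD] := dir_deriv_bound g.
exists ((K * Bg + (K + Bg)) + (Bf * L + (Bf + L)) +
  (Df * (L + Dg) + (Df + (L + Dg))))%N => z v z' M t M1 t1 zM vM z'M zz'.
have rf := fK _ _ _ _ _ M1 t1 zM vM z'M zz'.
have rg := gL _ _ _ _ _ M1 t1 zM vM z'M zz'.
have g'g : nc (meval z' g - meval z g) <= `|t| * (pb (L + Dg) M).
  have -> : meval z' g - meval z g =
    (meval z' g - meval z g - C_ R t * dir_deriv g z v) + C_ R t * dir_deriv g z v.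
    by rewrite subrK.
  rewrite (le_trans (ncD _ _))// (le_trans _ (ler_wpM2l (normr_ge0 t) (pbD L Dg M1)))//.
  rewrite mulrDr lerD//.
    rewrite (le_trans rg)// ler_wpM2r ?pb_ge0//.
    by rewrite -(real_normK (num_real t)) expr2 ler_piMl.
  by rewrite ncM nc_real ler_wpM2l// gD.
have -> : meval z' (f * g) - meval z (f * g) - C_ R t * dir_deriv (f * g) z v =
  (meval z' f - meval z f - C_ R t * dir_deriv f z v) * meval z' g
  + meval z f * (meval z' g - meval z g - C_ R t * dir_deriv g z v)
  + C_ R t * dir_deriv f z v * (meval z' g - meval z g).
  by rewrite dir_derivM !mevalM; exact: taylor_mul_identity.
apply: (le_trans (ncD _ _)).
apply: (le_trans _ (ler_wpM2l (t20 t) (pbD _ _ M1))).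
rewrite [leRHS]mulrDr; apply: lerD.
  apply: (le_trans (ncD _ _)).
  apply: (le_trans _ (ler_wpM2l (t20 t) (pbD _ _ M1))).
  rewrite [leRHS]mulrDr; apply: lerD.
    apply: (le_trans _ (ler_wpM2l (t20 t) (pbM _ _ M1))).
    by rewrite ncM mulrA ler_pM ?nc_ge0 ?gB.
  apply: (le_trans _ (ler_wpM2l (t20 t) (pbM _ _ M1))).
  by rewrite ncM mulrCA ler_pM ?nc_ge0 ?fB.
apply: (le_trans _ (ler_wpM2l (t20 t) (pbM _ _ M1))).
have -> : t ^+ 2 * (pb Df M * pb (L + Dg) M) =
    (`|t| * pb Df M) * (`|t| * pb (L + Dg) M).
  by rewrite -(real_normK (num_real t)); ring.
rewrite !ncM nc_real; apply: ler_pM => //; rewrite ?mulr_ge0 ?nc_ge0//.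
by rewrite ler_wpM2l// fD.
Qed.

End polynomials.

(** ** Gaussian integration by parts *)

Section real_facts.
Context {R : realType}.

(** Differentiation at [0] in the form of an inequality between first order
    terms. *)
Lemma le0_of_small (a C : R) : (forall t, 0 < t <= 1 -> a <= t * C) -> a <= 0.
Proof.
move=> H; rewrite leNgt; apply/negP => a0.
have C0 : 0 < C by have := H 1; rewrite ltr01 lexx mul1r => /(_ isT); exact: lt_le_trans.
pose t := Num.min 1 (a / (2 * C)).
have t01 : 0 < t <= 1.
  rewrite /t lt_min ltr01/= divr_gt0 ?mulr_gt0//=.
  by rewrite ge_min lexx.
have := H t t01; apply/negP; rewrite -ltNge.
apply: (@le_lt_trans _ _ (a / (2 * C) * C)).
  by rewrite ler_wpM2r ?(ltW C0)// /t ge_min lexx orbT.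
have -> : a / (2 * C) * C = a / 2 by field; rewrite gt_eqF.
by rewrite ltr_pdivrMr// ltr_pMr// ltr1n.
Qed.

Lemma expR_sub1_bound (a : R) : `|expR a - 1 - a| <= a ^+ 2 * expR `|a|.
Proof.
have e1 := expR_ge1Dx a.
have e2 := expR_ge1Dx (- a).
have ea : expR a * expR (- a) = 1 by rewrite -expRD subrr expR0.
have p0 := expR_gt0 a.
rewrite ger0_norm; last lra.
have up : expR a - 1 - a <= a * (expR a - 1) by nra.
apply: (le_trans up).
have [a0|a0] := leP 0 a.
  rewrite ger0_norm// expr2 -mulrA ler_wpM2l//; nra.
rewrite ltr0_norm// expr2.
have l1 : 1 <= expR (- a) by lra.
have : 0 <= (a * a) * (expR (- a) - 1) by rewrite mulr_ge0 ?subr_ge0// -expr2 sqr_ge0.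
nra.
Qed.

Lemma expR_shift_bound (t v W : R) : 0 <= t <= 1 -> `|v| <= W ->
  `|expR (t * v - t ^+ 2 / 2) - 1 - t * v| <=
  t ^+ 2 * ((W + 1) ^+ 2 * expR (W + 1) + 1).
Proof.
move=> /andP[t0 t1] vW; set a := t * v - t ^+ 2 / 2.
have W0 : 0 <= W by apply: le_trans vW.
have aW : `|a| <= t * (W + 1).
  rewrite /a (le_trans (ler_normB _ _))// normrM (ger0_norm t0).
  rewrite (ger0_norm (_ : 0 <= t ^+ 2 / 2)); last by rewrite divr_ge0 ?sqr_ge0.
  rewrite mulrDr lerD ?ler_wpM2l// mulr1; nra.
have -> : expR a - 1 - t * v = (expR a - 1 - a) - t ^+ 2 / 2 by rewrite /a; ring.
rewrite (le_trans (ler_normB _ _))// mulrDr lerD//; last first.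
  rewrite mulr1 ger0_norm ?divr_ge0 ?sqr_ge0//.
  by rewrite ler_pdivrMr// ler_peMr ?sqr_ge0// ler1n.
rewrite (le_trans (expR_sub1_bound a))// mulrA -exprMn ler_pM ?sqr_ge0 ?expR_ge0//.
  rewrite -(real_normK (num_real a)) ler_pXn2r ?nnegrE//.
  by rewrite mulr_ge0// addr_ge0.
by rewrite ler_expR (le_trans aW)// ler_piMl// addr_ge0.
Qed.

End real_facts.

Section integration_by_parts.
Context {R : realType} {n : nat}.
Local Notation G := (gaussian R n).
Local Notation wt := (@wt R n).
Implicit Types (f : cpoly R n) (z : 'I_n -> R[i]) (y : Rn R n).

Lemma eq_tame (h k : Rn R n -> R) : h =1 k -> tame wt h -> tame wt k.
Proof. by move=> /funext ->. Qed.

Definition affine z0 (b : R[i]) y : 'I_n -> R[i] :=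
  fun i => z0 i + b * C_ R (tnth y i).

Lemma ctame_affine z0 b f : ctame wt (fun y => meval (affine z0 b y) f).
Proof.
apply: ctame_meval => j; apply: ctameD; first exact: ctame_cst.
by apply: ctameZ; exact: ctame_coord.
Qed.

Lemma coord_le_wt y i : `|tnth y i| <= wt y.
Proof. by rewrite /wt (bigD1 i)//= lerDl sumr_ge0. Qed.

Definition unit_tuple (j : 'I_n) : Rn R n := [tuple (i == j)%:R | i < n].

Lemma tameX (h : Rn R n -> R) k : tame wt h -> tame wt (fun y => h y ^+ k).
Proof.
move=> th; elim: k => [|k IH].
  by under eq_fun do rewrite expr0; exact: tame_cst.
by under eq_fun do rewrite exprS; exact: tameM.
Qed.

Lemma sum_unit_tuple j y :
  \sum_i tnth (unit_tuple j) i * tnth y i = tnth y j.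
Proof.
rewrite (bigD1 j)//= big1 => [|i ij]; rewrite tnth_mktuple.
  by rewrite eqxx mul1r addr0.
by rewrite (negPf ij) mul0r.
Qed.

Lemma sum_unit_tuple_sqr j : \sum_i tnth (unit_tuple j) i ^+ 2 = 1.
Proof.
rewrite (bigD1 j)//= big1 => [|i ij]; rewrite tnth_mktuple.
  by rewrite eqxx expr1n addr0.
by rewrite (negPf ij) expr0n.
Qed.

(** Compare the two expressions of [E f (z0 + b (y + t e_j))], by shifting the
    argument and by shifting the measure: their terms of order [t] agree. *)
Lemma gaussian_ibp z0 b f j :
  EC G (fun y => C_ R (tnth y j) * meval (affine z0 b y) f) =
  b * EC G (fun y => meval (affine z0 b y) (mderiv j f)).
Proof.
pose F y := meval (affine z0 b y) f.
pose DF y := meval (affine z0 b y) (mderiv j f).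
have tF : ctame wt F by exact: ctame_affine.
have tDF : ctame wt DF by exact: ctame_affine.
have tyF : ctame wt (fun y => C_ R (tnth y j) * F y).
  by apply: ctameM => //; exact: ctame_coord.
rewrite -/DF -/F; set A := EC G _; set B := b * _.
apply/eqP; rewrite -subr_eq0 -nc_eq0 eq_le nc_ge0 andbT.
have [K fK] := taylor1 f.
pose M y := 1 + \sum_i nc (z0 i) + nc b * (wt y + 1).
have w0 y : 0 <= wt y by exact: wt_ge0.
have s0 : 0 <= \sum_i nc (z0 i) by apply: sumr_ge0 => i _; exact: nc_ge0.
have M1 y : 1 <= M y.
  rewrite /M -addrA lerDl addr_ge0// mulr_ge0 ?nc_ge0//.
  by rewrite addr_ge0.
pose q y := (wt y + 1) ^+ 2 * expR (wt y + 1) + 1.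
have tw : tame wt wt by exact: (tame_w (mu := G)).
have tw1 : tame wt (fun y => wt y + 1) by apply: tameD => //; exact: tame_cst.
have tM : tame wt (fun y => K%:R * M y ^+ K).
  apply: tameZ; apply: tameX; apply: tameD; first exact: tame_cst.
  exact: tameZ.
have te1 : tame wt (fun y => expR (wt y + 1)).
  apply: (eq_tame _ (tameZ (expR 1) (tame_expw (mu := G) (w := wt) 1))) => y.
  by rewrite -expRD mul1r addrC.
have tq : tame wt (fun y => nc (F y) * q y).
  apply: tameM; first exact: tame_nc.
  apply: tameD; last exact: tame_cst.
  by apply: tameM => //; exact: tameX.
apply: (@le0_of_small _ _ (Rintegral G setT (fun y => K%:R * M y ^+ K) +
  Rintegral G setT (fun y => nc (F y) * q y))) => t t01.
have [t0 t1] := andP t01.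
have tn0 : t != 0 by rewrite gt_eqF.
rewrite -(ler_pM2l t0) mulrA -expr2.
pose Fs y := F (lincomb 1 t y (unit_tuple j)).
pose Fe y := F y * C_ R (expR (t * tnth y j - t ^+ 2 / 2)).
have tFs : ctame wt Fs.
  rewrite /Fs /F /affine; apply: ctame_meval => i.
  under eq_fun do rewrite tnth_lincomb.
  apply: ctameD; first exact: ctame_cst.
  apply: ctameZ; apply: ctame_real; apply: tameD; last exact: tame_cst.
  by apply: tameZ; exact: tame_coord.
have FsFe : EC G Fs = EC G Fe.
  apply: (etrans (EC_shift t (unit_tuple j) tF)); apply: eq_EC => y.
  by rewrite sum_unit_tuple sum_unit_tuple_sqr mulr1.
have dF y : dir_deriv f (affine z0 b y) (fun i => b * (i == j)%:R) = b * DF y.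
  rewrite /dir_deriv (bigD1 j)//= big1 => [|i ij].
    by rewrite eqxx mulr1 addr0 mulrC.
  by rewrite (negPf ij) !mulr0.
have coordM y i : nc (affine z0 b y i) + nc b <= M y.
  have zi : nc (z0 i) <= \sum_i nc (z0 i).
    by rewrite (bigD1 i)//= lerDl sumr_ge0// => k _; exact: nc_ge0.
  rewrite /affine /M mulrDr mulr1 addrA lerD2r.
  rewrite (le_trans (ncD _ _))// lerD//; last first.
    by rewrite ncM nc_real ler_wpM2l ?nc_ge0// coord_le_wt.
  by rewrite (le_trans zi)// lerDr.
(* The shift of the argument, to first order. *)
have part1 y : nc (Fs y - F y - C_ R t * (b * DF y)) <= t ^+ 2 * (K%:R * M y ^+ K).
  rewrite -dF; apply: fK => //.
  - by rewrite gtr0_norm.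
  - by move=> i; rewrite (le_trans _ (coordM y i))// lerDl nc_ge0.
  - move=> i; rewrite (le_trans _ (coordM y i))// ncM.
    case: (i == j); rewrite ?nc1 ?nc0 ?mulr1 ?mulr0 ?addr_ge0 ?nc_ge0//.
    by rewrite lerDr nc_ge0.
  - move=> i; rewrite (le_trans _ (coordM y i))//.
    have -> : affine z0 b (lincomb 1 t y (unit_tuple j)) i =
       affine z0 b y i + b * C_ R (t * (i == j)%:R).
      by rewrite /affine tnth_lincomb mul1r tnth_mktuple rmorphD/= mulrDr addrA.
    rewrite (le_trans (ncD _ _))// lerD2l ncM nc_real ler_piMr ?nc_ge0//.
    rewrite normrM gtr0_norm//; case: (i == j); rewrite ?normr1 ?normr0 ?mulr1//.
    by rewrite mulr0.
  - move=> i; rewrite /affine tnth_lincomb mul1r tnth_mktuple.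
    rewrite [X in nc X](_ : _ = 0).
      by rewrite nc0; apply: mulr_ge0; [exact: sqr_ge0|exact: le_trans (M1 y)].
    rewrite rmorphD rmorphM/= rmorph_nat mulrDr (addrA (z0 i)).
    by rewrite [X in X - _]addrAC subrr add0r mulrCA subrr.
(* The shift of the density, to first order. *)
have part2 y : nc (Fe y - F y - C_ R t * (C_ R (tnth y j) * F y)) <=
    t ^+ 2 * (nc (F y) * q y).
  have -> : Fe y - F y - C_ R t * (C_ R (tnth y j) * F y) =
     F y * C_ R (expR (t * tnth y j - t ^+ 2 / 2) - 1 - t * tnth y j).
    rewrite /Fe 2!rmorphB rmorph1 !mulrBr mulr1; congr (_ - _).
    by rewrite rmorphM mulrA mulrC.
  rewrite ncM nc_real mulrCA ler_wpM2l ?nc_ge0//.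
  by apply: expR_shift_bound; [rewrite ltW|exact: coord_le_wt].
have tFe : ctame wt Fe.
  have -> : Fe = (fun y => F y * C_ R (expR (t * tnth y j - t ^+ 2 / 2))) by [].
  apply: ctameM => //; apply: ctame_real.
  apply: (tame_le _ (tame_expw (mu := G) (w := wt) `|t|)) => [|y].
    apply: measurableT_comp => //; apply: measurable_funB => //.
    by apply: measurable_funM => //; exact: measurable_tnth.
  rewrite (ger0_norm (expR_ge0 _)) (ger0_norm (expR_ge0 _)) ler_expR lerBlDr (le_trans (ler_norm _))//.
  rewrite normrM (le_trans (ler_wpM2l _ (coord_le_wt y j)))// lerDl.
  by rewrite divr_ge0 ?sqr_ge0.
have tD1 : ctame wt (fun y => Fs y - F y - C_ R t * (b * DF y)).
  by apply: ctameB; [exact: ctameB|do 2 apply: ctameZ].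
have tD2 : ctame wt (fun y => Fe y - F y - C_ R t * (C_ R (tnth y j) * F y)).
  by apply: ctameB; [exact: ctameB|apply: ctameZ].
have E1 : EC G (fun y => Fs y - F y - C_ R t * (b * DF y)) =
    EC G Fe - EC G F - C_ R t * B.
  have tbDF : ctame wt (fun y => b * DF y) by exact: ctameZ.
  rewrite EC_B; [|exact: ctameB|exact: ctameZ].
  by rewrite EC_B// FsFe EC_Z// EC_Z.
have E2 : EC G (fun y => Fe y - F y - C_ R t * (C_ R (tnth y j) * F y)) =
    EC G Fe - EC G F - C_ R t * A.
  rewrite EC_B; [|exact: ctameB|exact: ctameZ].
  by rewrite EC_B// EC_Z.
have -> : t * nc (A - B) = nc (EC G (fun y => Fs y - F y - C_ R t * (b * DF y)) -
   EC G (fun y => Fe y - F y - C_ R t * (C_ R (tnth y j) * F y))).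
  rewrite E1 E2 opprB [X in _ = nc X]addrC subrKA -mulrBr ncM nc_real gtr0_norm//.
rewrite mulrDr; apply: (le_trans (ncB _ _)); apply: lerD.
  apply: (le_trans (nc_EC tD1)); rewrite -expectZ//.
  by apply: expect_le => //; [exact: tame_nc|exact: tameZ].
apply: (le_trans (nc_EC tD2)); rewrite -expectZ//.
by apply: expect_le => //; [exact: tame_nc|exact: tameZ].
Qed.

End integration_by_parts.

(** * Gaussian averages and Hermite polynomials *)

Section multi_indices.
Context {n : nat}.
Implicit Types (m : multinom n) (j : 'I_n).

Lemma mnm_subK m j : (0 < m j)%N -> mnm_add (mnm_sub m (mnm1 j)) (mnm1 j) = m.
Proof.
move=> mj; apply/mnmP => i; rewrite mnmDE mnmBE mnm1E.
by case: eqVneq => [<-|_]; rewrite ?subn0 ?addn0// subnK.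
Qed.

Lemma mnm_addK m j : mnm_sub (mnm_add m (mnm1 j)) (mnm1 j) = m.
Proof. by apply/mnmP => i; rewrite mnmBE mnmDE addnK. Qed.

Lemma mnm_addE m j : mnm_add m (mnm1 j) j = (m j).+1.
Proof. by rewrite mnmDE mnm1E eqxx addn1. Qed.

Lemma mdegS m j : mdeg (mnm_add m (mnm1 j)) = (mdeg m).+1.
Proof. by rewrite mdegD mdeg1 addn1. Qed.

Lemma mnm_ind (P : multinom n -> Prop) : P mnm0 ->
  (forall m j, P m -> P (mnm_add m (mnm1 j))) -> forall m, P m.
Proof.
move=> P0 PS m; move: {2}(mdeg m) (erefl (mdeg m)) => k.
elim: k m => [|k IH] m mk.
  suff -> : m = mnm0 by [].
  by apply/eqP; rewrite -mdeg_eq0 mk.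
have [j mj] : exists j, (0 < m j)%N.
  apply/existsP; rewrite -[X in is_true X]negbK; apply/negP.
  rewrite negb_exists => /forallP H.
  suff m0 : m = mnm0 by move: mk; rewrite m0 mdeg0.
  by apply/mnmP => i; rewrite mnm0E; apply/eqP; rewrite -leqn0 leqNgt H.
rewrite -(mnm_subK mj); apply: PS; apply: IH.
by apply: succn_inj; rewrite -(mdegS _ j) mnm_subK.
Qed.

End multi_indices.

Section degree.
Context {R : realType} {n : nat}.
Implicit Types (f g : cpoly R n) (d : nat).

Lemma P_leP d f : P_le d f <-> forall a, (d < mdeg a)%N -> mcoeff a f = 0.
Proof.
split=> H a.
  by move=> da; apply/eqP; rewrite mcoeff_eq0; apply/negP => /H; rewrite leqNgt da.
by rewrite mcoeff_msupp leqNgt => f0; apply/negP => /H; apply/eqP.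
Qed.

Lemma P_le_mon d d' f : (d <= d')%N -> P_le d f -> P_le d' f.
Proof. by move=> dd H a /H /leq_trans; apply. Qed.

Lemma P_leD d f g : P_le d f -> P_le d g -> P_le d (f + g).
Proof.
move=> /P_leP H /P_leP H'; apply/P_leP => a da.
by rewrite mcoeffD H// H'// addr0.
Qed.

Lemma P_leZ d c f : P_le d f -> P_le d (c *: f).
Proof. by move=> /P_leP H; apply/P_leP => a da; rewrite mcoeffZ H// mulr0. Qed.

Lemma P_le0 d : P_le d (0 : cpoly R n).
Proof. by apply/P_leP => a da; rewrite mcoeff0. Qed.

Lemma P_le_sum d (I : Type) (s : seq I) (P : pred I) (F : I -> cpoly R n) :
  (forall i, P i -> P_le d (F i)) -> P_le d (\sum_(i <- s | P i) F i).
Proof.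
move=> H; apply: (big_ind (@P_le R n d)) => //; first exact: P_le0.
by move=> f g; exact: P_leD.
Qed.

Lemma P_leX (m : multinom n) : P_le (mdeg m) (@mpolyX n R[i] m).
Proof. by move=> a; rewrite msuppX inE => /eqP ->. Qed.

Lemma P_le1 d : P_le d (1 : cpoly R n).
Proof. by have := @P_leX (mnm0 : multinom n); rewrite mpolyX0 mdeg0; exact: P_le_mon. Qed.

Lemma P_leXvar d j f : P_le d f -> P_le d.+1 (Xvar j * f).
Proof.
move=> H a /msuppM_le /allpairsP[[b c]/= []].
rewrite msuppX inE => /eqP -> /H cd ->.
by rewrite mdegD mdeg1 add1n ltnS.
Qed.

Lemma P_le_deriv d j f : P_le d.+1 f -> P_le d (mderiv j f).
Proof.
move=> /P_leP H; apply/P_leP => a da.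
by rewrite mcoeff_mderiv H ?mul0rn// mdegD mdeg1 addn1 ltnS.
Qed.

Lemma P_le0_deriv j f : P_le 0 f -> mderiv j f = 0.
Proof.
move=> /P_leP H; apply/mpolyP => a.
by rewrite mcoeff_mderiv H ?mul0rn ?mcoeff0// mdegD mdeg1 addn1.
Qed.

Lemma pevalE f x : peval f x = meval (fun j => C_ R (tnth x j)) f.
Proof. by []. Qed.

Lemma P_le_exists f : exists d, P_le d f.
Proof.
exists (\sum_(a <- msupp f) mdeg a)%N => a af.
by rewrite (big_rem a)//= leq_addr.
Qed.

End degree.

Section average.
Context {R : realType} {n : nat}.
Local Notation G := (gaussian R n).
Local Notation wt := (@wt R n).
Implicit Types (f g : cpoly R n) (x y : Rn R n) (a b : R[i]).

Definition shifted a b x y : 'I_n -> R[i] :=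
  affine (fun i => a * C_ R (tnth x i)) b y.

(** The partial derivatives are recorded together with the values because the
    integration by parts in [is_averageXvar] needs both. *)
Definition is_average a b f g :=
  (forall x, peval g x = EC G (fun y => meval (shifted a b x y) f)) /\
  (forall j x, peval (mderiv j g) x =
     a * EC G (fun y => meval (shifted a b x y) (mderiv j f))).

Lemma ctame_shifted a b x f : ctame wt (fun y => meval (shifted a b x y) f).
Proof. exact: ctame_affine. Qed.

Lemma is_averageD a b f f' g g' : is_average a b f g -> is_average a b f' g' ->
  is_average a b (f + f') (g + g').
Proof.
move=> [E1 D1] [E2 D2]; split=> [x|j x].
  rewrite /peval mevalD -!pevalE E1 E2 -EC_D; [|exact: ctame_shifted..].
  by apply: eq_EC => y; rewrite mevalD.
rewrite /peval mderivD mevalD -!pevalE D1 D2 -mulrDr -EC_D; [|exact: ctame_shifted..].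
by congr (_ * _); apply: eq_EC => y; rewrite mderivD mevalD.
Qed.

Lemma is_averageZ a b c f g : is_average a b f g ->
  is_average a b (c *: f) (c *: g).
Proof.
move=> [E1 D1]; split=> [x|j x].
  rewrite /peval mevalZ -!pevalE E1 -EC_Z; last exact: ctame_shifted.
  by apply: eq_EC => y; rewrite mevalZ.
rewrite /peval [in LHS]mderivZ mevalZ -!pevalE D1 mulrCA -(EC_Z c); last exact: ctame_shifted.
by congr (_ * _); apply: eq_EC => y; rewrite mderivZ mevalZ.
Qed.

Lemma is_average1 a b : is_average a b 1 1.
Proof.
split=> [x|j x].
  rewrite /peval meval1 -[LHS](EC_cst (mu := G)).
  by apply: eq_EC => y; rewrite meval1.
rewrite -(mpolyC1 n R[i]) mderivC /peval meval0.
rewrite (_ : EC G _ = 0) ?mulr0// -[RHS](EC_cst (mu := G)).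
by apply: eq_EC => y; rewrite meval0.
Qed.

(** Multiplying by a variable inside the average produces, by integration by
    parts, an average of the derivative. *)
Lemma EC_mul_shifted a b x f j :
  EC G (fun y => shifted a b x y j * meval (shifted a b x y) f) =
  a * C_ R (tnth x j) * EC G (fun y => meval (shifted a b x y) f) +
  b ^+ 2 * EC G (fun y => meval (shifted a b x y) (mderiv j f)).
Proof.
have tf := ctame_shifted a b x f.
have tyf : ctame wt (fun y => C_ R (tnth y j) * meval (shifted a b x y) f).
  by apply: ctameM => //; exact: ctame_coord.
have ibp : EC G (fun y => C_ R (tnth y j) * meval (shifted a b x y) f) =
    b * EC G (fun y => meval (shifted a b x y) (mderiv j f)).
  exact: gaussian_ibp.
rewrite expr2 -(mulrA b) -ibp.
rewrite -(EC_Z (a * C_ R (tnth x j)) tf) -(EC_Z b tyf) -EC_D; first last.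
- exact: ctameZ.
- exact: ctameZ.
by apply: eq_EC => y; rewrite {1}/shifted /affine mulrDl (mulrA b).
Qed.

Lemma is_averageXvar a b f g g' j : is_average a b f g ->
  is_average a b (mderiv j f) g' ->
  is_average a b (Xvar j * f) (a *: (Xvar j * g) + b ^+ 2 *: g').
Proof.
move=> [E1 D1] [E2 D2]; split=> [x|k x].
  transitivity (EC G (fun y => shifted a b x y j * meval (shifted a b x y) f)).
    rewrite EC_mul_shifted /peval mevalD !mevalZ mevalM mevalXvar -!pevalE E1 E2.
    by rewrite mulrA.
  by apply: eq_EC => y; rewrite mevalM mevalXvar.
transitivity (a * EC G (fun y => (j == k)%:R * meval (shifted a b x y) f +
    shifted a b x y j * meval (shifted a b x y) (mderiv k f))); last first.
  congr (_ * _); apply: eq_EC => y.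
  by rewrite mderivM mevalD !mevalM mevalXvar mderivXvar mevalC eq_sym.
rewrite EC_D; first last.
- apply: ctameM; last exact: ctame_shifted.
  apply: ctameD; first exact: ctame_cst.
  by apply: ctameZ; exact: ctame_coord.
- by apply: ctameZ; exact: ctame_shifted.
rewrite EC_mul_shifted EC_Z; last exact: ctame_shifted.
rewrite mderivD !mderivZ mderivM mderivXvar /peval.
rewrite mevalD !mevalZ mevalD !mevalM mevalXvar mevalC -!pevalE E1 D1 D2.
rewrite eq_sym mderiv_comm !mulrDr addrA; congr (_ + _ + _).
- by congr (_ * _); rewrite mulrCA mulrA.
- by rewrite mulrCA.
Qed.

(** An average of a polynomial is again a polynomial, of no larger degree. *)
Lemma average_monomial a b (m : multinom n) :
  exists g, P_le (mdeg m) g /\ is_average a b (@mpolyX n R[i] m) g.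
Proof.
move: {2}(mdeg m) (leqnn (mdeg m)) => k.
elim: k m => [|k IH] m mk.
  have -> : m = mnm0 by apply/eqP; rewrite -mdeg_eq0 -leqn0.
  exists 1; rewrite mpolyX0; split; first exact: P_le1.
  exact: is_average1.
elim/(@mnm_ind n): m mk => [|m j _] mk.
  by exists 1; rewrite mpolyX0; split; [exact: P_le1|exact: is_average1].
rewrite mdegS ltnS in mk; have [g [gm gE]] := IH m mk.
have [g' [gm' gE']] : exists g', P_le (mdeg m) g' /\
    is_average a b (mderiv j (@mpolyX n R[i] m)) g'.
  rewrite mderivX; have [mj|mj] := posnP (m j).
    exists 0; split; first exact: P_le0.
    rewrite mj; rewrite -(scale0r 1); have := is_averageZ 0 (is_average1 a b).
    by rewrite !scale0r.
  have lm : (mdeg (mnm_sub m (mnm1 j)) <= mdeg m)%N by exact: mdegB.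
  have [h [hm hE]] := IH _ (leq_trans lm mk).
  exists ((m j)%:R *: h); split; last exact: is_averageZ.
  by apply: P_leZ; exact: (P_le_mon lm hm).
exists (a *: (Xvar j * g) + b ^+ 2 *: g'); split.
  apply: P_leD; apply: P_leZ; first by rewrite mdegS; exact: P_leXvar.
  by apply: (P_le_mon _ gm'); rewrite mdegS.
by rewrite mpolyXD mulrC; exact: is_averageXvar.
Qed.

Definition avgX a b m : cpoly R n := projT1 (cid (average_monomial a b m)).

(** Hermite polynomials are averages with [a = 1] and [b = i], and the Mehler
    transform is an average with real coefficients. *)
Definition avg a b f : cpoly R n :=
  \sum_(m <- msupp f) mcoeff m f *: avgX a b m.

Lemma avg_is_average a b f : is_average a b f (avg a b f).
Proof.
rewrite {1}(mpolyE f) /avg; elim: (msupp f) => [|m s IH].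
  rewrite !big_nil; have := is_averageZ 0 (is_average1 a b).
  by rewrite !scale0r.
rewrite !big_cons; apply: is_averageD; last exact: IH.
apply: is_averageZ.
by rewrite /avgX; case: cid => g [].
Qed.

Lemma avgE a b f x :
  peval (avg a b f) x = EC G (fun y => meval (shifted a b x y) f).
Proof. by case: (avg_is_average a b f). Qed.

Lemma avg_deriv a b f j x :
  peval (mderiv j (avg a b f)) x =
  a * EC G (fun y => meval (shifted a b x y) (mderiv j f)).
Proof. by case: (avg_is_average a b f). Qed.

Lemma P_le_avg a b d f : P_le d f -> P_le d (avg a b f).
Proof.
move=> fd; rewrite /avg big_seq_cond; apply: P_le_sum => m; rewrite andbT => mf.
apply: P_leZ; rewrite /avgX; case: cid => g [gm _] /=.
by apply: (P_le_mon _ gm); exact: fd.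
Qed.

End average.

(** ** Hermite polynomials *)

Section hermite.
Context {R : realType} {n : nat}.
Local Notation G := (gaussian R n).
Local Notation wt := (@wt R n).
Implicit Types (f g : cpoly R n) (x y : Rn R n) (a b : multinom n).
Local Notation "'ii'" := (Complex (0 : R) 1).

Definition hpoly a : cpoly R n := avg 1 ii (@mpolyX n R[i] a).

Lemma shifted_ii x y j : shifted 1 ii x y j = Complex (tnth x j) (tnth y j).
Proof. by apply: eq_ReIm => /=; ring. Qed.

Lemma hpolyE a x : peval (hpoly a) x = hermite a x.
Proof.
rewrite avgE; apply: eq_EC => y; rewrite mevalX; apply: eq_bigr => j _.
by rewrite shifted_ii.
Qed.

Lemma P_le_hpoly a : P_le (mdeg a) (hpoly a).
Proof. by apply: P_le_avg; exact: P_leX. Qed.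

Lemma hermite0 x : hermite (mnm0 : multinom n) x = 1.
Proof.
rewrite -hpolyE avgE -[RHS](EC_cst (mu := G)); apply: eq_EC => y.
by rewrite mpolyX0 meval1.
Qed.

Lemma hermite_deriv a j x : peval (mderiv j (hpoly a)) x =
  (a j)%:R * hermite (mnm_sub a (mnm1 j)) x.
Proof.
rewrite avg_deriv mul1r -hpolyE avgE -EC_Z; last exact: ctame_shifted.
by apply: eq_EC => y; rewrite mderivX mevalZ.
Qed.

Lemma hermite_rec a j x : hermite (mnm_add a (mnm1 j)) x =
  C_ R (tnth x j) * hermite a x - peval (mderiv j (hpoly a)) x.
Proof.
rewrite -hpolyE avgE.
transitivity (EC G (fun y => shifted 1 ii x y j *
    meval (shifted 1 ii x y) (@mpolyX n R[i] a))).
  by apply: eq_EC => y; rewrite mpolyXD mulrC mevalM mevalXU.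
rewrite EC_mul_shifted mul1r -hpolyE avgE avg_deriv mul1r.
by rewrite (_ : ii ^+ 2 = -1) ?mulN1r//; apply: eq_ReIm => /=; ring.
Qed.

Fact pairing_key : unit. Proof. exact: tt. Qed.

(** Bilinear rather than sesquilinear: Hermite polynomials are real on [R^n], so
    that they are orthogonal for it. *)
Definition pairing : cpoly R n -> cpoly R n -> R[i] :=
  locked_with pairing_key (fun f g => EC G (fun x => peval f x * peval g x)).

Lemma pairingE f g : pairing f g = EC G (fun x => peval f x * peval g x).
Proof. by rewrite /pairing unlock. Qed.

Lemma ctame_pairing f g : ctame wt (fun x => peval f x * peval g x).
Proof. by apply: ctameM; exact: ctame_peval. Qed.

Lemma pairingC f g : pairing f g = pairing g f.
Proof. by rewrite !pairingE; apply: eq_EC => x; rewrite mulrC. Qed.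

Lemma pairingDl f f' g : pairing (f + f') g = pairing f g + pairing f' g.
Proof.
rewrite !pairingE -EC_D; [|exact: ctame_pairing..].
by apply: eq_EC => x; rewrite /peval mevalD mulrDl.
Qed.

Lemma pairingZl c f g : pairing (c *: f) g = c * pairing f g.
Proof.
rewrite !pairingE -EC_Z; last exact: ctame_pairing.
by apply: eq_EC => x; rewrite /peval mevalZ mulrA.
Qed.

Lemma pairingBl f f' g : pairing (f - f') g = pairing f g - pairing f' g.
Proof. by rewrite -scaleN1r pairingDl pairingZl mulN1r. Qed.

Lemma pairingBr f g g' : pairing f (g - g') = pairing f g - pairing f g'.
Proof. by rewrite pairingC pairingBl !(pairingC f). Qed.

Lemma pairing_suml (I : Type) (s : seq I) (F : I -> cpoly R n) g :
  pairing (\sum_(i <- s) F i) g = \sum_(i <- s) pairing (F i) g.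
Proof.
elim: s => [|i s IH]; last by rewrite !big_cons pairingDl IH.
by rewrite !big_nil -(scale0r g) pairingZl mul0r.
Qed.

Lemma pairing_eq f f' g : peval f =1 peval f' -> pairing f g = pairing f' g.
Proof. by move=> /funext ff; rewrite !pairingE ff. Qed.

(** The creation operator [x_j - d_j] is adjoint to the derivative. *)
Lemma hermite_adjoint a j g :
  pairing (hpoly (mnm_add a (mnm1 j))) g = pairing (hpoly a) (mderiv j g).
Proof.
have ibp : EC G (fun x => C_ R (tnth x j) * peval (hpoly a * g) x) =
    EC G (fun x => peval (mderiv j (hpoly a * g)) x).
  have aff (h : cpoly R n) x : meval (affine (fun=> 0) 1 x) h = peval h x.
    by apply: meval_eq => i; rewrite /affine add0r mul1r.
  rewrite (eq_EC (H := fun x => C_ R (tnth x j) *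
    meval (affine (fun=> 0) 1 x) (hpoly a * g))); last by move=> x; rewrite aff.
  by rewrite gaussian_ibp mul1r; apply: eq_EC => x; rewrite aff.
transitivity (EC G (fun x => C_ R (tnth x j) * peval (hpoly a * g) x) -
    pairing (mderiv j (hpoly a)) g).
  rewrite !pairingE -EC_B; [|by apply: ctameM; [exact: ctame_coord|exact: ctame_peval]|
    exact: ctame_pairing].
  apply: eq_EC => x; rewrite hpolyE hermite_rec mulrBl; congr (_ - _).
  by rewrite /peval mevalM -!pevalE hpolyE mulrA.
rewrite ibp; apply/eqP; rewrite subr_eq addrC; apply/eqP.
rewrite !pairingE -EC_D; [|exact: ctame_pairing..].
by apply: eq_EC => x; rewrite /peval mderivM mevalD !mevalM.
Qed.

(** Each step of the adjunction lowers both the index and the degree of [g]. *)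
Lemma hermite_orth_le d a g : P_le d g -> (d < mdeg a)%N -> pairing (hpoly a) g = 0.
Proof.
elim: d a g => [|d IH] a g gd; elim/(@mnm_ind n): a => [|a j _]; rewrite ?mdeg0// mdegS ltnS.
  move=> _; rewrite hermite_adjoint P_le0_deriv// pairingC.
  by rewrite -(scale0r g) pairingZl mul0r.
by move=> da; rewrite hermite_adjoint IH//; exact: P_le_deriv.
Qed.

Lemma pairing_hermiteS a b j : pairing (hpoly (mnm_add a (mnm1 j))) (hpoly b) =
  (b j)%:R * pairing (hpoly a) (hpoly (mnm_sub b (mnm1 j))).
Proof.
rewrite hermite_adjoint -[in RHS]pairingC -pairingZl pairingC.
by apply: pairing_eq => x; rewrite hermite_deriv /peval mevalZ -pevalE hpolyE.
Qed.

Lemma hermite_orth a b : a != b -> pairing (hpoly a) (hpoly b) = 0.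
Proof.
elim/(@mnm_ind n): a b => [|a j IH] b ab.
  rewrite pairingC; apply: (@hermite_orth_le 0).
    by have := @P_le_hpoly mnm0; rewrite mdeg0.
  by rewrite lt0n mdeg_eq0 eq_sym.
rewrite pairing_hermiteS; have [->|bj] := posnP (b j); first by rewrite mul0r.
rewrite IH ?mulr0//; apply: contraNneq ab => ->.
by rewrite mnm_subK.
Qed.

Lemma hermite_norm_neq0 a : pairing (hpoly a) (hpoly a) != 0.
Proof.
elim/(@mnm_ind n): a => [|a j IH].
  rewrite (_ : pairing _ _ = 1) ?oner_neq0// pairingE -[RHS](EC_cst (mu := G)).
  by apply: eq_EC => x; rewrite hpolyE hermite0 mulr1.
by rewrite pairing_hermiteS mnm_addE mnm_addK mulf_neq0// pnatr_eq0.
Qed.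

(** ** Expansions *)

Definition hsum (l : seq (R[i] * multinom n)) x : R[i] :=
  \sum_(p <- l) p.1 * hermite p.2 x.

Definition hspan d (F : Rn R n -> R[i]) := exists l,
  (forall p, p \in l -> (mdeg p.2 <= d)%N) /\ F =1 hsum l.

Lemma hspanD d F H : hspan d F -> hspan d H -> hspan d (fun x => F x + H x).
Proof.
move=> [l [ld Fl]] [k [kd Hk]]; exists (l ++ k); split.
  by move=> p; rewrite mem_cat => /orP[/ld|/kd].
by move=> x; rewrite /hsum big_cat/= Fl Hk.
Qed.

Lemma hspanZ d c F : hspan d F -> hspan d (fun x => c * F x).
Proof.
move=> [l [ld Fl]]; exists [seq (c * p.1, p.2) | p <- l]; split.
  by move=> p /mapP[q /ld ql ->].
move=> x; rewrite /hsum big_map Fl mulr_sumr.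
by apply: eq_bigr => p _; rewrite mulrA.
Qed.

Lemma hspan0 d : hspan d (fun=> 0).
Proof. by exists [::]; split => // x; rewrite /hsum big_nil. Qed.

Lemma eq_hspan d F H : F =1 H -> hspan d F -> hspan d H.
Proof. by move=> /funext ->. Qed.

Lemma hspan_hermite d a : (mdeg a <= d)%N -> hspan d (hermite a).
Proof.
move=> ad; exists [:: (1, a)]; split.
  by move=> p; rewrite inE => /eqP ->.
by move=> x; rewrite /hsum big_seq1 mul1r.
Qed.

(** By the recurrence [x_j H_a = H_(a + e_j) + a_j H_(a - e_j)]. *)
Lemma hspan_mulX d F j : hspan d F -> hspan d.+1 (fun x => C_ R (tnth x j) * F x).
Proof.
move=> [l [ld Fl]].
apply: (@eq_hspan _ (fun x => \sum_(p <- l) p.1 * (C_ R (tnth x j) * hermite p.2 x))).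
  by move=> x; rewrite Fl mulr_sumr; apply: eq_bigr => p _; rewrite mulrCA.
elim: l ld {F Fl} => [|p l IH] ld.
  by apply: (eq_hspan _ (hspan0 _)) => x; rewrite big_nil.
apply: (@eq_hspan _ (fun x => p.1 * (C_ R (tnth x j) * hermite p.2 x) +
   \sum_(p <- l) p.1 * (C_ R (tnth x j) * hermite p.2 x))).
  by move=> x; rewrite big_cons.
have pd := ld p (mem_head _ _).
apply: hspanD; last by apply: IH => q ql; apply: ld; rewrite inE ql orbT.
apply: hspanZ; apply: (@eq_hspan _ (fun x => hermite (mnm_add p.2 (mnm1 j)) x +
  (p.2 j)%:R * hermite (mnm_sub p.2 (mnm1 j)) x)).
  by move=> x; rewrite hermite_rec hermite_deriv subrK.
apply: hspanD; first by apply: hspan_hermite; rewrite mdegS.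
apply: hspanZ; apply: hspan_hermite.
by rewrite (leq_trans (mdegB _ _))// ltnW.
Qed.

Lemma hspan_peval d f : P_le d f -> hspan d (peval f).
Proof.
move=> fd.
apply: (@eq_hspan _ (fun x => \sum_(m <- msupp f) mcoeff m f * peval (@mpolyX n R[i] m) x)).
  move=> x; rewrite [RHS]pevalE [in RHS](mpolyE f) raddf_sum/=.
  by apply: eq_bigr => m _; rewrite mevalZ.
have supp_d : forall a, a \in msupp f -> (mdeg a <= d)%N by [].
elim: (msupp f) supp_d => [|m s IH] sd.
  by apply: (eq_hspan _ (hspan0 _)) => x; rewrite big_nil.
apply: (@eq_hspan _ (fun x => mcoeff m f * peval (@mpolyX n R[i] m) x +
   \sum_(m <- s) mcoeff m f * peval (@mpolyX n R[i] m) x)).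
  by move=> x; rewrite big_cons.
have md : (mdeg m <= d)%N by apply: sd; exact: mem_head.
apply: hspanD; last by apply: IH => q qs; apply: sd; rewrite inE qs orbT.
apply: hspanZ => {IH sd s}; move: md.
elim/(@mnm_ind n): m d {fd} => [|m j IH] d md.
  apply: (eq_hspan _ (hspan_hermite md)).
  by move=> x; rewrite hermite0 mpolyX0 /peval meval1.
case: d md => [|d]; rewrite mdegS// ltnS => md.
apply: (eq_hspan _ (hspan_mulX j (IH _ md))) => x.
by rewrite mpolyXD mulrC /peval mevalM mevalXU.
Qed.

End hermite.

Section high_degree.
Context {R : realType} {n : nat}.
Local Notation G := (gaussian R n).
Local Notation wt := (@wt R n).
Implicit Types (f g h : cpoly R n) (x y : Rn R n) (a b : multinom n) (d : nat).

Lemma pairing_sum_hermite (s : seq (multinom n)) (c : multinom n -> R[i]) f g :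
  (forall x, peval f x = \sum_(a <- s) c a * hermite a x) ->
  pairing f g = \sum_(a <- s) c a * pairing (hpoly a) g.
Proof.
move=> fE; rewrite (@pairing_eq _ _ f (\sum_(a <- s) c a *: hpoly a)).
  by rewrite pairing_suml; apply: eq_bigr => a _; rewrite pairingZl.
move=> x; rewrite fE [RHS]pevalE raddf_sum/=; apply: eq_bigr => a _.
by rewrite mevalZ -pevalE hpolyE.
Qed.

Lemma P_ge_orth d f g : P_ge d.+1 f -> P_le d g -> pairing f g = 0.
Proof.
move=> [s [c [sd fE]]] gd; rewrite (pairing_sum_hermite _ fE) big_seq big1// => a sa.
by rewrite (hermite_orth_le gd) ?mulr0//; exact: sd.
Qed.

(** The coefficients of the Hermite expansion are read off by orthogonality. *)
Lemma orth_P_ge d f : (forall a, (mdeg a <= d)%N -> pairing f (hpoly a) = 0) ->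
  P_ge d.+1 f.
Proof.
move=> f0; have [e fe] := P_le_exists f; have [l [_ fl]] := hspan_peval fe.
pose s := undup [seq p.2 | p <- l].
pose c a := \sum_(p <- l | p.2 == a) p.1.
have us : uniq s by exact: undup_uniq.
have fE x : peval f x = \sum_(a <- s) c a * hermite a x.
  rewrite fl /hsum /c.
  transitivity (\sum_(a <- s) \sum_(p <- l | p.2 == a) p.1 * hermite p.2 x).
    rewrite (exchange_big_dep predT)//= big_seq [RHS]big_seq; apply: eq_bigr => p pl.
    have sp : [seq a <- s | p.2 == a] = [:: p.2].
      rewrite -(filter_pred1_uniq us (x := p.2)); last by rewrite mem_undup map_f.
      by apply: eq_filter => a; rewrite /= eq_sym.
    by rewrite -big_filter sp big_seq1.
  apply: eq_bigr => a _; rewrite mulr_suml; apply: eq_bigr => p /eqP <- //.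
have c0 a : a \in s -> (mdeg a <= d)%N -> c a = 0.
  move=> sa ad; have := f0 a ad; rewrite (pairing_sum_hermite _ fE).
  rewrite (bigD1_seq a)//= big1 => [|b ba]; last by rewrite hermite_orth ?mulr0.
  by rewrite addr0 => /eqP; rewrite mulf_eq0 (negPf (hermite_norm_neq0 a)) orbF => /eqP.
exists [seq a <- s | (d < mdeg a)%N], c; split.
  by move=> a; rewrite mem_filter => /andP[].
move=> x; rewrite fE big_filter [RHS]big_mkcond/= big_seq [RHS]big_seq.
apply: eq_bigr => a sa; case: ltnP => // ad.
by rewrite c0// mul0r.
Qed.

(** The orthogonal projection onto the polynomials of degree at most [d]. *)
Definition lowpart d h : cpoly R n :=
  \sum_(a : bmultinom n d.+1)
    (pairing h (hpoly a) / pairing (hpoly a) (hpoly a)) *: hpoly a.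

Lemma P_ge_highpart d h : P_ge d.+1 (h - lowpart d h).
Proof.
apply: orth_P_ge => b bd; rewrite pairingBl.
rewrite /lowpart pairing_suml; pose b' := BMultinom (bd : (mdeg b < d.+1)%N).
rewrite (bigD1 b')//= big1 => [|a ab]; last first.
  have nab : bmnm a != b.
    by apply: contraNneq ab => ab; apply/eqP; exact: val_inj.
  by rewrite pairingZl (hermite_orth nab) mulr0.
rewrite addr0 pairingZl.
by rewrite (divfK (hermite_norm_neq0 b)) subrr.
Qed.

End high_degree.

(** ** The Ornstein-Uhlenbeck semigroup *)

Section mehler.
Context {R : realType} {n : nat}.
Local Notation G := (gaussian R n).
Local Notation wt := (@wt R n).
Local Notation wt2 := (@wt2 R n).
Implicit Types (f g h : cpoly R n) (x y : Rn R n) (c s : R).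

(** Mehler's formula: for [c = expR (- t)] and [c ^+ 2 + s ^+ 2 = 1] this is
    the Ornstein-Uhlenbeck semigroup at time [t]. *)
Definition mehler c s f : cpoly R n := avg (C_ R c) (C_ R s) f.

Lemma shifted_real c s x y f :
  meval (shifted (C_ R c) (C_ R s) x y) f = peval f (lincomb c s x y).
Proof.
rewrite /peval; apply: meval_eq => j.
by rewrite /shifted /affine tnth_lincomb rmorphD/= !rmorphM.
Qed.

Lemma mehlerE c s f x :
  peval (mehler c s f) x = EC G (fun y => peval f (lincomb c s x y)).
Proof. by rewrite avgE; apply: eq_EC => y; rewrite shifted_real. Qed.

(** The derivative in [x] is converted into one in [y], at the price [c / s]. *)
Lemma mehler_deriv_ibp c s f j x :
  C_ R s * peval (mderiv j (mehler c s f)) x =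
  C_ R c * EC G (fun y => C_ R (tnth y j) * peval f (lincomb c s x y)).
Proof.
have ibp := gaussian_ibp (fun i => C_ R c * C_ R (tnth x i)) (C_ R s) f j.
transitivity (C_ R c * (C_ R s *
    EC G (fun y => meval (shifted (C_ R c) (C_ R s) x y) (mderiv j f)))).
  by rewrite mulrCA -(avg_deriv (C_ R c) (C_ R s) f j x).
apply: (congr1 ( *%R (C_ R c))); apply: (etrans (esym ibp)).
by apply: eq_EC => y; rewrite -shifted_real.
Qed.

Lemma ctame_lincomb c s f :
  ctame wt2 (fun z => peval f (lincomb c s z.1 z.2)).
Proof.
have -> : (fun z : Rn R n * Rn R n => peval f (lincomb c s z.1 z.2)) =
    (fun z => meval (shifted (C_ R c) (C_ R s) z.1 z.2) f).
  by apply/funext => z; rewrite shifted_real.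
apply: ctame_meval => j; apply: ctameD; apply: ctameZ.
  exact: (ctame_fst (ctame_coord j)).
exact: (ctame_snd (ctame_coord j)).
Qed.

(** The symmetry [y |-> - y], as a rotation by [pi / 2] of a pair followed by
    forgetting a coordinate. *)
Lemma EC_neg (F : Rn R n -> R[i]) : ctame wt F ->
  EC G (fun x => F (lincomb (-1) 0 x x)) = EC G F.
Proof.
move=> tF; have tF2 := ctame_snd tF.
have cs : (0 : R) ^+ 2 + 1 ^+ 2 = 1 by ring.
have H := EC_rot cs (lexx 0) tF2.
have E1 : EC (G \x G)%E (fun z : Rn R n * Rn R n => F z.2) = EC G F.
  by rewrite EC_pair// -[RHS](EC_cst (mu := G)).
rewrite -E1 -H EC_pair; last first.
  have [a b] := tF2; split.
    exact: (tame_lincomb 0 1 (-1) 0 a).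
  exact: (tame_lincomb 0 1 (-1) 0 b).
apply: eq_EC => x; rewrite -[LHS](EC_cst (mu := G)); apply: eq_EC => y /=.
congr F; apply: eq_from_tnth => i; rewrite !tnth_lincomb; ring.
Qed.

(** The pair [(x, cos t x + sin t y)] is exchangeable up to the sign of [y]. *)
Lemma pairing_mehler c s f g : c ^+ 2 + s ^+ 2 = 1 -> 0 <= c ->
  pairing (mehler c s f) g = pairing f (mehler c s g).
Proof.
move=> cs c0.
pose H (z : Rn R n * Rn R n) := peval f z.1 * peval g (lincomb c (- s) z.1 z.2).
have tH : ctame wt2 H.
  by apply: ctameM; [exact: (ctame_fst (ctame_peval f))|exact: ctame_lincomb].
have tF : ctame wt2 (fun z => peval f (lincomb c s z.1 z.2) * peval g z.1).
  by apply: ctameM; [exact: ctame_lincomb|exact: (ctame_fst (ctame_peval g))].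
transitivity (EC (G \x G)%E (fun z => peval f (lincomb c s z.1 z.2) * peval g z.1)).
  rewrite pairingE EC_pair//; apply: eq_EC => x /=; rewrite mehlerE mulrC -EC_Z.
    by apply: eq_EC => y; rewrite mulrC.
  exact: (ctame_section x (ctame_lincomb c s f)).
transitivity (EC (G \x G)%E H).
  rewrite -(EC_rot cs c0 tH); apply: eq_EC => -[x y]; rewrite /H/=.
  congr (_ * peval g _); apply: eq_from_tnth => i; rewrite !tnth_lincomb.
  by rewrite -[LHS]mul1r -cs; ring.
rewrite pairingE EC_pair//; apply: eq_EC => x; rewrite /H/= mehlerE -EC_Z; last first.
  exact: (ctame_section x (ctame_lincomb c s g)).
rewrite -[LHS]EC_neg; last exact: (ctame_section x tH).
apply: eq_EC => y; congr (_ * peval g _); apply: eq_from_tnth => i.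
by rewrite !tnth_lincomb; ring.
Qed.

Lemma P_ge_mehler c s d f : c ^+ 2 + s ^+ 2 = 1 -> 0 <= c ->
  P_ge d.+1 f -> P_ge d.+1 (mehler c s f).
Proof.
move=> cs c0 fd; apply: orth_P_ge => a ad; rewrite pairing_mehler//.
apply: (P_ge_orth fd); apply: P_le_avg.
exact: (P_le_mon ad (@P_le_hpoly R n a)).
Qed.

End mehler.

(** * Dimension-free gradient estimates *)

Section linear_moments.
Context {R : realType} {n : nat}.
Local Notation G := (gaussian R n).
Local Notation wt := (@wt R n).
Local Notation E := (Rintegral G setT).
Implicit Types (a x y : Rn R n) (r : R).

(** Moments of a linear form are controlled by its exponential moments, which are
    explicit and do not depend on the dimension. *)
Lemma powR_le_expR (t r : R) : 0 <= r -> `|t| `^ r <= expR (r * t) + expR (r * - t).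
Proof.
move=> r0; apply: (@le_trans _ _ (expR (r * `|t|))).
  rewrite mulrC expRM ge0_ler_powR// ?nnegrE ?expR_ge0//.
  by rewrite (le_trans _ (expR_ge1Dx _))// lerDr.
have [t0|t0] := leP 0 t.
  by rewrite ger0_norm// lerDl expR_ge0.
by rewrite ltr0_norm// lerDr expR_ge0.
Qed.

Definition dot a y : R := \sum_j tnth a j * tnth y j.

Lemma tame_dot a : tame wt (dot a).
Proof. by apply: tame_sum => j; apply: tameZ; exact: tame_coord. Qed.

Lemma tame_exp_dot a (r : R) : tame wt (fun y => expR (r * dot a y)).
Proof.
pose K := \sum_j `|tnth a j|.
apply: (tame_le _ (tame_expw (mu := G) (w := wt) (`|r| * K))) => [|y].
  apply: measurableT_comp => //; apply: measurable_funM => //.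
  by have [] := tame_dot a.
rewrite (ger0_norm (expR_ge0 _)) (ger0_norm (expR_ge0 _)) ler_expR (le_trans (ler_norm _))// normrM -mulrA.
rewrite ler_wpM2l// (le_trans (ler_norm_sum _ _ _))// /K mulr_suml ler_sum// => j _.
by rewrite normrM ler_wpM2l// coord_le_wt.
Qed.

Lemma expect_exp_dot a (r : R) :
  E (fun y => expR (r * dot a y)) = expR (r ^+ 2 * (\sum_j tnth a j ^+ 2) / 2).
Proof.
apply: EFin_inj; rewrite expect_fin; last exact: tame_exp_dot.
have := gaussian_exp_moment [tuple r * tnth a j | j < n].
have -> : \sum_j tnth [tuple r * tnth a j | j < n] j ^+ 2 =
    r ^+ 2 * \sum_j tnth a j ^+ 2.
  by rewrite mulr_sumr; apply: eq_bigr => j _; rewrite tnth_mktuple exprMn.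
move=> <-; apply: eq_integral => y _; congr (expR _)%:E.
rewrite /dot mulr_sumr; apply: eq_bigr => j _.
by rewrite tnth_mktuple mulrA.
Qed.

Definition exp_const r : R := expR (r ^+ 2 / 2) + expR (r ^+ 2 / 2).

Lemma exp_const_ge0 r : 0 <= exp_const r.
Proof. by rewrite addr_ge0// expR_ge0. Qed.

Lemma moment_unit a r : 0 <= r -> \sum_j tnth a j ^+ 2 = 1 ->
  E (fun y => `|dot a y| `^ r) <= exp_const r.
Proof.
move=> r0 a1.
have te (q : R) : tame wt (fun y => expR (q * dot a y)) by exact: tame_exp_dot.
have -> : exp_const r = E (fun y => expR (r * dot a y) + expR (- r * dot a y)).
  by rewrite expectD// !expect_exp_dot a1 sqrrN !mulr1.
apply: expect_le => [| |y].
- by apply: tame_powR => //; exact: tame_dot.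
- exact: tameD.
- by rewrite mulNr -mulrN powR_le_expR.
Qed.

Lemma moment_real a r : 0 < r ->
  E (fun y => `|dot a y| `^ r) <=
  exp_const r * Num.sqrt (\sum_j tnth a j ^+ 2) `^ r.
Proof.
move=> r0; set s := Num.sqrt _.
have s2 : s ^+ 2 = \sum_j tnth a j ^+ 2.
  by rewrite sqr_sqrtr// sumr_ge0// => j _; exact: sqr_ge0.
have [s0|s0] := eqVneq s 0.
  have a0 j : tnth a j = 0.
    apply/eqP; rewrite -sqrf_eq0 eq_le sqr_ge0 andbT.
    have : \sum_j tnth a j ^+ 2 = 0 by rewrite -s2 s0 expr0n.
    move=> <-; rewrite [leRHS](bigD1 j)//= lerDl sumr_ge0// => i _.
    exact: sqr_ge0.
  rewrite (_ : E _ = 0).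
    by rewrite mulr_ge0 ?exp_const_ge0 ?powR_ge0.
  rewrite -[RHS](expect_cst (mu := G)); apply: eq_Rintegral => y _.
  rewrite /dot big1 ?normr0 ?powR0 ?gt_eqF// => j _.
  by rewrite a0 mul0r.
pose b : Rn R n := [tuple s^-1 * tnth a j | j < n].
have ab y : dot a y = s * dot b y.
  rewrite /dot mulr_sumr; apply: eq_bigr => j _.
  by rewrite tnth_mktuple -mulrA mulVKf.
have b1 : \sum_j tnth b j ^+ 2 = 1.
  transitivity (s^-1 ^+ 2 * s ^+ 2); last by rewrite -exprMn mulVf// expr1n.
  rewrite s2 mulr_sumr; apply: eq_bigr => j _.
  by rewrite tnth_mktuple exprMn.
have tb : tame wt (fun y => `|dot b y| `^ r).
  by apply: tame_powR; [exact: ltW|exact: tame_dot].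
have -> : E (fun y => `|dot a y| `^ r) = s `^ r * E (fun y => `|dot b y| `^ r).
  rewrite -expectZ//; apply: eq_Rintegral => y _.
  by rewrite ab normrM powRM// ger0_norm ?sqrtr_ge0.
by rewrite mulrC ler_wpM2r ?powR_ge0// moment_unit// ltW.
Qed.

Definition enorm (v : 'I_n -> R[i]) : R := Num.sqrt (\sum_j nc (v j) ^+ 2).

Lemma enorm_ge0 v : 0 <= enorm v. Proof. exact: sqrtr_ge0. Qed.

Lemma enorm_sqr v : enorm v ^+ 2 = \sum_j nc (v j) ^+ 2.
Proof. by rewrite sqr_sqrtr// sumr_ge0// => j _; exact: sqr_ge0. Qed.

Definition cdot (v : 'I_n -> R[i]) y : R[i] := \sum_j v j * C_ R (tnth y j).

Lemma ctame_cdot v : ctame wt (cdot v).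
Proof. by apply: ctame_sum => j; apply: ctameZ; exact: ctame_coord. Qed.

Definition moment_const r : R := 2 `^ r * (exp_const r + exp_const r).

Lemma moment_const_gt0 r : 0 < moment_const r.
Proof. by rewrite mulr_gt0 ?powR_gt0// !addr_gt0// expR_gt0. Qed.

Lemma powRD_le (s t r : R) : 0 <= s -> 0 <= t -> 0 <= r ->
  (s + t) `^ r <= 2 `^ r * (s `^ r + t `^ r).
Proof.
move=> s0 t0 r0.
have H (u v : R) : 0 <= u -> u <= v -> (u + v) `^ r <= 2 `^ r * (u `^ r + v `^ r).
  move=> u0 uv; have v0 := le_trans u0 uv.
  apply: (@le_trans _ _ ((2 * v) `^ r)).
    rewrite ge0_ler_powR// ?nnegrE ?addr_ge0 ?mulr_ge0//.
    by rewrite mulr_natl mulr2n lerD2r.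
  by rewrite powRM// ler_wpM2l ?powR_ge0// lerDr powR_ge0.
have [st|/ltW ts] := leP s t; first exact: H.
by rewrite addrC [X in _ * X]addrC H.
Qed.

Lemma moment_complex v r : 0 < r ->
  E (fun y => nc (cdot v y) `^ r) <= moment_const r * enorm v `^ r.
Proof.
move=> r0; have r0' := ltW r0.
pose a : Rn R n := [tuple complex.Re (v j) | j < n].
pose b : Rn R n := [tuple complex.Im (v j) | j < n].
have vE y : nc (cdot v y) <= `|dot a y| + `|dot b y|.
  have -> : dot a y = complex.Re (cdot v y).
    rewrite /cdot (big_morph (@complex.Re R) (id1 := 0) (op1 := +%R))//; last exact: cReD.
    by apply: eq_bigr => j _; rewrite tnth_mktuple cReM/= mulr0 subr0.
  have -> : dot b y = complex.Im (cdot v y).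
    rewrite /cdot (big_morph (@complex.Im R) (id1 := 0) (op1 := +%R))//; last exact: cImD.
    by apply: eq_bigr => j _; rewrite tnth_mktuple cImM/= mulr0 add0r.
  exact: nc_leD.
have av : Num.sqrt (\sum_j tnth a j ^+ 2) <= enorm v.
  apply: ler_wsqrtr; apply: ler_sum => j _.
  by rewrite tnth_mktuple nc_sqr lerDl sqr_ge0.
have bv : Num.sqrt (\sum_j tnth b j ^+ 2) <= enorm v.
  apply: ler_wsqrtr; apply: ler_sum => j _.
  by rewrite tnth_mktuple nc_sqr lerDr sqr_ge0.
have ta : tame wt (fun y => `|dot a y| `^ r) by apply: tame_powR => //; exact: tame_dot.
have tb : tame wt (fun y => `|dot b y| `^ r) by apply: tame_powR => //; exact: tame_dot.
have tab : tame wt (fun y => `|dot a y| `^ r + `|dot b y| `^ r) by exact: tameD.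
have tv : tame wt (fun y => nc (cdot v y) `^ r).
  apply: (eq_tame _ (tame_powR r0' (tame_nc (ctame_cdot v)))) => y.
  by rewrite ger0_norm ?nc_ge0.
apply: (@le_trans _ _ (E (fun y => 2 `^ r * (`|dot a y| `^ r + `|dot b y| `^ r)))).
  apply: expect_le; [exact: tv|exact: (tameZ (2 `^ r) tab)|].
  move=> y; apply: le_trans (powRD_le _ _ r0') => //.
  by rewrite ge0_ler_powR// ?nnegrE ?nc_ge0 ?addr_ge0.
rewrite expectZ// /moment_const -mulrA ler_wpM2l ?powR_ge0// expectD// mulrDl.
have mono (s : R) : 0 <= s -> s <= enorm v -> exp_const r * s `^ r <= exp_const r * enorm v `^ r.
  move=> s0 sv; rewrite ler_wpM2l ?exp_const_ge0//.
  by rewrite ge0_ler_powR// nnegrE// enorm_ge0.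
apply: lerD; (apply: le_trans; first exact: moment_real); apply: mono => //; exact: sqrtr_ge0.
Qed.

End linear_moments.

Section jensen.
Context {d} {T : measurableType d} {R : realType}
  {mu : {measure set T -> \bar R}} {w : T -> R} {muw : exp_integrable mu w}.
Local Notation E := (Rintegral mu setT).

Lemma conj_exp (r : R) : 1 < r ->
  [/\ 0 < r, 1 < r / (r - 1) & r^-1 + (r / (r - 1))^-1 = 1].
Proof.
move=> r1; have r0 : 0 < r by exact: lt_trans r1.
have r10 : 0 < r - 1 by rewrite subr_gt0.
split => //; first by rewrite ltr_pdivlMr// mul1r ltrBlDr ltrDl.
by rewrite invf_div; field; rewrite gt_eqF.
Qed.

Lemma expect_le_Nr r (f : T -> R) : 1 < r -> tame w f -> E (fun x => `|f x|) <= Nr mu r f.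
Proof.
move=> r1 tf; have [r0 r1' rr] := conj_exp r1.
have q0 : 0 < r / (r - 1) by exact: lt_trans r1'.
pose proof (hoelder_Nr r0 q0 rr tf (tame_cst 1)) as H.
rewrite (Nr_cst 1 q0) normr1 mulr1 in H.
apply: (le_trans _ H); apply: le_of_eq.
by apply: eq_Rintegral => x _; rewrite mulr1.
Qed.

(** Jensen's inequality, from Hoelder's inequality against the constant [1]. *)
Lemma nc_EC_powR r (F : T -> R[i]) : 1 < r -> ctame w F ->
  nc (EC mu F) `^ r <= E (fun x => nc (F x) `^ r).
Proof.
move=> r1 tF; have r0 : 0 < r by exact: lt_trans r1.
have tn : tame w (fun x => nc (F x)) by exact: tame_nc.
have H : nc (EC mu F) <= Nr mu r (fun x => nc (F x)).
  apply: (le_trans (nc_EC tF)); apply: (le_trans _ (expect_le_Nr r1 tn)).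
  apply: le_of_eq.
  by apply: eq_Rintegral => x _; rewrite ger0_norm ?nc_ge0.
have := ge0_ler_powR (ltW r0) (nc_ge0 _ : _ \is Num.nneg) (Nr_ge0 _ _ : _ \is Num.nneg) H.
move=> H2; apply: (le_trans H2); rewrite (Nr_powR _ r0).
apply: le_of_eq.
by apply: eq_Rintegral => x _; rewrite ger0_norm ?nc_ge0.
Qed.

End jensen.

Section trigonometric_bounds.
Context {R : realType}.
Implicit Types e t : R.

Lemma mvt0 (f df : R -> R) e : 0 <= e -> (forall x : R, is_derive x 1 f (df x)) ->
  exists2 t, 0 <= t <= e & f e - f 0 = df t * e.
Proof.
move=> e0 fd.
have fc : {within `[0, e], continuous f}.
  apply: continuous_subspaceT => x.
  exact/differentiable_continuous/derivable1_diffP/(@ex_derive _ _ _ _ _ _ _ (fd x)).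
have [t] := MVT_segment e0 (fun x _ => fd x) fc.
by rewrite in_itv/= subr0 => te fE; exists t.
Qed.

Lemma sin_le e : 0 <= e -> `|sin e| <= e.
Proof.
move=> e0; have [t _] := mvt0 e0 (fun x => is_derive_sin x).
rewrite sin0 subr0 => ->; rewrite normrM [`|e|]ger0_norm//.
by rewrite ler_piMl// cos_max.
Qed.

Lemma cos_sub1_bound e : 0 <= e -> `|cos e - 1| <= e ^+ 2.
Proof.
move=> e0; have [t /andP[t0 te]] := mvt0 e0 (fun x => is_derive_cos x).
rewrite cos0 => ->; rewrite normrM normrN [`|e|]ger0_norm// expr2 ler_wpM2r//.
exact: le_trans (sin_le t0) te.
Qed.

Lemma sin_sub_bound e : 0 <= e <= 1 -> `|sin e - e| <= e ^+ 2.
Proof.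
move=> /andP[e0 e1]; have [t /andP[t0 te]] := mvt0 e0 (fun x => is_derive_sin x).
rewrite sin0 subr0 => ->; rewrite -{2}[e]mul1r -mulrBl normrM [`|e|]ger0_norm//.
rewrite expr2 ler_wpM2r// (le_trans (cos_sub1_bound t0))//.
by rewrite (le_trans (_ : _ <= t)) ?expr2 ?ler_piMr// (le_trans te).
Qed.

Lemma atan_le t : 0 <= t -> atan t <= t.
Proof.
move=> t0; have [x _] := mvt0 t0 (fun x => is_derive1_atan x).
rewrite atan0 subr0 => ->; rewrite ler_piMl//.
by rewrite invf_le1 ?lerDl ?sqr_ge0// ltr_pwDl ?sqr_ge0.
Qed.

Lemma atan_ge0 t : 0 <= t -> 0 <= atan t.
Proof. by move=> t0; rewrite -atan0; exact: le_atan. Qed.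

Lemma sin_atan t : sin (atan t) = t * cos (atan t).
Proof.
have c0 : cos (atan t) != 0.
  by rewrite gt_eqF// cos_gt0_pihalf// atan_gtNpi2 atan_ltpi2.
by rewrite -{2}(atanK t) /tan divfK.
Qed.

End trigonometric_bounds.

Section gradient_estimates.
Context {R : realType} {n : nat}.
Local Notation G := (gaussian R n).
Local Notation wt := (@wt R n).
Local Notation wt2 := (@wt2 R n).
Local Notation E := (Rintegral G setT).
Local Notation E2 := (Rintegral (G \x G)%E setT).
Local Notation N := (Nr G).
Implicit Types (f g : cpoly R n) (x y : Rn R n) (r c s : R).

Lemma Nr_le_powR {d} {T : measurableType d} (mu : {measure set T -> \bar R}) r (h : T -> R) (A : R) :
  0 < r -> 0 <= A ->
  Rintegral mu setT (fun z => `|h z| `^ r) <= A `^ r -> Nr mu r h <= A.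
Proof.
move=> r0 A0 H; rewrite NrE -[leRHS](powRr1 A0) -(divff (lt0r_neq0 r0)) powRrM.
by rewrite ge0_ler_powR// ?invr_ge0 ?(ltW r0)// nnegrE ?powR_ge0// Rintegral_ge0// => x _;
  exact: powR_ge0.
Qed.

Lemma tame_norm_poly f : tame wt (norm_poly f).
Proof. exact: (tame_nc (ctame_peval f)). Qed.

Lemma norm_poly_ge0 f x : 0 <= norm_poly f x. Proof. exact: nc_ge0. Qed.

Lemma norm_gradE f x : norm_grad f x = enorm (fun j => peval (mderiv j f) x).
Proof. by []. Qed.

Lemma norm_grad_ge0 f x : 0 <= norm_grad f x. Proof. exact: sqrtr_ge0. Qed.

Lemma tame_norm_grad f : tame wt (norm_grad f).
Proof.
apply: tame_sqrt; apply: tame_sum => j.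
by apply: tameX; exact: tame_norm_poly.
Qed.

(** Bounds the norm of [y |-> v . y] by the euclidean norm of [v], in every
    dimension. *)
Definition lin_const r : R := moment_const r `^ r^-1.

Lemma lin_const_gt0 r : 0 < lin_const r.
Proof. by rewrite powR_gt0// moment_const_gt0. Qed.

Lemma Nr_cdot r (v : 'I_n -> R[i]) : 0 < r ->
  N r (fun y => nc (cdot v y)) <= lin_const r * enorm v.
Proof.
move=> r0; apply: Nr_le_powR => //.
  by rewrite mulr_ge0 ?enorm_ge0// ltW// lin_const_gt0.
rewrite powRM ?enorm_ge0//; last by rewrite ltW// lin_const_gt0.
rewrite /lin_const -powRrM mulVf ?gt_eqF// powRr1; last first.
  by rewrite ltW// moment_const_gt0.
apply: (le_trans _ (moment_complex v r0)).
apply: le_of_eq; apply: eq_Rintegral => y _.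
by rewrite ger0_norm ?nc_ge0.
Qed.

Lemma tame_lincomb1 c s (h : Rn R n -> R) : tame wt h ->
  tame wt2 (fun z => h (lincomb c s z.1 z.2)).
Proof. by move=> /tame_fst; exact: tame_lincomb. Qed.

Lemma expect_rot1 c s (h : Rn R n -> R) : c ^+ 2 + s ^+ 2 = 1 -> 0 <= c ->
  tame wt h -> E2 (fun z => h (lincomb c s z.1 z.2)) = E h.
Proof.
move=> cs c0 th; have th2 : tame wt2 (fun z => h z.1) by exact: tame_fst.
have H := expect_rot cs c0 th2; apply: (etrans H).
rewrite expect_pair//; apply: eq_Rintegral => x _.
by rewrite /= expect_cst.
Qed.

(** At each point [x], the gradient of the transform is tested against its own
    conjugate [v]; after integration by parts this is the expectation of
    [y |-> v . y] against [f], to which Hoelder's inequality applies with a norm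
    of [v . y] that does not see the dimension. Rotation invariance concludes. *)
Lemma grad_mehler r c s f : 1 < r -> c ^+ 2 + s ^+ 2 = 1 -> 0 <= c -> 0 <= s ->
  s * N r (norm_grad (mehler c s f)) <=
  c * lin_const (r / (r - 1)) * N r (norm_poly f).
Proof.
move=> r1 cs c0 s0; have [r0 q1 rq] := conj_exp r1.
set q := r / (r - 1) in q1 rq *.
have q0 : 0 < q by exact: lt_trans q1.
pose K := lin_const q; have K0 : 0 < K by exact: lin_const_gt0.
pose F x y := peval f (lincomb c s x y).
have tF x : ctame wt (F x) by exact: (ctame_section x (ctame_lincomb c s f)).
have point x : s * norm_grad (mehler c s f) x <= c * K * N r (fun y => nc (F x y)).
  rewrite norm_gradE; set v := fun j => _; set W := enorm v.
  have W0 : 0 <= W by exact: enorm_ge0.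
  have [->|Wn] := eqVneq W 0.
    by rewrite mulr0 !mulr_ge0 ?Nr_ge0// ltW.
  have Wp : 0 < W by rewrite lt_def Wn.
  rewrite -(ler_pM2r Wp) -(mulrA s W W) -expr2.
  pose vb j := conjc (v j).
  have vbW : enorm vb = W.
    by rewrite /W /enorm; congr Num.sqrt; apply: eq_bigr => j _; rewrite nc_conj.
  have E1 : C_ R (s * W ^+ 2) = C_ R c * EC G (fun y => cdot vb y * F x y).
    transitivity (\sum_j vb j * (C_ R s * v j)).
      rewrite /W enorm_sqr mulr_sumr rmorph_sum; apply: eq_bigr => j _.
      by rewrite rmorphM/= -conjcM mulrCA.
    transitivity (\sum_j C_ R c * EC G (fun y => vb j * C_ R (tnth y j) * F x y)).
      apply: eq_bigr => j _; rewrite mehler_deriv_ibp mulrCA.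
      apply: (congr1 ( *%R (C_ R c))); rewrite -EC_Z.
        by apply: eq_EC => y; rewrite mulrA.
      by apply: ctameM; [exact: ctame_coord|exact: (tF x)].
    rewrite -mulr_sumr; apply: (congr1 ( *%R (C_ R c))).
    rewrite -EC_sum.
      by apply: eq_EC => y; rewrite /cdot mulr_suml.
    by move=> j; apply: ctameM; [apply: ctameZ; exact: ctame_coord|exact: (tF x)].
  have : s * W ^+ 2 = nc (C_ R (s * W ^+ 2)).
    by rewrite nc_real ger0_norm// mulr_ge0// sqr_ge0.
  rewrite E1 ncM nc_real (ger0_norm c0) => ->; rewrite -!mulrA ler_wpM2l//.
  have H := nc_EC_hoelder q0 r0 _ (ctame_cdot vb) (tF x).
  apply: le_trans; first by apply: H; rewrite addrC.
  rewrite mulrA mulrAC; apply: ler_wpM2r; first exact: Nr_ge0.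
  by rewrite -vbW; exact: Nr_cdot.
have Kc0 : 0 <= c * K by rewrite mulr_ge0// ltW.
have tng : tame wt (norm_grad (mehler c s f)) by exact: tame_norm_grad.
have tP : tame wt (fun x => norm_poly f x `^ r).
  apply: (eq_tame _ (tame_powR (ltW r0) (tame_norm_poly f))) => x.
  by rewrite ger0_norm ?norm_poly_ge0.
have tF2 : tame wt2 (fun z => norm_poly f (lincomb c s z.1 z.2) `^ r).
  exact: (tame_lincomb1 c s tP).
have <- : N r (fun x => s * norm_grad (mehler c s f) x) =
    s * N r (norm_grad (mehler c s f)).
  by rewrite NrZ// ger0_norm.
apply: Nr_le_powR => //; first by rewrite mulr_ge0// Nr_ge0.
rewrite powRM ?Nr_ge0// Nr_powR//.
have -> : E (fun x => `|norm_poly f x| `^ r) =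
    E2 (fun z => norm_poly f (lincomb c s z.1 z.2) `^ r).
  rewrite (expect_rot1 cs c0 tP); apply: eq_Rintegral => x _.
  by rewrite ger0_norm ?norm_poly_ge0.
rewrite expect_pair// -expectZ; last exact: (tame_expect_section tF2).
apply: expect_le.
- by apply: tame_powR; [exact: ltW|exact: tameZ].
- by apply: tameZ; exact: (tame_expect_section tF2).
move=> x; rewrite ger0_norm ?mulr_ge0 ?norm_grad_ge0//.
apply: (@le_trans _ _ ((c * K * N r (fun y => nc (F x y))) `^ r)).
  rewrite ge0_ler_powR ?(ltW r0) ?nnegrE ?mulr_ge0 ?norm_grad_ge0 ?Nr_ge0//.
  by rewrite ltW.
rewrite powRM ?Nr_ge0// ler_wpM2l ?powR_ge0// Nr_powR//.
apply: le_of_eq; apply: eq_Rintegral => y _.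
by rewrite ger0_norm ?nc_ge0.
Qed.

End gradient_estimates.

Section mehler_close.
Context {R : realType} {n : nat}.
Local Notation G := (gaussian R n).
Local Notation G2 := (gaussian R n \x gaussian R n)%E.
Local Notation wt := (@wt R n).
Local Notation wt2 := (@wt2 R n).
Local Notation E := (Rintegral G setT).
Local Notation E2 := (Rintegral G2 setT).
Local Notation N := (Nr G).
Local Notation T := (Rn R n * Rn R n)%type.
Implicit Types (f g : cpoly R n) (x y : Rn R n) (r c s e t : R) (z : T).

Lemma Nr_rot r c s (h : T -> R) : 0 < r -> c ^+ 2 + s ^+ 2 = 1 -> 0 <= c ->
  tame wt2 h ->
  Nr G2 r (fun z => h (lincomb c s z.1 z.2, lincomb (- s) c z.1 z.2)) = Nr G2 r h.
Proof.
move=> r0 cs c0 th; have tp : tame wt2 (fun z => `|h z| `^ r).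
  by apply: tame_powR => //; exact: ltW.
by rewrite !NrE; have <- := expect_rot cs c0 tp.
Qed.

(** The variation of [g] along an arc of angle [e] of the circle through [z.1]
    and [z.2]. *)
Definition increment g e z : R[i] :=
  peval g (lincomb (cos e) (sin e) z.1 z.2) - peval g z.1.

Lemma ctame_increment g e : ctame wt2 (increment g e).
Proof.
apply: ctameB; first exact: ctame_lincomb.
exact: (ctame_fst (ctame_peval g)).
Qed.

Definition inc_norm r g e : R := Nr G2 r (fun z => nc (increment g e z)).

(** The rotation by [a] preserves the measure and turns an increment of angle
    [e] at angle [0] into one at angle [a]. *)
Lemma inc_normD r g a e : 1 < r -> 0 <= a <= pi / 2 ->
  inc_norm r g (a + e) <= inc_norm r g a + inc_norm r g e.
Proof.
move=> r1 /andP[a0 a2]; have r0 : 0 < r by exact: lt_trans r1.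
have cs : cos a ^+ 2 + sin a ^+ 2 = 1 by exact: cos2Dsin2.
have c0 : 0 <= cos a.
  by apply: cos_ge0_pihalf; rewrite a2 andbT (le_trans _ a0)// oppr_le0 divr_ge0 ?pi_ge0.
pose rot z : T := (lincomb (cos a) (sin a) z.1 z.2, lincomb (- sin a) (cos a) z.1 z.2).
have trot : ctame wt2 (fun z => increment g e (rot z)).
  have [t1 t2] := ctame_increment g e.
  by split; [exact: (tame_lincomb _ _ _ _ t1)|exact: (tame_lincomb _ _ _ _ t2)].
have -> : inc_norm r g e = Nr G2 r (fun z => nc (increment g e (rot z))).
  exact: (esym (Nr_rot r0 cs c0 (tame_nc (ctame_increment g e)))).
apply: (le_trans _ (Nr_ncD (ltW r1) (ctame_increment g a) trot)).
apply: le_of_eq; apply: eq_Nr => z.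
congr nc; rewrite /increment /rot/= [RHS]addrC subrKA.
apply: (congr1 (fun u => peval g u - peval g z.1)).
apply: eq_from_tnth => i; rewrite !tnth_lincomb cosD sinD; ring.
Qed.

Lemma inc_norm0 r g : 0 < r -> inc_norm r g 0 = 0.
Proof.
move=> r0; rewrite /inc_norm.
transitivity (Nr G2 r (fun _ : T => 0 : R)); last by rewrite Nr_cst// normr0.
apply: eq_Nr => z; rewrite /increment cos0 sin0 (_ : lincomb 1 0 _ _ = z.1).
  by rewrite subrr nc0.
by apply: eq_from_tnth => i; rewrite tnth_lincomb mul1r mul0r addr0.
Qed.

Lemma inc_normMn r g e k : 1 < r -> 0 <= e -> e *+ k <= pi / 2 ->
  inc_norm r g (e *+ k) <= inc_norm r g e *+ k.
Proof.
move=> r1 e0; elim: k => [|k IH] ek.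
  by rewrite !mulr0n inc_norm0// (lt_trans _ r1).
have ek' : e *+ k <= pi / 2 by apply: le_trans ek; rewrite mulrS lerDr.
rewrite 2!mulrSr; apply: le_trans.
  by apply: inc_normD => //; rewrite mulrn_wge0.
by rewrite lerD2r; exact: IH.
Qed.

(** Conditionally on the position, the derivative in a Gaussian direction is a
    linear form in that direction. *)
Lemma Nr_dir_deriv r g : 1 < r ->
  Nr G2 r (fun z => nc (cdot (fun j => peval (mderiv j g) z.1) z.2)) <=
  lin_const r * N r (norm_grad g).
Proof.
move=> r1; have r0 : 0 < r by exact: lt_trans r1.
set h := fun z => _.
have L0 : 0 <= lin_const r by rewrite ltW// lin_const_gt0.
have th : ctame wt2 (fun z => cdot (fun j => peval (mderiv j g) z.1) z.2).
  apply: ctame_sum => j; apply: ctameM.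
    exact: (ctame_fst (ctame_peval _)).
  exact: (ctame_snd (ctame_coord j)).
have tp : tame wt2 (fun z => `|h z| `^ r).
  by apply: tame_powR; [exact: ltW|exact: (tame_nc th)].
have tg : tame wt (fun x => `|norm_grad g x| `^ r).
  by apply: tame_powR; [exact: ltW|exact: tame_norm_grad].
apply: Nr_le_powR => //; first by rewrite mulr_ge0// Nr_ge0.
rewrite powRM ?Nr_ge0// Nr_powR// expect_pair// -expectZ//.
apply: expect_le; [exact: (tame_expect_section tp)|exact: tameZ|] => x.
rewrite -powRM// (ger0_norm (norm_grad_ge0 g x)) norm_gradE.
apply: (@le_trans _ _ (N r (fun y => nc (cdot (fun j => peval (mderiv j g) x) y)) `^ r)).
  by rewrite Nr_powR.
rewrite ge0_ler_powR ?(ltW r0) ?nnegrE ?Nr_ge0 ?mulr_ge0 ?enorm_ge0//.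
exact: Nr_cdot.
Qed.

(** For a small angle the increment is [e] times the derivative of [g] at [z.1]
    in the direction [z.2], up to second order. *)
Lemma inc_norm_small r g : 1 < r -> exists K : R, forall e, 0 <= e <= 1 ->
  inc_norm r g e <= e * (lin_const r * N r (norm_grad g)) + e ^+ 2 * K.
Proof.
move=> r1; have r0 : 0 < r by exact: lt_trans r1.
have [K gK] := taylor1 g.
pose M z := 1 + wt2 z.
have w0 z : 0 <= wt2 z by rewrite addr_ge0// wt_ge0.
have M1 z : 1 <= M z by rewrite lerDl.
have tM : tame wt2 (fun z => K%:R * M z ^+ K).
  apply: tameZ; have t1 : tame wt2 M.
    apply: tameD; first exact: tame_cst.
    exact: (tame_w (mu := G2)).
  elim: (K) => [|k IH]; first by under eq_fun do rewrite expr0; exact: tame_cst.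
  by under eq_fun do rewrite exprS; exact: tameM.
exists (Nr G2 r (fun z => K%:R * M z ^+ K)) => e /andP[e0 e1].
pose D z := cdot (fun j => peval (mderiv j g) z.1) z.2.
have tD : ctame wt2 D.
  apply: ctame_sum => j; apply: ctameM.
    exact: (ctame_fst (ctame_peval _)).
  exact: (ctame_snd (ctame_coord j)).
have te : ctame wt2 (fun z => C_ R e * D z) by exact: ctameZ.
have tr : ctame wt2 (fun z => increment g e z - C_ R e * D z).
  by apply: ctameB => //; exact: ctame_increment.
apply: (@le_trans _ _ (Nr G2 r (fun z => nc (C_ R e * D z)) +
    Nr G2 r (fun z => nc (increment g e z - C_ R e * D z)))).
  apply: (le_trans _ (Nr_ncD (ltW r1) te tr)).
  apply: le_of_eq; apply: eq_Nr => z.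
  by congr nc; rewrite addrC subrK.
apply: lerD.
  rewrite (Nr_ncZ _ r0 tD) nc_real ger0_norm// ler_wpM2l//.
  exact: Nr_dir_deriv.
rewrite -[e ^+ 2 in leRHS]ger0_norm ?sqr_ge0//.
rewrite -(NrZ (e ^+ 2) r0 tM).
apply: Nr_le => //; [exact: (tame_nc tr)|exact: tameZ|] => -[x y].
rewrite (ger0_norm (nc_ge0 _)) (le_trans _ (ler_norm _))//.
have coord_le u i : `|tnth u i| <= wt u := coord_le_wt u i.
apply: gK => //.
- by rewrite ger0_norm.
- move=> j; rewrite nc_real (le_trans (coord_le x j))// /M /wt2/=.
  by have := wt_ge0 y; have := wt_ge0 x; lra.
- move=> j; rewrite nc_real (le_trans (coord_le y j))// /M /wt2/=.
  by have := wt_ge0 y; have := wt_ge0 x; lra.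
- move=> j; rewrite nc_real tnth_lincomb (le_trans (ler_normD _ _))// !normrM.
  rewrite /M /wt2/= -[leLHS]add0r lerD// lerD//.
    by rewrite (le_trans _ (coord_le x j))// ler_piMl// cos_max.
  by rewrite (le_trans _ (coord_le y j))// ler_piMl// sin_max.
- move=> j; rewrite tnth_lincomb -rmorphB -rmorphM -rmorphB nc_real/=.
  have -> : cos e * tnth x j + sin e * tnth y j - tnth x j - e * tnth y j =
    (cos e - 1) * tnth x j + (sin e - e) * tnth y j by ring.
  rewrite (le_trans (ler_normD _ _))// !normrM.
  apply: (@le_trans _ _ (e ^+ 2 * wt x + e ^+ 2 * wt y)).
    apply: lerD; apply: ler_pM => //.
      exact: cos_sub1_bound.
    by apply: sin_sub_bound; rewrite e0.
  by rewrite -mulrDr ler_wpM2l ?sqr_ge0// /M /wt2 lerDr.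
Qed.

(** Cut the arc into [k] equal pieces: the second order errors add up to
    [O (1 / k)]. *)
Lemma inc_norm_le r g t : 1 < r -> 0 <= t <= pi / 2 ->
  inc_norm r g t <= t * (lin_const r * N r (norm_grad g)).
Proof.
move=> r1 /andP[t0 t2]; have [K HK] := inc_norm_small g r1.
set L := lin_const r * _ in HK *.
rewrite -subr_le0; apply: (@le0_of_small _ _ (t ^+ 2 * `|K|)) => e /andP[e0 e1].
pose k := Num.bound (e^-1 + t).
have kb : e^-1 + t < k%:R by apply: archi_boundP; rewrite addr_ge0// invr_ge0 ltW.
have kp : 0 < k%:R :> R by apply: le_lt_trans kb; rewrite addr_ge0// invr_ge0 ltW.
have tk : 0 <= t / k%:R <= 1.
  rewrite divr_ge0 ?ler0n//= ler_pdivrMr// mul1r (le_trans _ (ltW kb))// lerDr.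
  by rewrite invr_ge0 ltW.
have tkk : t / k%:R *+ k = t by rewrite -mulr_natr divfK// gt_eqF.
have H : inc_norm r g (t / k%:R *+ k) <= inc_norm r g (t / k%:R) *+ k.
  by apply: inc_normMn => //; [case/andP: tk|rewrite tkk].
rewrite tkk in H; rewrite lerBlDr; apply: (le_trans H).
apply: (@le_trans _ _ ((t / k%:R * L + (t / k%:R) ^+ 2 * K) *+ k)).
  by rewrite ler_wMn2r// HK.
rewrite -mulr_natr.
have -> : (t / k%:R * L + (t / k%:R) ^+ 2 * K) * k%:R = t ^+ 2 * K / k%:R + t * L.
  by field; rewrite gt_eqF.
rewrite lerD2r (le_trans (_ : _ <= t ^+ 2 * `|K| / k%:R))//.
  by rewrite ler_wpM2r ?invr_ge0 ?ler0n// ler_wpM2l ?sqr_ge0// ler_norm.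
rewrite mulrC ler_wpM2r ?mulr_ge0 ?sqr_ge0//.
rewrite -[leRHS]invrK lef_pV2 ?posrE ?invr_gt0//.
by rewrite (le_trans _ (ltW kb))// lerDl.
Qed.

(** By Jensen's inequality, averaging in [y] does not increase the norm of the
    increment along the arc from [x] to [x cos t + y sin t]. *)
Lemma mehler_close r t g : 1 < r -> 0 <= t <= pi / 2 ->
  N r (norm_poly (g - mehler (cos t) (sin t) g)) <=
  t * (lin_const r * N r (norm_grad g)).
Proof.
move=> r1 t2; have r0 : 0 < r by exact: lt_trans r1.
apply: (le_trans _ (inc_norm_le g r1 t2)).
apply: Nr_le_powR => //; first exact: Nr_ge0.
have ti := ctame_increment g t.
have tp : tame wt2 (fun z => `|nc (increment g t z)| `^ r).
  by apply: tame_powR; [exact: ltW|exact: (tame_nc ti)].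
rewrite /inc_norm Nr_powR// expect_pair//.
apply: expect_le; [|exact: (tame_expect_section tp)|].
  by apply: tame_powR; [exact: ltW|exact: tame_norm_poly].
move=> x; have tix : ctame wt (fun y => increment g t (x, y)).
  exact: (ctame_section x ti).
apply: (@le_trans _ _ (nc (EC G (fun y => increment g t (x, y))) `^ r)); last first.
  apply: (le_trans (nc_EC_powR r1 tix)).
  apply: le_of_eq; apply: eq_Rintegral => y _.
  by rewrite ger0_norm ?nc_ge0.
rewrite (ger0_norm (norm_poly_ge0 _ _)).
apply: le_of_eq.
congr (_ `^ r); rewrite /norm_poly -[LHS]ncN; congr nc.
rewrite /increment EC_B/=; first last.
- exact: ctame_cst.
- exact: (ctame_section x (ctame_lincomb _ _ g)).
by rewrite EC_cst -mehlerE [in LHS]/peval mevalB -!pevalE opprB.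
Qed.

End mehler_close.

(** * Polynomial approximation in Gaussian measure *)

(** ** Bernstein polynomials *)

Section bernstein.
Context {R : realType}.
Implicit Types (t : R) (phi : R -> R) (N k : nat).

Definition binom N k t : R := 'C(N, k)%:R * t ^+ k * (1 - t) ^+ (N - k).

Lemma binom_ge0 N k t : 0 <= t <= 1 -> 0 <= binom N k t.
Proof. by move=> /andP[t0 t1]; rewrite !mulr_ge0 ?exprn_ge0 ?subr_ge0. Qed.

Lemma sum_binom N t : \sum_(k < N.+1) binom N k t = 1.
Proof.
transitivity ((1 - t + t) ^+ N); last by rewrite subrK expr1n.
rewrite exprDn; apply: eq_bigr => k _.
by rewrite /binom -mulr_natl; ring.
Qed.

(** The absorption identity for binomial coefficients; [g = 1] and [g = id] give
    the first two moments. *)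
Lemma sum_binom_shift N t (g : nat -> R) :
  \sum_(k < N.+2) k%:R * g k * binom N.+1 k t =
  N.+1%:R * t * \sum_(k < N.+1) g k.+1 * binom N k t.
Proof.
rewrite big_ord_recl/= !mul0r add0r mulr_sumr; apply: eq_bigr => k _.
rewrite /bump leq0n add1n /binom subSS exprS.
have E : k.+1%:R * 'C(N.+1, k.+1)%:R = N.+1%:R * 'C(N, k)%:R :> R.
  by rewrite -!natrM mul_bin_diag.
rewrite mulrAC !mulrA E; ring.
Qed.

Lemma sum_binom1 N t : \sum_(k < N.+1) k%:R * binom N k t = N%:R * t.
Proof.
case: N => [|N]; first by rewrite big_ord_recl big_ord0 !mul0r addr0.
have := sum_binom_shift N t (fun=> 1).
rewrite (eq_bigr (fun k : 'I_(N.+2) => k%:R * binom N.+1 k t)); last first.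
  by move=> k _; rewrite mulr1.
move=> ->; rewrite (eq_bigr (fun k : 'I_(N.+1) => binom N k t)); last first.
  by move=> k _; rewrite mul1r.
by rewrite sum_binom mulr1.
Qed.

Lemma binom_variance N t :
  \sum_(k < N.+2) (k%:R - N.+1%:R * t) ^+ 2 * binom N.+1 k t =
  N.+1%:R * t * (1 - t).
Proof.
have S2 := sum_binom_shift N t (fun k => k%:R).
have -> : \sum_(k < N.+2) (k%:R - N.+1%:R * t) ^+ 2 * binom N.+1 k t =
  \sum_(k < N.+2) k%:R * k%:R * binom N.+1 k t
  - 2 * (N.+1%:R * t) * (\sum_(k < N.+2) k%:R * binom N.+1 k t)
  + (N.+1%:R * t) ^+ 2 * (\sum_(k < N.+2) binom N.+1 k t).
  rewrite !mulr_sumr -sumrB -big_split/=; apply: eq_bigr => k _; ring.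
rewrite S2 sum_binom1 sum_binom.
have -> : \sum_(k < N.+1) k.+1%:R * binom N k t = N%:R * t + 1.
  transitivity (\sum_(k < N.+1) k%:R * binom N k t + \sum_(k < N.+1) binom N k t).
    rewrite -big_split/=.
    by apply: eq_bigr => k _; rewrite -natr1 mulrDl mul1r.
  by rewrite sum_binom1 sum_binom.
rewrite -natr1; ring.
Qed.

(** The degree is [N.+1], so that no division by zero occurs. *)
Definition bern phi N t : R :=
  \sum_(k < N.+2) phi (k%:R / N.+1%:R) * binom N.+1 k t.

Let node_itv N (k : 'I_N.+2) : 0 <= (k%:R / N.+1%:R : R) <= 1.
Proof.
by rewrite divr_ge0//= ler_pdivrMr// mul1r ler_nat -ltnS.
Qed.

Lemma bern_bound phi (B : R) N t :
  (forall u : R, 0 <= u <= 1 -> `|phi u| <= B) -> 0 <= t <= 1 -> `|bern phi N t| <= B.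
Proof.
move=> phiB t01; rewrite /bern (le_trans (ler_norm_sum _ _ _))//.
have -> : B = \sum_(k < N.+2) B * binom N.+1 k t.
  by rewrite -mulr_sumr sum_binom mulr1.
apply: ler_sum => k _.
rewrite normrM [`|binom _ _ _|]ger0_norm ?binom_ge0// ler_wpM2r ?binom_ge0//.
by apply: phiB; exact: node_itv.
Qed.

(** Chebyshev's argument: nodes close to [t] contribute by continuity, the
    others by the variance of the binomial distribution, of order [1 / N]. *)
Lemma cvg_bern phi (B : R) t :
  (forall u : R, 0 <= u <= 1 -> `|phi u| <= B) -> 0 <= t <= 1 ->
  (forall e : R, 0 < e -> exists2 dl : R, 0 < dl &
    forall u : R, 0 <= u <= 1 -> `|u - t| < dl -> `|phi u - phi t| <= e) ->
  (fun N => bern phi N t) @ \oo --> phi t.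
Proof.
move=> phiB t01 phit; apply/cvgrPdist_le => e e0.
have [dl d0 phid] := phit (e / 2) (divr_gt0 e0 (ltr0Sn _ 1)).
have B0 : 0 <= B := le_trans (normr_ge0 _) (phiB t t01).
pose K := 2 * B / dl ^+ 2.
have K0 : 0 <= K by rewrite /K divr_ge0 ?sqr_ge0 ?mulr_ge0.
have point (u : R) : 0 <= u <= 1 -> `|phi u - phi t| <= e / 2 + K * (u - t) ^+ 2.
  move=> u01; have [ud|ud] := ltP `|u - t| dl.
    by rewrite (le_trans (phid u u01 ud))// lerDl mulr_ge0 ?sqr_ge0.
  apply: (@le_trans _ _ (2 * B)).
    by rewrite (le_trans (ler_normB _ _))// mulr_natl mulr2n lerD// phiB.
  rewrite (le_trans _ (ler_wpDl _ (lexx _))) ?divr_ge0 ?(ltW e0)//.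
  rewrite /K -mulrA ler_peMr ?mulr_ge0// mulrC ler_pdivlMr ?exprn_gt0// mul1r.
  by rewrite -(real_normK (num_real (u - t))) ler_pXn2r ?nnegrE// ltW.
pose N0 := Num.bound (K / (e / 2)).
exists N0 => // N /= N0N.
have Np : 0 < N.+1%:R :> R by rewrite ltr0n.
have KN : K / N.+1%:R <= e / 2.
  rewrite ler_pdivrMr// mulrC -ler_pdivrMr ?divr_gt0//.
  have Ke : 0 <= K / (e / 2) by exact: divr_ge0 K0 (ltW (divr_gt0 e0 (ltr0Sn _ 1))).
  by rewrite (le_trans (ltW (archi_boundP Ke)))// ler_nat ltnW.
have -> : phi t - bern phi N t =
  \sum_(k < N.+2) (phi t - phi (k%:R / N.+1%:R)) * binom N.+1 k t.
  have phiE : phi t = \sum_(k < N.+2) phi t * binom N.+1 k t.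
    by rewrite -mulr_sumr sum_binom mulr1.
  rewrite {1}phiE /bern -sumrB.
  by apply: eq_bigr => k _; rewrite mulrBl.
rewrite (le_trans (ler_norm_sum _ _ _))//.
apply: (@le_trans _ _ (\sum_(k < N.+2) (e / 2 * binom N.+1 k t +
   K / N.+1%:R ^+ 2 * ((k%:R - N.+1%:R * t) ^+ 2 * binom N.+1 k t)))).
  apply: ler_sum => k _; rewrite normrM distrC.
  rewrite [`|binom _ _ _|]ger0_norm ?binom_ge0//.
  rewrite (mulrA (K / N.+1%:R ^+ 2)) -[leRHS]mulrDl ler_wpM2r ?binom_ge0//.
  rewrite (le_trans (point _ (node_itv k)))// lerD2l -mulrA ler_wpM2l//.
  rewrite -exprVn -exprMn.
apply: le_of_eq.
  by congr (_ ^+ 2); field; rewrite addrC natr1 pnatr_eq0.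
rewrite big_split/= -mulr_sumr sum_binom -mulr_sumr binom_variance mulr1.
have -> : e = e / 2 + e / 2 by field.
have -> : (e / 2 + e / 2) / 2 = e / 2 by field.
rewrite lerD2l (le_trans _ KN)//.
have /andP[t0 t1] := t01.
have -> : K / N.+1%:R ^+ 2 * (N.+1%:R * t * (1 - t)) = K / N.+1%:R * (t * (1 - t)).
  by field; rewrite addrC natr1 pnatr_eq0.
rewrite ler_piMr ?divr_ge0 ?(ltW Np)//; nra.
Qed.

End bernstein.

Section power_limits.
Context {R : realType}.
Implicit Types (a : nat -> R) (l b c : R).

Lemma cvg_powR a l b : 0 < l -> a @ \oo --> l ->
  (fun k => a k `^ b) @ \oo --> l `^ b.
Proof.
move=> l0 al; suff C : {for l, continuous (fun x : R => x `^ b)}.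
  exact: cvg_comp al C.
apply/differentiable_continuous/derivable1_diffP.
by apply: derivable_powR; rewrite in_itv/= andbT.
Qed.

Lemma cvg_powR0 a c : 0 < c -> (forall k, 0 <= a k) -> a @ \oo --> 0 ->
  (fun k => a k `^ c) @ \oo --> 0.
Proof.
move=> c0 a0 al; apply/cvgrPdist_le => e e0.
have ec : 0 < e `^ c^-1 by exact: powR_gt0.
have /cvgrPdist_le/(_ _ ec) := al; apply: filterS => k.
rewrite !sub0r !normrN ger0_norm// => ak.
rewrite ger0_norm ?powR_ge0//.
rewrite (le_trans (ge0_ler_powR (ltW c0) _ _ ak)) ?nnegrE ?powR_ge0//.
by rewrite -powRrM mulVf ?gt_eqF// powRr1// ltW.
Qed.

End power_limits.

Section complex_limits.
Context {R : realType}.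
Implicit Types (z t : nat -> R[i]) (l m : R[i]).

Definition cvgC z l :=
  (fun k => complex.Re (z k)) @ \oo --> complex.Re l /\
  (fun k => complex.Im (z k)) @ \oo --> complex.Im l.

Lemma eq_cvgC z t l : z =1 t -> cvgC z l -> cvgC t l.
Proof. by move=> /funext ->. Qed.

Lemma cvgC_cst l : cvgC (fun=> l) l.
Proof. by split; exact: cvg_cst. Qed.

Lemma cvgC_real (a : nat -> R) (b : R) : a @ \oo --> b ->
  cvgC (fun k => C_ R (a k)) (C_ R b).
Proof. by move=> ab; split => //=; exact: cvg_cst. Qed.

Lemma cvgCD z t l m : cvgC z l -> cvgC t m -> cvgC (fun k => z k + t k) (l + m).
Proof.
move=> [a b] [a' b']; split; rewrite ?cReD ?cImD.
  by under eq_fun do rewrite cReD; exact: cvgD.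
by under eq_fun do rewrite cImD; exact: cvgD.
Qed.

Lemma cvgCM z t l m : cvgC z l -> cvgC t m -> cvgC (fun k => z k * t k) (l * m).
Proof.
move=> [a b] [a' b']; split; rewrite ?cReM ?cImM.
  by under eq_fun do rewrite cReM; apply: cvgB; exact: cvgM.
by under eq_fun do rewrite cImM; apply: cvgD; exact: cvgM.
Qed.

Lemma cvgC_conj z l : cvgC z l -> cvgC (fun k => conjc (z k)) (conjc l).
Proof.
move=> [a b]; split.
  rewrite (_ : (fun k => complex.Re (conjc (z k))) = (fun k => complex.Re (z k))).
    by case: l a {b}.
  by apply/funext => k; case: (z k).
rewrite (_ : (fun k => complex.Im (conjc (z k))) = (fun k => - complex.Im (z k))).
  by case: l b {a} => u v /= b; exact: cvgN.
by apply/funext => k; case: (z k).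
Qed.

Lemma cvgC_nc z l : cvgC z l -> (fun k => nc (z k)) @ \oo --> nc l.
Proof.
move=> [a b].
have E (u : R[i]) : nc u = Num.sqrt (complex.Re u ^+ 2 + complex.Im u ^+ 2).
  by case: u.
rewrite E; under eq_fun do rewrite E.
have S : (fun k => complex.Re (z k) ^+ 2 + complex.Im (z k) ^+ 2) @ \oo -->
    complex.Re l ^+ 2 + complex.Im l ^+ 2.
  by apply: cvgD; apply: cvgM.
exact: cvg_comp S (@sqrt_continuous R _).
Qed.

Lemma cvgC_0 z : (fun k => nc (z k)) @ \oo --> 0 -> cvgC z 0.
Proof.
move=> z0; split; apply/cvgrPdist_le => e e0.
  have /cvgrPdist_le/(_ _ e0) := z0; apply: filterS => k.
  rewrite !sub0r !normrN ger0_norm ?nc_ge0//; apply: le_trans; exact: nc_Re.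
have /cvgrPdist_le/(_ _ e0) := z0; apply: filterS => k.
rewrite !sub0r !normrN ger0_norm ?nc_ge0//; apply: le_trans; exact: nc_Im.
Qed.

Lemma cvgC_meval n (a : nat -> 'I_n -> R[i]) (b : 'I_n -> R[i]) (f : cpoly R n) :
  (forall j, cvgC (fun k => a k j) (b j)) ->
  cvgC (fun k => meval (a k) f) (meval b f).
Proof.
move=> ab; elim/(@mpoly_ring_ind R n): f => [c|j|f g IHf IHg|f g IHf IHg].
- by rewrite mevalC; under eq_fun do rewrite mevalC; exact: cvgC_cst.
- by rewrite mevalXvar; under eq_fun do rewrite mevalXvar; exact: ab.
- by rewrite mevalD; under eq_fun do rewrite mevalD; exact: cvgCD.
- by rewrite mevalM; under eq_fun do rewrite mevalM; exact: cvgCM.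
Qed.

End complex_limits.

(** ** Dominated convergence *)

Section dominated.
Context {d} {T : measurableType d} {R : realType}.
Variables (mu : {measure set T -> \bar R}) (w : T -> R).
Context {muw : exp_integrable mu w}.

Lemma Nr_dominated (r : R) (F_ : nat -> T -> R[i]) (F : T -> R[i]) (B : T -> R) (e : R) :
  0 < r -> 0 < e -> (forall k, ctame w (F_ k)) -> ctame w F -> tame w B ->
  (forall k x, nc (F_ k x) <= B x) -> (forall x, cvgC (fun k => F_ k x) (F x)) ->
  exists k, Nr mu r (fun x => nc (F x - F_ k x)) <= e.
Proof.
move=> r0 e0 tF_ tF tB FB FF.
pose h k x := nc (F x - F_ k x) `^ r.
have th k : tame w (h k).
  have t1 : tame w (fun x => nc (F x - F_ k x)) by apply: tame_nc; exact: ctameB.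
  rewrite (_ : h k = (fun x => `|nc (F x - F_ k x)| `^ r)).
    exact: tame_powR (ltW r0) t1.
  by apply/funext => x; rewrite ger0_norm ?nc_ge0.
have tD : tame w (fun x => `|nc (F x) + B x| `^ r).
  by apply: tame_powR (ltW r0) _; apply: tameD => //; exact: tame_nc.
have [] := @dominated_convergence _ _ _ mu setT measurableT
  (fun k x => (h k x)%:E) (fun=> 0%E) (fun x => (`|nc (F x) + B x| `^ r)%:E).
- by move=> k; apply/measurable_EFinP; case: (th k).
- exact: measurable_cst.
- apply: aeW => x _; apply: cvg_EFin; first exact: nearW.
  rewrite /=; apply: cvg_powR0 => // [k|]; first exact: nc_ge0.
  rewrite -(@nc0 R) -(subrr (F x)); apply: cvgC_nc.
  apply: (@cvgCD R _ (fun k => - F_ k x) (F x) (- F x)); first exact: cvgC_cst.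
  rewrite -mulN1r; apply: (@eq_cvgC R (fun k => (-1) * F_ k x)).
    by move=> k; rewrite mulN1r.
  by apply: cvgCM => //; exact: cvgC_cst.
- exact: tame_integrable.
- apply: aeW => x k _; rewrite /= lee_fin ger0_norm ?powR_ge0//.
  have B0 : 0 <= B x := le_trans (nc_ge0 _) (FB k x).
  rewrite [X in _ <= X `^ _]ger0_norm ?addr_ge0 ?nc_ge0//.
  rewrite ge0_ler_powR ?(ltW r0) ?nnegrE ?addr_ge0 ?nc_ge0//.
  by apply: le_trans (ncB _ _) _; rewrite lerD2l.
move=> _ _; rewrite integral0.
have -> : (fun k => (\int[mu]_x (h k x)%:E)%E) = EFin \o (fun k => \int[mu]_x h k x).
  by apply/funext => k /=; rewrite (expect_fin (th k)).
move/fine_cvgP => [_].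
have er : 0 < e `^ r by exact: powR_gt0.
move=> /cvgrPdist_le/(_ _ er) [N _ /(_ N (leqnn N))] /=.
rewrite sub0r normrN => hN; exists N; apply: Nr_le_powR => //; first exact: ltW.
apply: le_trans hN; apply: le_trans (ler_norm _).
apply: le_of_eq; apply: eq_Rintegral => x _.
by rewrite /h ger0_norm ?nc_ge0.
Qed.

End dominated.

Section approximable.
Context {R : realType} {n : nat}.
Local Notation G := (gaussian R n).
Implicit Types (F : Rn R n -> R[i]) (r : R).

Definition approximable r F := forall e : R, 0 < e ->
  exists h : cpoly R n, Nr G r (fun x => nc (F x - peval h x)) <= e.

Lemma approximable_lim r (F_ : nat -> Rn R n -> R[i]) F B : 1 <= r ->
  (forall k, approximable r (F_ k)) ->
  (forall k, ctame wt (F_ k)) -> ctame wt F -> tame wt B ->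
  (forall k x, nc (F_ k x) <= B x) -> (forall x, cvgC (fun k => F_ k x) (F x)) ->
  approximable r F.
Proof.
move=> r1 aF tF_ tF tB FB FF e e0.
have r0 : 0 < r := lt_le_trans ltr01 r1.
have e20 : 0 < e / 2 by rewrite divr_gt0.
have [k Fk] := Nr_dominated r0 e20 tF_ tF tB FB FF.
have [h hk] := aF k _ e20.
exists h; rewrite [leRHS](splitr e).
have tP := ctame_peval h.
have tk := tF_ k.
apply: le_trans (lerD Fk hk).
have H : Nr G r (fun x => nc ((F x - F_ k x) + (F_ k x - peval h x))) <=
  Nr G r (fun x => nc (F x - F_ k x)) + Nr G r (fun x => nc (F_ k x - peval h x)).
  by apply: Nr_ncD => //; exact: ctameB.
apply: le_trans H.
apply: le_of_eq; apply: eq_Nr => x.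
by rewrite addrA subrK.
Qed.

End approximable.

Section polynomial_functions.
Context {R : realType} {n : nat} {X : Type}.
Variable v : X -> 'I_n -> R.
Implicit Types (F H : X -> R[i]).

(** Working with functions rather than with formal polynomials makes the
    closure under conjugation and under composition immediate. *)
Definition poly_in F := exists f : cpoly R n,
  forall x, meval (fun j => C_ R (v x j)) f = F x.

Lemma eq_poly_in F H : F =1 H -> poly_in F -> poly_in H.
Proof. by move=> FH [f fF]; exists f => x; rewrite fF. Qed.

Lemma poly_in_cst c : poly_in (fun=> c).
Proof. by exists (mpolyC n c) => x; rewrite mevalC. Qed.

Lemma poly_in_var j : poly_in (fun x => C_ R (v x j)).
Proof. by exists (Xvar j) => x; rewrite mevalXvar. Qed.

Lemma poly_inD F H : poly_in F -> poly_in H -> poly_in (fun x => F x + H x).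
Proof. by move=> [f fF] [g gH]; exists (f + g) => x; rewrite mevalD fF gH. Qed.

Lemma poly_inM F H : poly_in F -> poly_in H -> poly_in (fun x => F x * H x).
Proof. by move=> [f fF] [g gH]; exists (f * g) => x; rewrite mevalM fF gH. Qed.

Lemma poly_inX F k : poly_in F -> poly_in (fun x => F x ^+ k).
Proof.
move=> pF; elim: k => [|k IH]; first exact: poly_in_cst.
by apply: eq_poly_in (poly_inM pF IH) => x; rewrite exprS.
Qed.

Lemma poly_in_sum (I : Type) (s : seq I) (F : I -> X -> R[i]) :
  (forall i, poly_in (F i)) -> poly_in (fun x => \sum_(i <- s) F i x).
Proof.
move=> pF; elim: s => [|i s IH].
  by apply: eq_poly_in (poly_in_cst 0) => x; rewrite big_nil.
by apply: eq_poly_in (poly_inD (pF i) IH) => x; rewrite big_cons.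
Qed.

Lemma poly_in_conj F : poly_in F -> poly_in (fun x => conjc (F x)).
Proof.
move=> [f fF].
suff: poly_in (fun x => conjc (meval (fun j => C_ R (v x j)) f)).
  by apply: eq_poly_in => x; rewrite fF.
elim/(@mpoly_ring_ind R n): f {F fF} => [c|j|f g pf pg|f g pf pg].
- by apply: eq_poly_in (poly_in_cst (conjc c)) => x; rewrite mevalC.
- apply: eq_poly_in (poly_in_var j) => x; rewrite mevalXvar.
  by rewrite /= oppr0.
- by apply: eq_poly_in (poly_inD pf pg) => x; rewrite mevalD rmorphD.
- by apply: eq_poly_in (poly_inM pf pg) => x; rewrite mevalM rmorphM.
Qed.

End polynomial_functions.

Lemma poly_in_meval {R : realType} {n m : nat} {X : Type} (v : X -> 'I_n -> R)
  (z : X -> 'I_m -> R[i]) (f : cpoly R m) :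
  (forall j, poly_in v (z^~ j)) -> poly_in v (fun x => meval (z x) f).
Proof.
move=> pz; elim/(@mpoly_ring_ind R m): f => [c|j|f g pf pg|f g pf pg].
- by apply: eq_poly_in (poly_in_cst v c) => x; rewrite mevalC.
- by apply: eq_poly_in (pz j) => x; rewrite mevalXvar.
- by apply: eq_poly_in (poly_inD pf pg) => x; rewrite mevalD.
- by apply: eq_poly_in (poly_inM pf pg) => x; rewrite mevalM.
Qed.

Section sine_series.
Context {R : realType}.

Lemma cvg_sin_series (y : R) : series (sin_coeff y) @ \oo --> sin y.
Proof. rewrite unlock; exact: is_cvg_series_sin_coeff. Qed.

Lemma sin_series_le (y : R) k : `|series (sin_coeff y) k| <= expR `|y|.
Proof.
have nd : nondecreasing_seq (series (exp_coeff `|y|)).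
  by apply: nondecreasing_series => i _; rewrite divr_ge0 ?exprn_ge0.
have cv := is_cvg_series_exp_coeff `|y|.
apply: le_trans (_ : series (exp_coeff `|y|) k <= _); last first.
  exact: nondecreasing_cvgn_le nd cv k.
rewrite /series/= (le_trans (ler_norm_sum _ _ _))// ler_sum// => i _.
rewrite /sin_coeff /exp_coeff/= !normrM normrX normfV normr_nat.
rewrite normrX normrN normr1 expr1n mulr1 normr_nat.
by rewrite ler_wpM2r// ler_piMl ?exprn_ge0//; case: (odd i).
Qed.

Lemma sin_le_abs (y : R) : `|sin y| <= `|y|.
Proof.
have [y0|y0] := leP 0 y; first by rewrite [leRHS]ger0_norm//; exact: sin_le.
have := @sin_le R (- y); rewrite oppr_ge0 ltW// sinN normrN => /(_ isT) H.
by rewrite [leRHS]ltr0_norm.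
Qed.

End sine_series.

(** ** Approximation of extremal functions *)

Section psi.
Context {R : realType}.
Implicit Types (z : R[i]) (s e : R).

(** For [e = 0] this is, up to a positive factor, the conjugate of the gradient
    of [z |-> nc z `^ s]; a positive [e] makes it a smooth function of [z]. *)
Definition psi s e z : R[i] := conjc z * C_ R ((nc z ^+ 2 + e) `^ ((s - 2) / 2)).

Lemma nc_psi s e z : 0 <= e -> nc (psi s e z) = nc z * (nc z ^+ 2 + e) `^ ((s - 2) / 2).
Proof. by move=> e0; rewrite ncM nc_conj nc_real ger0_norm ?powR_ge0. Qed.

Lemma nc_psi_le s e z : 1 < s -> 0 <= e ->
  nc (psi s e z) <= (nc z ^+ 2 + e) `^ ((s - 1) / 2).
Proof.
move=> s1 e0; rewrite nc_psi//.
have z0 := nc_ge0 z.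
have E : (nc z ^+ 2 + e) `^ ((s - 1) / 2) =
  (nc z ^+ 2 + e) `^ (1 / 2) * (nc z ^+ 2 + e) `^ ((s - 2) / 2).
  rewrite -powRD; first by congr (_ `^ _); lra.
  by apply/implyP => /eqP H; exfalso; lra.
rewrite E ler_wpM2r ?powR_ge0//.
have -> : nc z = (nc z ^+ 2) `^ (1 / 2).
  by rewrite -powR_mulrn// -powRrM mul1r divff// powRr1.
rewrite ge0_ler_powR ?divr_ge0// ?nnegrE ?addr_ge0 ?exprn_ge0 ?powR_ge0//.
by rewrite -[in leRHS]powR_mulrn ?powR_ge0// -powRrM mul1r mulVf// powRr1 ?exprn_ge0// lerDl.
Qed.

Lemma cvgC_psi s (e : nat -> R) (z : nat -> R[i]) l : 1 < s ->
  (forall k, 0 <= e k) -> e @ \oo --> 0 -> cvgC z l ->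
  cvgC (fun k => psi s (e k) (z k)) (psi s 0 l).
Proof.
move=> s1 e0 ecv zl; have nl := cvgC_nc zl.
have C : (fun k => nc (z k) ^+ 2 + e k) @ \oo --> nc l ^+ 2 + 0.
  by apply: cvgD => //; apply: cvgM.
have [l0|l0] := eqVneq l 0.
  have -> : psi s 0 l = 0 by rewrite /psi l0 conjc0 mul0r.
  apply: cvgC_0.
  have D : (fun k => (nc (z k) ^+ 2 + e k) `^ ((s - 1) / 2)) @ \oo --> (0 : R).
    apply: cvg_powR0.
    - by rewrite divr_gt0 ?subr_gt0.
    - by move=> k; rewrite addr_ge0 ?exprn_ge0 ?nc_ge0.
    - by move: C; rewrite l0 nc0 expr0n addr0.
  apply: squeeze_cvgr (cvg_cst 0) D.
  by apply: nearW => k; rewrite nc_ge0/= nc_psi_le.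
apply: cvgCM; first exact: cvgC_conj.
apply: cvgC_real; apply: cvg_powR C.
by rewrite addr0 exprn_gt0// lt_neqAle nc_ge0 andbT eq_sym nc_eq0.
Qed.

End psi.

Lemma ctame_psi {d} {T : measurableType d} {R : realType}
  (mu : {measure set T -> \bar R}) (w : T -> R) {muw : exp_integrable mu w}
  (s e : R) (F : T -> R[i]) : 1 < s -> 0 <= e -> ctame w F ->
  ctame w (fun x => psi s e (F x)).
Proof.
move=> s1 e0 tF; have tn : tame w (fun x => nc (F x)) by exact: tame_nc.
have tB : tame w (fun x => `|nc (F x) ^+ 2 + e| `^ ((s - 1) / 2)).
  apply: tame_powR; first by rewrite divr_ge0// subr_ge0 ltW.
  apply: tameD; last exact: tame_cst.
  exact: tameM.
have [tc1 tc2] : ctame w (fun x => conjc (F x)) by exact: ctame_conj.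
have mp : measurable_fun setT (fun x => (nc (F x) ^+ 2 + e) `^ ((s - 2) / 2)).
  apply: measurableT_comp (measurable_powR _) _.
  apply: measurable_funD => //; apply: measurable_funX.
  exact: tame_measurable tn.
have bnd x : nc (psi s e (F x)) <= `|nc (F x) ^+ 2 + e| `^ ((s - 1) / 2).
  by rewrite ger0_norm ?addr_ge0 ?exprn_ge0 ?nc_ge0// nc_psi_le.
split.
  apply: (tame_le _ tB) => [|x].
    under eq_fun do rewrite cReM /= mulr0 subr0.
    by apply: measurable_funM => //; exact: tame_measurable tc1.
  by apply: le_trans (nc_Re _) _; rewrite [leRHS]ger0_norm ?powR_ge0.
apply: (tame_le _ tB) => [|x].
  under eq_fun do rewrite cImM /= mulr0 add0r.
  by apply: measurable_funM => //; exact: tame_measurable tc2.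
by apply: le_trans (nc_Im _) _; rewrite [leRHS]ger0_norm ?powR_ge0.
Qed.

Lemma poly_in_bern {R : realType} {n : nat} {X : Type} (v : X -> 'I_n -> R)
  (phi : R -> R) N (f : X -> R) :
  poly_in v (fun x => C_ R (f x)) -> poly_in v (fun x => C_ R (bern phi N (f x))).
Proof.
move=> pf.
pose c (k : 'I_N.+2) := C_ R (phi (k%:R / N.+1%:R) * 'C(N.+1, k)%:R).
pose H x := \sum_(k < N.+2) c k * C_ R (f x) ^+ k * (1 + (- 1) * C_ R (f x)) ^+ (N.+1 - k).
apply: (@eq_poly_in R n X v H) => [x|].
  rewrite /H /bern rmorph_sum; apply: eq_bigr => k _.
  rewrite /c /binom !rmorphM !rmorphXn mulN1r rmorphB rmorph1.
  by rewrite !mulrA.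
apply: poly_in_sum => k; apply: poly_inM; last first.
  apply: poly_inX; apply: poly_inD; first exact: poly_in_cst.
  by apply: poly_inM => //; exact: poly_in_cst.
by apply: poly_inM; [exact: poly_in_cst|exact: poly_inX].
Qed.

Lemma sin_sub_le {R : realType} (y : R) : `|sin y - y| <= 2 * y ^+ 2.
Proof.
have [y1|y1] := leP `|y| 1; last first.
  apply: le_trans (ler_normB _ _) _.
  have : `|sin y| <= 1 by rewrite ler_norml sin_geN1 sin_le1.
  rewrite -(real_normK (num_real y)); nra.
suff H (z : R) : 0 <= z <= 1 -> `|sin z - z| <= 2 * z ^+ 2.
  have [y0|y0] := leP 0 y; first by apply: H; rewrite y0 (le_trans (ler_norm _) y1).
  rewrite -normrN opprB addrC -sinN -[X in `|_ + X|]opprK -[in leRHS]sqrrN; apply: H.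
  by rewrite oppr_ge0 (ltW y0)/= (le_trans (ler_norm _))// normrN.
move=> z01; apply: le_trans (sin_sub_bound z01) _.
by rewrite ler_peMl ?sqr_ge0// ler1n.
Qed.

Section density.
Context {R : realType} {n : nat}.
Local Notation G := (gaussian R n).
Implicit Types (r a s e : R) (u : cpoly R n) (x : Rn R n).

(** Bounded, and equal to the coordinates in the limit [a = 0]. *)
Definition sinw a x (j : 'I_n) : R := sin (a * tnth x j) / a.

Lemma sinw_le a x j : 0 < a -> `|sinw a x j| <= `|tnth x j|.
Proof.
move=> a0; rewrite /sinw normrM normfV (gtr0_norm a0) ler_pdivrMr//.
by rewrite (le_trans (sin_le_abs _))// normrM (gtr0_norm a0) mulrC.
Qed.

Lemma sinw_bound a x j : 0 < a -> `|sinw a x j| <= a^-1.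
Proof.
move=> a0; rewrite /sinw normrM normfV (gtr0_norm a0).
by rewrite ler_piMl ?invr_ge0 ?(ltW a0)// ler_norml sin_geN1 sin_le1.
Qed.

Lemma tame_sinw a j : 0 < a -> tame wt (fun x => sinw a x j).
Proof.
move=> a0; apply: (@tame_le _ _ _ G _ _ _ (fun x => tnth x j)).
- apply: measurable_funM => //; apply: measurableT_comp.
    by apply: continuous_measurable_fun; exact: continuous_sin.
  by apply: measurable_funM => //; exact: measurable_tnth.
- exact: tame_coord.
- by move=> x; exact: sinw_le.
Qed.

Lemma approximable_poly_in r F : 1 <= r ->
  poly_in (fun x (j : 'I_n) => tnth x j) F -> approximable r F.
Proof.
move=> r1 [h hF] e e0; exists h.
rewrite (@eq_Nr _ _ _ G r _ (fun=> 0)); last first.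
  by move=> x; rewrite /peval hF subrr nc0.
by rewrite Nr_cst ?normr0 ?(ltW e0)// (lt_le_trans ltr01).
Qed.

(** The Taylor polynomials of the sine are dominated by an exponential. The
    functions [sinw a] serve as a bounded substitute for the coordinates: a
    continuous function of them involves only a compact set of values, on which
    it is a uniform limit of polynomials. *)
Lemma approximable_sin r a u : 1 <= r -> 0 < a ->
  approximable r (fun x => meval (fun j => C_ R (sinw a x j)) u).
Proof.
move=> r1 a0.
pose S k x j := series (sin_coeff (a * tnth x j)) k / a.
have pS k : poly_in (fun x (j : 'I_n) => tnth x j)
    (fun x => meval (fun j => C_ R (S k x j)) u).
  apply: poly_in_meval => j.
  pose H x := \sum_(i <- index_iota 0 k)
    C_ R ((odd i)%:R * (-1) ^+ i.-1./2 * a ^+ i / i`!%:R / a) * C_ R (tnth x j) ^+ i.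
  apply: (@eq_poly_in R n _ _ H) => [x|].
    rewrite /H /S /series/= mulr_suml rmorph_sum; apply: eq_bigr => i _.
    rewrite /sin_coeff/= -rmorphXn -rmorphM; congr (C_ R _).
    by rewrite exprMn; ring.
  apply: poly_in_sum => i; apply: poly_inM; first exact: poly_in_cst.
  by apply: poly_inX; exact: (poly_in_var (fun x (j : 'I_n) => tnth x j) j).
have tS k : ctame wt (fun x => meval (fun j => C_ R (S k x j)) u).
  have [h hS] := pS k; apply: eq_ctame (ctame_peval h) => x; exact: hS.
have [K uK] := meval_bound u.
pose M x := 1 + expR (a * wt x) / a.
apply: (@approximable_lim R n r
  (fun k x => meval (fun j => C_ R (S k x j)) u) _
  (fun x => K%:R * M x ^+ K) r1).
- by move=> k; exact: approximable_poly_in.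
- exact: tS.
- by apply: ctame_meval => j; apply: ctame_real; exact: tame_sinw.
- apply: tameZ; apply: tameX; apply: tameD; first exact: tame_cst.
  have H : tame wt (fun x => a^-1 * expR (a * wt x)).
    by apply: tameZ; exact: tame_expw.
  by apply: eq_tame H => x; rewrite mulrC.
- move=> k x; apply: uK => [|j]; first by rewrite lerDl divr_ge0 ?expR_ge0 ?ltW.
  rewrite nc_real /S normrM normfV (gtr0_norm a0).
  rewrite (_ : M x = 1 + expR (a * wt x) / a)//.
  apply: ler_wpDl => //; rewrite ler_wpM2r ?invr_ge0 ?(ltW a0)//.
  apply: le_trans (sin_series_le _ _) _.
  by rewrite ler_expR normrM (gtr0_norm a0) ler_wpM2l ?(ltW a0)// coord_le_wt.
- move=> x; apply: cvgC_meval => j; apply: cvgC_real.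
  by apply: cvgM; [exact: cvg_sin_series|exact: cvg_cst].
Qed.

Lemma meval_sinw_bound a u : 0 < a -> exists2 M : R, 0 < M &
  forall x, nc (meval (fun j => C_ R (sinw a x j)) u) <= M.
Proof.
move=> a0; have [K uK] := meval_bound u.
have M1 : 1 <= 1 + a^-1 by rewrite lerDl invr_ge0 ltW.
exists (K%:R * (1 + a^-1) ^+ K + 1) => [|x].
  by rewrite ltr_wpDl// mulr_ge0// exprn_ge0// (le_trans _ M1).
rewrite ler_wpDr//; apply: uK => // j.
by rewrite nc_real ler_wpDl// sinw_bound.
Qed.

Lemma powR_affine_bound (M e b t : R) : 0 < M -> 0 < e -> 0 <= t <= 1 ->
  `|(M * t + e) `^ b| <= e `^ b + (M + e) `^ b.
Proof.
move=> M0 e0 /andP[t0 t1]; rewrite ger0_norm ?powR_ge0//.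
have le1 : e <= M * t + e by rewrite lerDr mulr_ge0// ltW.
have le2 : M * t + e <= M + e by rewrite lerD2r ler_piMr// ltW.
have p : 0 < M * t + e := lt_le_trans e0 le1.
have [b0|b0] := leP 0 b.
  by rewrite ler_wpDl ?powR_ge0// ge0_ler_powR// nnegrE ?ltW// addr_gt0.
rewrite ler_wpDr ?powR_ge0// -(opprK b) !(powRN _ (- b)).
rewrite lef_pV2 ?posrE ?powR_gt0//.
by rewrite ge0_ler_powR ?oppr_ge0 ?(ltW b0) ?nnegrE ?(ltW e0) ?(ltW p).
Qed.

Lemma powR_affine_continuous (M e b t : R) : 0 < M -> 0 < e -> 0 <= t <= 1 ->
  forall d : R, 0 < d -> exists2 dl : R, 0 < dl &
    forall v : R, 0 <= v <= 1 -> `|v - t| < dl ->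
      `|(M * v + e) `^ b - (M * t + e) `^ b| <= d.
Proof.
move=> M0 e0 /andP[t0 t1] d d0.
have p : 0 < M * t + e by rewrite ltr_wpDl// mulr_ge0// ltW.
have c1 : {for M * t + e, continuous (fun y : R => y `^ b)}.
  apply/differentiable_continuous/derivable1_diffP.
  by apply: derivable_powR; rewrite in_itv/= andbT.
have c2 : (fun v : R => M * v + e) @ t --> M * t + e.
  by apply: cvgD; [apply: cvgM; [exact: cvg_cst|exact: cvg_id]|exact: cvg_cst].
have /cvgrPdist_le/(_ _ d0) := cvg_comp _ _ c2 c1.
move=> /nbhs_ballP[dl /= dl0 H]; exists dl => // v _ vt.
by rewrite distrC; apply: H; rewrite /ball/= distrC.
Qed.

(** The modulus enters only through its square, a polynomial with values in a
    bounded interval, so that Bernstein polynomials in one variable suffice. *)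
Lemma approximable_psi_sin r s e a u : 1 <= r -> 0 < e -> 0 < a ->
  approximable r (fun x => psi s e (meval (fun j => C_ R (sinw a x j)) u)).
Proof.
move=> r1 e0 a0.
have [M M0 uM] := meval_sinw_bound u a0.
pose U x := meval (fun j => C_ R (sinw a x j)) u.
pose b := (s - 2) / 2.
pose phi t : R := (M ^+ 2 * t + e) `^ b.
pose t x := nc (U x) ^+ 2 / M ^+ 2.
have M20 : 0 < M ^+ 2 by rewrite exprn_gt0.
have t01 x : 0 <= t x <= 1.
  rewrite /t divr_ge0 ?sqr_ge0//= ler_pdivrMr// mul1r.
  by rewrite ler_pXn2r ?nnegrE ?nc_ge0 ?(ltW M0)// uM.
have pU : poly_in (sinw a) U by exists u.
have pt : poly_in (sinw a) (fun x => C_ R (t x)).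
  apply: eq_poly_in (poly_inM (poly_inM (poly_in_conj pU) pU)
    (poly_in_cst _ (C_ R (M ^- 2)))) => x.
  by rewrite conjcM -rmorphM.
pose F N x := conjc (U x) * C_ R (bern phi N (t x)).
have pF N : poly_in (sinw a) (F N).
  by apply: poly_inM; [exact: poly_in_conj|exact: poly_in_bern].
have tsin (h : cpoly R n) : ctame wt (fun x => meval (fun j => C_ R (sinw a x j)) h).
  by apply: ctame_meval => j; apply: ctame_real; exact: tame_sinw.
have phiE x : phi (t x) = (nc (U x) ^+ 2 + e) `^ b.
  by rewrite /phi /t mulrCA divff ?mulr1// gt_eqF.
pose B := e `^ b + (M ^+ 2 + e) `^ b.
have phiB v : 0 <= v <= 1 -> `|phi v| <= B by exact: powR_affine_bound.
apply: (@approximable_lim R n r F _ (fun=> M * B) r1).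
- move=> N; have [h hF] := pF N.
  rewrite (_ : F N = (fun x => meval (fun j => C_ R (sinw a x j)) h)).
    exact: approximable_sin.
  by apply/funext => x; rewrite hF.
- by move=> N; have [h hF] := pF N; apply: eq_ctame (tsin h) => x; exact: hF.
- have [h hF] := poly_in_conj pU.
  apply: ctameM; first by apply: eq_ctame (tsin h) => x; exact: hF.
  have mm : measurable_fun setT (fun x => (nc (U x) ^+ 2 + e) `^ b).
    apply: measurableT_comp (measurable_powR _) _.
    apply: measurable_funD => //; apply: measurable_funX.
    have H : tame wt (fun x => nc (U x)) by apply: tame_nc; exact: tsin.
    exact: tame_measurable H.
  apply: ctame_real; apply: (tame_le mm (tame_cst B)) => x.
  rewrite -phiE; apply: le_trans (phiB _ (t01 x)) (ler_norm _).
- exact: tame_cst.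
- move=> N x; rewrite ncM nc_conj nc_real ler_pM ?nc_ge0//; first exact: uM.
  exact: bern_bound.
- move=> x; apply: cvgCM; first exact: cvgC_cst.
  apply: cvgC_real; rewrite -phiE; apply: (@cvg_bern R phi B) => //.
  have /andP[p1 p2] := t01 x.
  by apply: powR_affine_continuous.
Qed.

(** Let the truncation and the regularization disappear together. *)
Lemma approximable_psi r s u : 1 <= r -> 1 < s ->
  approximable r (fun x => psi s 0 (peval u x)).
Proof.
move=> r1 s1.
pose a k : R := k.+1%:R^-1.
have a0 k : 0 < a k by rewrite invr_gt0.
have a1 k : a k <= 1 by rewrite invf_le1// ler1n.
have acv : a @ \oo --> 0 := @cvg_harmonic R.
have [K uK] := meval_bound u.
pose U k x := meval (fun j => C_ R (sinw (a k) x j)) u.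
pose M x : R := K%:R * (1 + wt x) ^+ K.
have M0 x : 0 <= M x by rewrite mulr_ge0// exprn_ge0// addr_ge0// wt_ge0.
have UM k x : nc (U k x) <= M x.
  apply: uK => [|j]; first by rewrite lerDl wt_ge0.
  rewrite nc_real ler_wpDl// (le_trans (sinw_le _ _ (a0 k)))//.
  exact: coord_le_wt.
have tM : tame wt M.
  by apply: tameZ; apply: tameX; apply: tameD; [exact: tame_cst|exact: tame_w].
apply: (@approximable_lim R n r (fun k x => psi s (a k) (U k x)) _
  (fun x => `|M x ^+ 2 + 1| `^ ((s - 1) / 2)) r1).
- by move=> k; apply: approximable_psi_sin.
- move=> k; apply: ctame_psi => //; first exact: ltW.
  by apply: ctame_meval => j; apply: ctame_real; exact: tame_sinw.
- by apply: ctame_psi => //; exact: ctame_peval.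
- apply: tame_powR; first by rewrite divr_ge0// subr_ge0 ltW.
  by apply: tameD; [exact: tameX|exact: tame_cst].
- move=> k x; apply: le_trans (nc_psi_le _ s1 (ltW (a0 k))) _.
  rewrite [X in _ <= X `^ _]ger0_norm ?addr_ge0 ?exprn_ge0//.
  rewrite ge0_ler_powR ?divr_ge0 ?subr_ge0 ?(ltW s1) ?nnegrE ?addr_ge0 ?exprn_ge0 ?nc_ge0 ?(ltW (a0 k))//.
  by rewrite lerD// ler_pXn2r ?nnegrE ?nc_ge0.
- move=> x; apply: cvgC_psi => // [k|]; first exact: ltW.
  apply: cvgC_meval => j; apply: cvgC_real.
  apply/cvgrPdist_le => d d0.
  have acv' : (fun k => 2 * tnth x j ^+ 2 * a k) @ \oo --> 0.
    by rewrite -(mulr0 (2 * tnth x j ^+ 2)); apply: cvgM => //; exact: cvg_cst.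
  have /cvgrPdist_le/(_ _ d0) := acv'; apply: filterS => k.
  rewrite sub0r normrN => H; apply: le_trans (le_trans (ler_norm _) H).
  rewrite distrC /sinw.
  have -> : sin (a k * tnth x j) / a k - tnth x j =
    (sin (a k * tnth x j) - a k * tnth x j) / a k.
    by field; rewrite gt_eqF.
  rewrite normrM normfV (gtr0_norm (a0 k)) ler_pdivrMr//.
  apply: le_trans (sin_sub_le _) _; apply: le_of_eq; ring.
Qed.

End density.

(** * Duality for norms and for distances to polynomials *)

Section psi_algebra.
Context {R : realType}.
Implicit Types (z t w : R[i]) (p : R).

Lemma nc_psi0 p z : 1 < p -> nc (psi p 0 z) = nc z `^ (p - 1).
Proof.
move=> p1; rewrite nc_psi// addr0.
have p10 : p - 1 != 0 by rewrite subr_eq0 gt_eqF.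
have [->|z0] := eqVneq (nc z) 0; first by rewrite mul0r powR0.
rewrite -powR_mulrn ?nc_ge0// -powRrM -{1}(powRr1 (nc_ge0 z)) -powRD ?z0 ?implybT//.
by congr (_ `^ _); field.
Qed.

Lemma psi_mul p z : 1 < p -> psi p 0 z * z = C_ R (nc z `^ p).
Proof.
move=> p1; have p10 : p - 1 != 0 by rewrite subr_eq0 gt_eqF.
have -> : nc z `^ p = nc z * nc (psi p 0 z).
  rewrite nc_psi0// -{2}(powRr1 (nc_ge0 z)) -powRD; first by congr (_ `^ _); ring.
  by apply/implyP => /eqP H; exfalso; lra.
rewrite nc_psi// mulrA -expr2.
have -> (a b : R) : C_ R (a * b) = C_ R a * C_ R b by exact: rmorphM.
rewrite -(conjcM z) /psi.
by rewrite mulrAC.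
Qed.

Lemma psiM p z t : psi p 0 (z * t) = psi p 0 z * psi p 0 t.
Proof.
rewrite /psi !addr0 ncM exprMn powRM ?exprn_ge0 ?nc_ge0// !rmorphM.
by rewrite mulrACA.
Qed.

(** Convexity of the [p]-th power of the modulus, in the form given by Young's
    inequality applied to [Re (psi w * z) <= nc w `^ (p - 1) * nc z]. *)
Lemma psi_convex p z w : 1 < p ->
  nc w `^ p + p * complex.Re (psi p 0 w * (z - w)) <= nc z `^ p.
Proof.
move=> p1; have [p0 q1 pq] := conj_exp p1.
set q := p / (p - 1) in q1 pq.
have q0 : 0 < q by apply: lt_trans q1.
have H1 : complex.Re (psi p 0 w * z) <= nc z `^ p / p + nc w `^ p / q.
  apply: le_trans (ler_norm _) _; apply: le_trans (nc_Re _) _.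
  rewrite ncM nc_psi0// mulrC.
  apply: le_trans (conjugate_powR (nc_ge0 z) (powR_ge0 _ _) p0 q0 pq) _.
  rewrite lerD2l -powRrM (_ : (p - 1) * q = p)//.
  by rewrite /q; field; rewrite subr_eq0 gt_eqF.
rewrite mulrBr cReD psi_mul//.
have -> : complex.Re (- C_ R (nc w `^ p)) = - nc w `^ p by [].
have H2 : p * complex.Re (psi p 0 w * z) <= nc z `^ p + nc w `^ p * (p - 1).
  apply: le_trans (ler_wpM2l (ltW p0) H1) _.
  apply: le_of_eq; rewrite /q; field.
  by rewrite !gt_eqF// ?subr_gt0.
lra.
Qed.

Lemma psi_near1 p (d : R) : 0 < d -> exists2 dl : R, 0 < dl &
  forall w, nc w <= dl -> nc (psi p 0 (1 + w) - 1) <= d.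
Proof.
move=> d0; set b := (p - 2) / 2.
have d40 : 0 < d / 4 by rewrite divr_gt0.
have c1 : {for 1, continuous (fun y : R => y `^ b)}.
  apply/differentiable_continuous/derivable1_diffP.
  by apply: derivable_powR; rewrite in_itv/= andbT.
have /cvgrPdist_le/(_ _ d40) := c1.
move=> /nbhs_ballP[e /= e0 H].
exists (Num.min (e / 4) (Num.min 1 (d / 2))).
  by rewrite !lt_min ltr01 !divr_gt0.
move=> w; rewrite !le_min => /and3P[we w1 wd].
set v := nc (1 + w).
have v0 : 0 <= v := nc_ge0 _.
have v1 : v <= 1 + nc w by rewrite /v -[X in _ <= X + _](@nc1 R) ncD.
have v2 : 1 - nc w <= v.
  have := @nc_dist R 1 (- w); rewrite nc1 ncN opprK; exact.
have w0 := nc_ge0 w.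
have Hv : `|(v ^+ 2) `^ b - 1| <= d / 4.
  have := H (v ^+ 2); rewrite powR1 distrC; apply.
  rewrite /ball/= distrC.
  have -> : v ^+ 2 - 1 = (v - 1) * (v + 1) by ring.
  rewrite normrM [X in _ * X]ger0_norm ?addr_ge0//.
  have a1 : `|v - 1| <= nc w by rewrite ler_norml; apply/andP; split; lra.
  have a0 := normr_ge0 (v - 1).
  by apply: (@le_lt_trans _ _ (e / 4 * 3)); [nra|lra].
have -> : psi p 0 (1 + w) - 1 =
  conjc (1 + w) * C_ R ((v ^+ 2) `^ b - 1) + conjc w.
  rewrite /psi -/v addr0 -/b rmorphB rmorph1 mulrBr mulr1.
  by rewrite -addrA -[- conjc (1 + w)]opprK; congr (_ + _); rewrite opprK rmorphD rmorph1 opprD subrK.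
apply: le_trans (ncD _ _) _; rewrite ncM !nc_conj nc_real -/v.
have b0 := normr_ge0 ((v ^+ 2) `^ b - 1).
by nra.
Qed.

(** Multiplicativity reduces the case of a small quotient [t / z] to continuity
    at [1]; when the quotient is not small, [nc t] controls both terms. *)
Lemma psi_modulus p (d : R) : 1 < p -> 0 < d -> exists2 K : R, 0 < K &
  forall z t, nc (psi p 0 (z + t) - psi p 0 z) <=
    d * nc z `^ (p - 1) + K * nc t `^ (p - 1).
Proof.
move=> p1 d0; have [e e0 H] := psi_near1 p d0.
have p10 : 0 <= p - 1 by rewrite subr_ge0 ltW.
exists (2 * (1 + e^-1) `^ (p - 1)).
  by rewrite mulr_gt0// powR_gt0// addr_gt0// invr_gt0.
move=> z t.
have [zt|zt] := ltP (e * nc z) (nc t); last first.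
  have [z0|z0] := eqVneq z 0.
    have t0 : t = 0.
      by apply/eqP; rewrite -nc_eq0 eq_le nc_ge0 andbT (le_trans zt)// z0 nc0 mulr0.
    by rewrite t0 addr0 subrr nc0 addr_ge0// !mulr_ge0 ?powR_ge0// ltW.
  have E : z + t = z * (1 + t / z).
    by rewrite mulrDr mulr1 (mulrC z (t / z)) divfK.
  rewrite {1}E psiM -[X in _ - X]mulr1 -mulrBr.
  rewrite ncM nc_psi0// mulrC ler_wpDr ?mulr_ge0 ?powR_ge0//.
  rewrite ler_wpM2r ?powR_ge0//; apply: H.
  by rewrite ncM ncV ler_pdivrMr// lt_neqAle nc_ge0 andbT eq_sym nc_eq0.
apply: le_trans (ncB _ _) _; rewrite !nc_psi0//.
have zt' : nc z <= e^-1 * nc t by rewrite mulrC ler_pdivlMr// mulrC ltW.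
have t0 := nc_ge0 t.
have e10 : 0 <= 1 + e^-1 by rewrite addr_ge0// invr_ge0 ltW.
have a1 : nc (z + t) `^ (p - 1) <= (1 + e^-1) `^ (p - 1) * nc t `^ (p - 1).
  rewrite -powRM// ge0_ler_powR ?nnegrE ?mulr_ge0 ?nc_ge0//.
  by apply: le_trans (ncD _ _) _; lra.
have a2 : nc z `^ (p - 1) <= (1 + e^-1) `^ (p - 1) * nc t `^ (p - 1).
  rewrite -powRM// ge0_ler_powR ?nnegrE ?mulr_ge0 ?nc_ge0//.
  by lra.
have a3 : 0 <= d * nc z `^ (p - 1) by rewrite mulr_ge0 ?powR_ge0// ltW.
by lra.
Qed.

End psi_algebra.

Section duality.
Context {R : realType} {n : nat}.
Local Notation G := (gaussian R n).
Local Notation E := (Rintegral G setT).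
Implicit Types (f g h u : cpoly R n).
Variables p q : R.
Hypotheses (p1 : 1 < p) (q1 : 1 < q) (pq : p^-1 + q^-1 = 1).

Let p0 : 0 < p. Proof. exact: lt_trans p1. Qed.
Let q0 : 0 < q. Proof. exact: lt_trans q1. Qed.

Let pqE : (p - 1) * q = p.
Proof.
have : p * q * (p^-1 + q^-1) = p * q by rewrite pq mulr1.
have -> : p * q * (p^-1 + q^-1) = q + p by field; rewrite !gt_eqF.
by move=> H; rewrite mulrBl mul1r -H; ring.
Qed.

Local Notation N r f := (Nr G r (norm_poly f)).

Lemma Nr_psi u : Nr G q (fun x => nc (psi p 0 (peval u x))) = N p u `^ (p - 1).
Proof.
rewrite NrE.
have -> : E (fun x => `|nc (psi p 0 (peval u x))| `^ q) = N p u `^ p.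
  rewrite (Nr_powR _ p0); apply: eq_Rintegral => x _.
  rewrite ger0_norm ?nc_ge0// nc_psi0// -powRrM pqE /norm_poly ger0_norm//.
  exact: nc_ge0.
rewrite -powRrM; congr (_ `^ _).
by rewrite -{1}pqE -mulrA mulfV ?mulr1// gt_eqF.
Qed.

Lemma ctame_psi_peval u : ctame wt (fun x => psi p 0 (peval u x)).
Proof. by apply: ctame_psi => //; exact: ctame_peval. Qed.

Lemma EC_psi_self u : EC G (fun x => psi p 0 (peval u x) * peval u x) = C_ R (N p u `^ p).
Proof.
rewrite (@eq_EC _ _ _ G _ (fun x => C_ R (nc (peval u x) `^ p))); last first.
  by move=> x; rewrite psi_mul.
rewrite EC_real (Nr_powR _ p0); apply: (congr1 (C_ R)); apply: eq_Rintegral => x _.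
by rewrite ger0_norm ?norm_poly_ge0.
Qed.

(** An approximation of the extremal function inherits its norm. *)
Lemma Nr_near_psi u h (e : R) :
  Nr G q (fun x => nc (psi p 0 (peval u x) - peval h x)) <= e ->
  N q h <= N p u `^ (p - 1) + e.
Proof.
move=> hu; have tu := ctame_psi_peval u; have th := ctame_peval h.
have td : ctame wt (fun x => psi p 0 (peval u x) - peval h x) by exact: ctameB.
have M : Nr G q (fun x => nc ((- 1) * (psi p 0 (peval u x) - peval h x) + psi p 0 (peval u x))) <=
  Nr G q (fun x => nc ((- 1) * (psi p 0 (peval u x) - peval h x))) +
  Nr G q (fun x => nc (psi p 0 (peval u x))).
  by apply: Nr_ncD => //; [exact: ltW|exact: ctameZ].
rewrite (Nr_ncZ _ q0 td) ncN nc1 mul1r Nr_psi in M.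
rewrite addrC; apply: le_trans (lerD hu (lexx _)).
apply: le_trans M; apply: le_of_eq.
by apply: eq_Nr => x; rewrite /norm_poly mulN1r opprB subrK.
Qed.

(** [g] is tested against a polynomial close to [psi p 0 g], the function that
    makes Hoelder's inequality an equality. *)
Lemma norm_le_dual g (B : R) : 0 <= B ->
  (forall h, nc (pairing g h) <= B * N q h) -> N p g <= B.
Proof.
move=> B0 H; set A := N p g.
have A0 : 0 <= A := Nr_ge0 _ _.
have tp := ctame_psi_peval g.
have key e : 0 < e -> A `^ p <= B * A `^ (p - 1) + (A + B) * e.
  move=> e0; have [h hE] := approximable_psi g (ltW q1) p1 e0.
  have tg := ctame_peval g; have th := ctame_peval h.
  have td : ctame wt (fun x => psi p 0 (peval g x) - peval h x) by exact: ctameB.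
  have -> : A `^ p = nc (EC G (fun x => psi p 0 (peval g x) * peval g x)).
    by rewrite EC_psi_self nc_real ger0_norm ?powR_ge0.
  rewrite (@eq_EC _ _ _ G _ (fun x => peval g x * (psi p 0 (peval g x) - peval h x) +
     peval g x * peval h x)); last first.
    by move=> x; rewrite -mulrDr subrK mulrC.
  rewrite EC_D; [|exact: ctameM|exact: ctameM].
  rewrite -pairingE; apply: le_trans (ncD _ _) _.
  have H1 : nc (EC G (fun x => peval g x * (psi p 0 (peval g x) - peval h x))) <=
     A * Nr G q (fun x => nc (psi p 0 (peval g x) - peval h x)).
    exact: nc_EC_hoelder.
  have H2 : N q h <= A `^ (p - 1) + e.
    exact: Nr_near_psi hE.
  have H3 := H h.
  have H4 := ler_wpM2l A0 hE.
  have H5 := ler_wpM2l B0 H2.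
  lra.
have {}key : A `^ p - B * A `^ (p - 1) <= 0.
  apply: (@le0_of_small _ _ (A + B)) => t /andP[t0 _].
  by have := key t t0; lra.
have [->//|Az] := eqVneq A 0.
have Ap : 0 < A by rewrite lt_neqAle eq_sym Az.
have HE : A `^ p = A * A `^ (p - 1).
  rewrite -{2}(powRr1 A0) -powRD ?Az ?implybT//; congr (_ `^ _); ring.
by move: key; rewrite HE -mulrBl pmulr_lle0 ?powR_gt0// subr_le0.
Qed.

End duality.

Lemma expansion_arith {R : realFieldType} (p t d K a b r r' T X : R) :
  X + p * (- t * r) <= a -> p * t * r <= p * t * (r' + d * (a + b) + K * (T * b)) ->
  X <= (1 + p * t * d) * a + p * t * r' + p * t * (d + K * T) * b.
Proof.
move=> H1 H2.
have E : a + p * t * (r' + d * (a + b) + K * (T * b)) =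
   (1 + p * t * d) * a + p * t * r' + p * t * (d + K * T) * b by ring.
have E2 : p * (- t * r) = - (p * t * r) by ring.
rewrite -E; rewrite E2 in H1; lra.
Qed.

Lemma ler_add_mid {R : realFieldType} (v1 v2 v3 v4 v5 : R) :
  v2 <= v3 + v4 -> v3 <= v5 -> v1 + v2 <= v1 + v5 + v4.
Proof. by move=> ? ?; lra. Qed.

Lemma near_critical_arith {R : realFieldType} (m S e d K T pt eta z Vu Vh V' : R) :
  0 < d -> 0 < K -> 0 <= T -> 0 < pt -> d * (m + 1 + S) = e / 3 ->
  K * T * (S + 1) = e / 3 -> eta <= 1 -> eta <= pt * (e / 3) ->
  V' <= Vu + pt * (- z + d * (Vu + Vh) + K * T * Vh) -> m <= V' -> Vu <= m + eta ->
  Vh <= S -> z <= e.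
Proof.
move=> d0 K0 T0 pt0 Ed EK eta1 eta2 H1 H2 H3 H4.
have A1 : d * (Vu + Vh) <= e / 3 by rewrite -Ed ler_wpM2l ?(ltW d0)//; lra.
have A2 : K * T * Vh <= e / 3.
  by rewrite -EK ler_wpM2l ?mulr_ge0 ?(ltW K0)//; lra.
suff : 0 <= pt * (e / 3 + (- z + d * (Vu + Vh) + K * T * Vh)).
  by rewrite pmulr_rge0//; lra.
by rewrite mulrDr; lra.
Qed.

Section distance.
Context {R : realType} {n : nat}.
Local Notation G := (gaussian R n).
Local Notation E := (Rintegral G setT).
Implicit Types (f g h u : cpoly R n).
Variables p q : R.
Hypotheses (p1 : 1 < p) (q1 : 1 < q) (pq : p^-1 + q^-1 = 1).

Let p0 : 0 < p. Proof. exact: lt_trans p1. Qed.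
Let q0 : 0 < q. Proof. exact: lt_trans q1. Qed.
Let p10 : 0 < p - 1. Proof. by rewrite subr_gt0. Qed.

Local Notation N r f := (Nr G r (norm_poly f)).
Local Notation V f := (N p f `^ p).

Lemma powR_pred (c : R) : 0 <= c -> c `^ (p - 1) * c = c `^ p.
Proof.
move=> c0; rewrite -{2}(powRr1 c0) -powRD; first by congr (_ `^ _); ring.
by rewrite subrK gt_eqF.
Qed.

Lemma powR_mul_le (a b : R) : 0 <= a -> 0 <= b -> a `^ (p - 1) * b <= a `^ p + b `^ p.
Proof.
move=> a0 b0.
have [ab|/ltW ab] := leP a b.
  rewrite ler_wpDl ?powR_ge0// -powR_pred// ler_wpM2r//.
  by rewrite ge0_ler_powR ?nnegrE// ltW.
by rewrite ler_wpDr ?powR_ge0// -powR_pred// ler_wpM2l// powR_ge0.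
Qed.

Lemma Nr_powRE f : V f = E (fun x => norm_poly f x `^ p).
Proof.
rewrite (Nr_powR _ p0); apply: eq_Rintegral => x _.
by rewrite ger0_norm ?norm_poly_ge0.
Qed.

Lemma tame_powR_norm f : tame wt (fun x => norm_poly f x `^ p).
Proof.
have H : tame wt (fun x => `|norm_poly f x| `^ p).
  by apply: tame_powR (ltW p0) _; exact: tame_norm_poly.
by apply: eq_tame H => x; rewrite ger0_norm ?norm_poly_ge0.
Qed.

Lemma pevalDZ u h c x : peval (u + c *: h) x = peval u x + c * peval h x.
Proof. by rewrite /peval mevalD mevalZ. Qed.

Lemma expect_lin3 (a b c : R) (f1 f2 f3 : Rn R n -> R) :
  tame wt f1 -> tame wt f2 -> tame wt f3 ->
  E (fun x => a * f1 x + b * f2 x + c * f3 x) = a * E f1 + b * E f2 + c * E f3.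
Proof.
move=> t1 t2 t3; rewrite expectD; [|by apply: tameD; exact: tameZ|exact: tameZ].
by rewrite expectD ?expectZ//; exact: tameZ.
Qed.

(** The gradient inequality for the convex function [V] at [u + t h], where
    [psi_modulus] moves the gradient back to [u]. The remainder depends on [u]
    only through [V u]; this uniformity is what lets [near_critical] choose [t]
    before the near-minimizer [u] is known. *)
Lemma expansion (d : R) : 0 < d -> exists2 K : R, 0 < K &
  forall u h (t : R), 0 < t ->
  V (u + C_ R t *: h) <= V u + p * t *
    (complex.Re (EC G (fun x => psi p 0 (peval u x) * peval h x)) +
     d * (V u + V h) + K * t `^ (p - 1) * V h).
Proof.
move=> d0; have [K K0 psiK] := psi_modulus p1 d0.
exists K => // u h t t0.
have pt0 : 0 <= p * t by rewrite mulr_ge0 ?ltW.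
have tp : ctame wt (fun x => psi p 0 (peval u x) * peval h x).
  by apply: ctameM; [exact: ctame_psi_peval|exact: ctame_peval].
have tR : tame wt (fun x => complex.Re (psi p 0 (peval u x) * peval h x)).
  by case: tp.
have tu := tame_powR_norm u; have th := tame_powR_norm h.
pose c2 := p * t * (d + K * t `^ (p - 1)).
pose B x := (1 + p * t * d) * norm_poly u x `^ p +
  (p * t) * complex.Re (psi p 0 (peval u x) * peval h x) +
  c2 * norm_poly h x `^ p.
have -> : V u + p * t *
    (complex.Re (EC G (fun x => psi p 0 (peval u x) * peval h x)) +
     d * (V u + V h) + K * t `^ (p - 1) * V h) = E B.
  pose proof (expect_lin3 (1 + p * t * d) (p * t) c2 tu tR th) as EB.
  rewrite /B EB (Nr_powRE u) (Nr_powRE h).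
  rewrite (_ : complex.Re (EC G _) =
    E (fun x => complex.Re (psi p 0 (peval u x) * peval h x)))//.
  have gen (v1 v2 v3 T : R) : v1 + p * t * (v2 + d * (v1 + v3) + K * T * v3) =
     (1 + p * t * d) * v1 + p * t * v2 + p * t * (d + K * T) * v3 by ring.
  exact: gen.
rewrite Nr_powRE; apply: (@expect_le _ _ _ G wt _ _ _).
- exact: tame_powR_norm.
- by apply: tameD; [apply: tameD; exact: tameZ|exact: tameZ].
move=> x; rewrite /B /norm_poly.
set w := peval (u + C_ R t *: h) x.
have wE : w = peval u x + C_ R t * peval h x by rewrite /w pevalDZ.
have cv := psi_convex (peval u x) w p1.
have e1 : peval u x - w = C_ R (- t) * peval h x.
  by rewrite wE opprD addrA subrr add0r rmorphN mulNr.
have e2 : complex.Re (psi p 0 w * (peval u x - w)) =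
   - t * complex.Re (psi p 0 w * peval h x).
  by rewrite e1 mulrCA (cReM (C_ R (- t))) /= mul0r subr0.
rewrite e2 in cv.
have e3 : complex.Re (psi p 0 w * peval h x) =
  complex.Re (psi p 0 (peval u x) * peval h x) +
  complex.Re ((psi p 0 w - psi p 0 (peval u x)) * peval h x).
  by rewrite -cReD -mulrDl addrC subrK.
have e4 : complex.Re ((psi p 0 w - psi p 0 (peval u x)) * peval h x) <=
  (d * nc (peval u x) `^ (p - 1) + K * nc (C_ R t * peval h x) `^ (p - 1)) * nc (peval h x).
  apply: le_trans (ler_norm _) _; apply: le_trans (nc_Re _) _.
  by rewrite ncM ler_wpM2r ?nc_ge0// wE psiK.
have e5 := powR_mul_le (nc_ge0 (peval u x)) (nc_ge0 (peval h x)).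
have e6 : nc (C_ R t * peval h x) `^ (p - 1) * nc (peval h x) =
  t `^ (p - 1) * nc (peval h x) `^ p.
  rewrite ncM nc_real gtr0_norm// powRM ?nc_ge0 ?(ltW t0)// -mulrA.
  by rewrite (powR_pred (nc_ge0 _)).
rewrite [X in _ <= X]mulrDl -!mulrA e6 in e4.
have e7 := ler_wpM2l (ltW d0) e5.
have e8 : complex.Re (psi p 0 w * peval h x) <=
  complex.Re (psi p 0 (peval u x) * peval h x) +
  d * (nc (peval u x) `^ p + nc (peval h x) `^ p) +
  K * (t `^ (p - 1) * nc (peval h x) `^ p).
  exact: (@eq_ind_r _ _ (fun v : R => v <= _) (ler_add_mid _ e4 e7) _ e3).
have e9 := ler_wpM2l pt0 e8.
exact: expansion_arith cv e9.
Qed.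

(** A polynomial that nearly minimizes [V] on the complex line it spans with
    [h] is nearly orthogonal to [h], after the duality map [psi]. *)
Lemma near_critical (m S e : R) : 0 <= m -> 0 <= S -> 0 < e ->
  exists2 eta : R, 0 < eta <= 1 & forall u h, V u <= m + eta ->
    (forall c : R[i], m <= V (u + c *: h)) -> V h <= S ->
    nc (EC G (fun x => psi p 0 (peval u x) * peval h x)) <= e.
Proof.
move=> m0 S0 e0.
have mS : 0 < 3 * (m + 1 + S) by rewrite mulr_gt0// -addrA ltr_wpDl// ltr_wpDr.
(* Each of the three error terms is made at most [e / 3]. *)
pose d := e / (3 * (m + 1 + S)).
have d0 : 0 < d by rewrite divr_gt0.
have Ed : d * (m + 1 + S) = e / 3.
  by rewrite /d; field; rewrite gt_eqF// -addrA ltr_wpDl// ltr_wpDr.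
have [K K0 exK] := expansion d0.
have EK : K * (e / (3 * (K * (S + 1)))) * (S + 1) = e / 3.
  by field; rewrite !gt_eqF// ltr_wpDl.
have KS : 0 < 3 * (K * (S + 1)) by rewrite !mulr_gt0// ltr_wpDl.
pose t := (e / (3 * (K * (S + 1)))) `^ (p - 1)^-1.
have et : 0 < e / (3 * (K * (S + 1))) by rewrite divr_gt0.
have t0 : 0 < t by exact: powR_gt0.
have tE : t `^ (p - 1) = e / (3 * (K * (S + 1))).
  by rewrite -powRrM mulVf ?gt_eqF// powRr1// ltW.
exists (Num.min 1 (p * t * (e / 3))).
  by rewrite lt_min ltr01 ge_min lexx !mulr_gt0// invr_gt0.
move=> u h uE minu hS.
set z := EC _ _.
have [z0|z0] := eqVneq (nc z) 0; first by rewrite z0 ltW.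
have [v v1 vz] := nc_norm_conj z0.
have tp : ctame wt (fun x => psi p 0 (peval u x) * peval h x).
  by apply: ctameM; [exact: ctame_psi_peval|exact: ctame_peval].
have Vh : V (- v *: h) = V h.
  rewrite !Nr_powRE; apply: eq_Rintegral => x _.
  by rewrite /norm_poly /peval mevalZ ncM ncN v1 mul1r.
have EZ : EC G (fun x => psi p 0 (peval u x) * peval (- v *: h) x) = C_ R (- nc z).
  rewrite (@eq_EC _ _ _ G _ (fun x => - v * (psi p 0 (peval u x) * peval h x))).
    by rewrite (EC_Z _ tp) -/z mulNr vz rmorphN.
  by move=> x; rewrite /peval mevalZ mulrCA.
have := exK u (- v *: h) t t0.
rewrite Vh EZ scalerA /= tE => H1.
have H2 := minu (C_ R t * - v).
have eta1 : Num.min 1 (p * t * (e / 3)) <= 1 by rewrite ge_min lexx.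
have eta2 : Num.min 1 (p * t * (e / 3)) <= p * t * (e / 3) by rewrite ge_min lexx orbT.
exact: (near_critical_arith d0 K0 (ltW et) (mulr_gt0 p0 t0) Ed EK eta1 eta2 H1 H2 uE hS).
Qed.

End distance.

Section polynomial_norms.
Context {R : realType} {n : nat}.
Local Notation G := (gaussian R n).
Implicit Types (f g : cpoly R n) (r : R).
Local Notation N r f := (Nr G r (norm_poly f)).

Lemma Nr_polyD r f g : 1 <= r -> N r (f + g) <= N r f + N r g.
Proof.
move=> r1.
have H : Nr G r (fun x => nc (peval f x + peval g x)) <= N r f + N r g.
  by apply: Nr_ncD r1 _ _; exact: ctame_peval.
apply: le_trans H; apply: le_of_eq.
by apply: eq_Nr => x; rewrite /norm_poly /peval mevalD.
Qed.

Lemma Nr_polyZ r c f : 0 < r -> N r (c *: f) = nc c * N r f.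
Proof.
move=> r0.
have <- : Nr G r (fun x => nc (c * peval f x)) = nc c * N r f.
  by apply: Nr_ncZ r0 _; exact: ctame_peval.
by apply: eq_Nr => x; rewrite /norm_poly /peval mevalZ.
Qed.

Lemma Nr_poly0 r : 0 < r -> N r 0 = 0.
Proof. by move=> r0; rewrite -(scale0r 0) Nr_polyZ// nc0 mul0r. Qed.

Lemma Nr_poly_sum r (I : Type) (s : seq I) (F : I -> cpoly R n) : 1 <= r ->
  N r (\sum_(i <- s) F i) <= \sum_(i <- s) N r (F i).
Proof.
move=> r1; elim: s => [|i s IH].
  by rewrite !big_nil Nr_poly0// (lt_le_trans ltr01).
by rewrite !big_cons; apply: le_trans (Nr_polyD _ _ r1) _; rewrite lerD2l.
Qed.

Lemma nc_pairing_le (p q : R) f g : 0 < p -> 0 < q -> p^-1 + q^-1 = 1 ->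
  nc (pairing f g) <= N p f * N q g.
Proof.
move=> p0 q0 pq; rewrite pairingE.
by apply: nc_EC_hoelder p0 q0 pq _ _; exact: ctame_peval.
Qed.

End polynomial_norms.

(** The arithmetic that ends [dist_le_dual]: [N * Np] is the [p]-th power of the
    distance [N], so that dividing by [Np] leaves [B] and an error controlled by
    the small number [k]. *)
Lemma dual_arith {R : realFieldType} (B e N1 D1 k N Np : R) :
  0 <= B -> 0 < D1 -> 0 < e -> 0 < N1 -> k * (N1 + B) = e * D1 -> N <= N1 -> D1 <= Np ->
  0 <= k -> N * Np <= k * N + B * (Np + k) -> N <= B + e.
Proof.
move=> B0 D0 e0 N0 kE NN DN k0 H.
have Np0 : 0 < Np := lt_le_trans D0 DN.
rewrite -(ler_pM2r Np0).
have H1 : k * (N + B) <= e * Np.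
  by apply: le_trans (ler_wpM2l k0 _) (_ : k * (N1 + B) <= _); rewrite ?lerD2r// kE ler_wpM2l// ltW.
lra.
Qed.

Section distance_duality.
Context {R : realType} {n : nat}.
Local Notation G := (gaussian R n).
Implicit Types (f g h u phi : cpoly R n).
Variables p q : R.
Hypotheses (p1 : 1 < p) (q1 : 1 < q) (pq : p^-1 + q^-1 = 1).

Let p0 : 0 < p. Proof. exact: lt_trans p1. Qed.
Let q0 : 0 < q. Proof. exact: lt_trans q1. Qed.

Local Notation N r f := (Nr G r (norm_poly f)).
Local Notation V f := (N p f `^ p).

Lemma Nr_powK f : V f `^ p^-1 = N p f.
Proof. by rewrite -powRrM divff ?gt_eqF// powRr1// Nr_ge0. Qed.

Variables (d : nat) (u h : cpoly R n) (e : R).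
(** In this part [h] is a polynomial close to the extremal function of [u], and
    that function is nearly orthogonal to the low degrees. *)
Hypothesis hu : Nr G q (fun x => nc (psi p 0 (peval u x) - peval h x)) <= e.
Hypothesis critical : forall a : bmultinom n d.+1,
  nc (EC G (fun x => psi p 0 (peval u x) * peval (hpoly a) x)) <= e.

Definition lowpart_const : R :=
  \sum_(a : bmultinom n d.+1)
    (N p (hpoly a) + 1) * (N q (hpoly a) / nc (pairing (hpoly a) (hpoly a) : R[i])).

Let tu : ctame wt (fun x => psi p 0 (peval u x)).
Proof. exact: ctame_psi_peval. Qed.

Let td : ctame wt (fun x => psi p 0 (peval u x) - peval h x).
Proof. by apply: ctameB => //; exact: ctame_peval. Qed.

Lemma pairing_approx g : nc (EC G (fun x => psi p 0 (peval u x) * peval g x) - pairing h g)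
  <= e * N p g.
Proof.
have tg := ctame_peval g; have th := ctame_peval h.
rewrite pairingE -EC_B; [|exact: ctameM|exact: ctameM].
rewrite (@eq_EC _ _ _ G _ (fun x => (psi p 0 (peval u x) - peval h x) * peval g x)); last first.
  by move=> x; rewrite mulrBl.
have qp : q^-1 + p^-1 = 1 by rewrite addrC.
have H : nc (EC G (fun x => (psi p 0 (peval u x) - peval h x) * peval g x)) <=
  Nr G q (fun x => nc (psi p 0 (peval u x) - peval h x)) * N p g.
  exact: nc_EC_hoelder.
by apply: le_trans H _; rewrite ler_wpM2r// Nr_ge0.
Qed.

(** The coefficients of the projection are pairings with Hermite polynomials,
    which are small for the extremal function and so for [h]. *)
Lemma norm_lowpart : N q (lowpart d h) <= e * lowpart_const.
Proof.
apply: le_trans (Nr_poly_sum _ _ (ltW q1)) _.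
rewrite /lowpart_const mulr_sumr; apply: ler_sum => a _.
rewrite (Nr_polyZ _ _ q0) ncM ncV.
rewrite -[leLHS]mulrA [X in _ * X <= _]mulrC [leRHS]mulrA ler_wpM2r ?divr_ge0 ?Nr_ge0 ?nc_ge0//.
have -> : pairing h (hpoly a) = EC G (fun x => psi p 0 (peval u x) * peval (hpoly a) x) -
  (EC G (fun x => psi p 0 (peval u x) * peval (hpoly a) x) - pairing h (hpoly a)).
  by rewrite opprB addrC subrK.
apply: le_trans (ncB _ _) _; rewrite mulrDr mulr1 addrC.
by rewrite lerD// pairing_approx.
Qed.

(** The pairing of [u] with its extremal function is [N p u `^ p]. Replacing that
    function by the high part of [h] replaces [u] by [g], up to small terms. *)
Lemma norm_self_le phi g (B : R) : u = g - phi -> P_le d phi -> 0 <= B ->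
  (forall f, P_ge d.+1 f -> nc (pairing f g) <= B * N q f) ->
  N p u * N p u `^ (p - 1) <=
    e * (1 + lowpart_const) * N p u +
    B * (N p u `^ (p - 1) + e * (1 + lowpart_const)).
Proof.
move=> uE phid B0 gB.
pose hi := h - lowpart d h.
have hiP : P_ge d.+1 hi := P_ge_highpart d h.
have hiu : pairing hi u = pairing hi g.
  by rewrite uE pairingBr (P_ge_orth hiP phid) subr0.
have E1 : N p u * N p u `^ (p - 1) =
   nc (EC G (fun x => psi p 0 (peval u x) * peval u x)).
  rewrite (EC_psi_self p1 u) nc_real ger0_norm ?powR_ge0//.
  by rewrite mulrC (powR_pred p1)// Nr_ge0.
have E2 : EC G (fun x => psi p 0 (peval u x) * peval u x) =
   (EC G (fun x => psi p 0 (peval u x) * peval u x) - pairing h u) +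
   (pairing hi u + pairing (lowpart d h) u).
  by rewrite -pairingDl /hi subrK subrK.
have H1 := pairing_approx u.
have H2 : nc (pairing (lowpart d h) u) <= e * lowpart_const * N p u.
  apply: le_trans (nc_pairing_le _ _ q0 p0 _) _; first by rewrite addrC.
  by rewrite ler_wpM2r ?Nr_ge0// norm_lowpart.
have H3 : N q hi <= N p u `^ (p - 1) + e * (1 + lowpart_const).
  have A : N q hi <= N q h + N q (lowpart d h).
    have := Nr_polyD h (- 1 *: lowpart d h) (ltW q1).
    by rewrite (Nr_polyZ _ _ q0) ncN nc1 mul1r scaleN1r.
  apply: le_trans A _; apply: le_trans (lerD (Nr_near_psi p1 q1 pq hu) norm_lowpart) _.
  by rewrite mulrDr mulr1 addrA.
have H4 : nc (pairing hi u) <= B * (N p u `^ (p - 1) + e * (1 + lowpart_const)).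
  by rewrite hiu; apply: le_trans (gB _ hiP) _; rewrite ler_wpM2l.
rewrite E1 E2; apply: le_trans (ncD _ _) _.
apply: le_trans (lerD H1 (ncD _ _)) _.
apply: le_trans (lerD (lexx _) (lerD H4 H2)) _.
by apply: le_of_eq; ring.
Qed.

End distance_duality.

Section distance_conclusion.
Context {R : realType} {n : nat}.
Local Notation G := (gaussian R n).
Implicit Types (f g h u phi : cpoly R n).
Variables p q : R.
Hypotheses (p1 : 1 < p) (q1 : 1 < q) (pq : p^-1 + q^-1 = 1).
Local Notation N r f := (Nr G r (norm_poly f)).
Local Notation V f := (N p f `^ p).

(** For [phi] optimal up to an error that [near_critical] provides, the estimate
    [norm_self_le] bounds the [p]-th power of the distance by [B] times its
    [(p - 1)]-st power, up to small terms. *)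
Lemma dist_le_dual d g (B e : R) : 0 <= B -> 0 < e ->
  (forall f, P_ge d.+1 f -> nc (pairing f g) <= B * N q f) ->
  exists2 phi, P_le d phi & N p (g - phi) <= B + e.
Proof.
move=> B0 e0 gB.
have p0 : 0 < p := lt_trans ltr01 p1.
pose A := [set V (g - phi) | phi in @P_le R n d].
have hA : has_inf A.
  split; first by exists (V (g - 0)), 0 => //; exact: P_le0.
  by exists 0 => _ [phi _ <-]; exact: powR_ge0.
pose m := inf A.
have m_le phi : P_le d phi -> m <= V (g - phi).
  by move=> phid; apply: ge_inf; [case: hA|exists phi].
have m0 : 0 <= m.
  by apply: lb_le_inf => [|_ [phi _ <-]]; [case: hA|exact: powR_ge0].
have V_le f c : V f <= c -> N p f <= c `^ p^-1.
  move=> fc; rewrite -(Nr_powK p1); apply: ge0_ler_powR (fc).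
  - by rewrite invr_ge0 ltW.
  - by rewrite nnegrE powR_ge0.
  - by rewrite nnegrE (le_trans (powR_ge0 _ _) fc).
(* A zero distance is treated apart: below one divides by a power of it. *)
have [m00|mn0] := eqVneq m 0.
  have [_ [phi phid <-] H] := inf_adherent (powR_gt0 p e0) hA.
  exists phi => //.
  have {}H : V (g - phi) <= e `^ p by rewrite ltW// -[ltRHS]add0r -m00.
  apply: le_trans (V_le _ _ H) _.
  by rewrite -powRrM divff ?gt_eqF// powRr1 ?(ltW e0)// lerDr.
have mp : 0 < m by rewrite lt_neqAle eq_sym mn0.
pose S := \sum_(a : bmultinom n d.+1) V (hpoly a).
have S0 : 0 <= S by apply: sumr_ge0 => a _; exact: powR_ge0.
pose L : R := lowpart_const (n := n) p q d.
have L0 : 0 <= L.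
  apply: sumr_ge0 => a _; rewrite mulr_ge0 ?addr_ge0 ?Nr_ge0//.
  by rewrite divr_ge0 ?Nr_ge0 ?nc_ge0.
pose N1 := (m + 1) `^ p^-1.
have N10 : 0 < N1 by apply: powR_gt0; rewrite addr_gt0.
pose D1 := (m `^ p^-1) `^ (p - 1).
have D10 : 0 < D1 by rewrite !powR_gt0.
pose k := e * D1 / (N1 + B).
have k0 : 0 < k by rewrite !divr_gt0 ?mulr_gt0// ltr_wpDr.
pose e' := k / (1 + L).
have e'0 : 0 < e' by rewrite divr_gt0// ltr_wpDr.
have e'k : e' * (1 + L) = k by rewrite divfK// gt_eqF// ltr_wpDr.
have [eta /andP[eta0 eta1] crit] := @near_critical R n p p1 m S e' m0 S0 e'0.
have [_ [phi phid <-] H] := inf_adherent eta0 hA.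
have {}H := ltW H.
pose u := g - phi.
have [h hu] := approximable_psi u (ltW q1) p1 e'0.
have cr (a : bmultinom n d.+1) :
  nc (EC G (fun x => psi p 0 (peval u x) * peval (hpoly a) x)) <= e'.
  apply: crit => [||]; first exact: H.
    move=> c; rewrite (_ : u + _ = g - (phi - c *: hpoly a)); last first.
      by rewrite /u opprB addrA addrAC.
    apply: m_le; rewrite -scaleNr; apply: P_leD => //; apply: P_leZ.
    by apply: (P_le_mon _ (@P_le_hpoly R n a)); rewrite -ltnS bmdeg.
  rewrite /S (bigD1 a)//= lerDl; apply: sumr_ge0 => b _; exact: powR_ge0.
have key := norm_self_le p1 q1 pq hu cr (erefl u) phid B0 gB.
rewrite -/L e'k in key.
exists phi => //.
have kE : k * (N1 + B) = e * D1 by rewrite divfK// gt_eqF// ltr_wpDr.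
have NN : N p u <= N1.
  by apply: V_le; apply: le_trans H _; rewrite lerD2l.
have DN : D1 <= N p u `^ (p - 1).
  apply: ge0_ler_powR; rewrite ?nnegrE ?powR_ge0 ?Nr_ge0 ?subr_ge0 ?(ltW p1)//.
  rewrite -(Nr_powK p1); apply: ge0_ler_powR; rewrite ?nnegrE ?powR_ge0 ?invr_ge0 ?(ltW p0)//.
  exact: m_le.
exact: dual_arith B0 D10 e0 N10 kE NN DN (ltW k0) key.
Qed.

End distance_conclusion.

(** * Comparison of the two constants *)

Section mehler_atan.
Context {R : realType} {n : nat}.
Local Notation G := (gaussian R n).
Implicit Types (f g : cpoly R n) (r A t : R).
Local Notation N r f := (Nr G r (norm_poly f)).
Local Notation D r f := (Nr G r (norm_grad f)).

Definition mehler_at t f : cpoly R n := mehler (cos t) (sin t) f.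

Lemma cos_atan_gt0 (t : R) : 0 < cos (atan t).
Proof. by apply: cos_gt0_pihalf; rewrite atan_gtNpi2 atan_ltpi2. Qed.

Lemma atan_itv (t : R) : 0 <= t -> 0 <= atan t <= pi / 2.
Proof. by move=> t0; rewrite atan_ge0//= ltW// atan_ltpi2. Qed.

Lemma sin_atan_ge0 (t : R) : 0 <= t -> 0 <= sin (atan t).
Proof. by move=> t0; rewrite sin_atan mulr_ge0// ltW// cos_atan_gt0. Qed.

(** The angle at which the gradient bound of the Mehler transform beats a
    given constant [A] by a factor two. *)
Definition angle r A : R := atan (2 * (lin_const (r / (r - 1)) * A)).

Lemma angle_arg_ge0 r A : 0 <= A -> 0 <= 2 * (lin_const (r / (r - 1)) * A).
Proof. by move=> A0; rewrite !mulr_ge0// ltW// lin_const_gt0. Qed.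

Lemma grad_mehler_angle r A f : 1 < r -> 0 <= A ->
  A * D r (mehler_at (angle r A) f) <= N r f / 2.
Proof.
move=> r1 A0; have a0 := angle_arg_ge0 r A0.
have K0 := @lin_const_gt0 R (r / (r - 1)).
have c0 := cos_atan_gt0 (2 * (lin_const (r / (r - 1)) * A)).
have := grad_mehler f r1 (cos2Dsin2 (angle r A)) (ltW c0) (sin_atan_ge0 a0).
rewrite -/(mehler_at _ f) sin_atan -/(angle r A).
set X := Nr _ _ _; set Y := Nr _ _ _; set K := lin_const _ in K0 *.
rewrite -mulrA mulrCA -[leRHS]mulrA ler_pM2l// -/K.
have -> : 2 * (K * A) * X = K * (2 * (A * X)) by ring.
by rewrite ler_pM2l// ler_pdivlMr// mulrC.
Qed.

Lemma mehler_at_close r t g : 1 < r -> 0 <= t <= pi / 2 ->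
  N r (g - mehler_at t g) <= t * (lin_const r * D r g).
Proof. exact: mehler_close. Qed.

End mehler_atan.

Lemma le_double {R : realFieldType} (a b : R) : a <= b + a / 2 -> a <= 2 * b.
Proof. lra. Qed.

Lemma sqrt_succ_le {R : rcfType} d : (0 < d)%N ->
  Num.sqrt d.+1%:R <= 2 * Num.sqrt d%:R :> R.
Proof.
move=> d0; have -> : 2 = Num.sqrt (2 ^+ 2) :> R by rewrite sqrtr_sqr ger0_norm.
rewrite -sqrtrM ?exprn_ge0// ler_wsqrtr// -natrX -natrM ler_nat; lia.
Qed.

Section comparison.
Context {R : realType} {n : nat}.
Local Notation G := (gaussian R n).
Implicit Types (f g h : cpoly R n).
Variables p q : R.
Hypotheses (p1 : 1 < p) (q1 : 1 < q) (pq : p^-1 + q^-1 = 1).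
Local Notation N r f := (Nr G r (norm_poly f)).
Local Notation D r f := (Nr G r (norm_grad f)).
Local Notation K := lin_const.

Let p0 : 0 < p. Proof. exact: lt_trans p1. Qed.
Let q0 : 0 < q. Proof. exact: lt_trans q1. Qed.
Let K0 r : 0 < K r :> R. Proof. exact: lin_const_gt0. Qed.

Let pqD : p * q = p + q.
Proof.
have : p * q * (p^-1 + q^-1) = p * q by rewrite pq mulr1.
by have -> : p * q * (p^-1 + q^-1) = p + q by field; rewrite !gt_eqF.
Qed.

Let qE : p / (p - 1) = q.
Proof.
apply: (canLR (mulfK _)); first by rewrite subr_eq0 gt_eqF.
by rewrite mulrBr mulr1 mulrC pqD addrK.
Qed.

Let pE : q / (q - 1) = p.
Proof.
apply: (canLR (mulfK _)); first by rewrite subr_eq0 gt_eqF.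
by rewrite mulrBr mulr1 pqD addrC addKr.
Qed.

Lemma mehler_at_pairing (t : R) f g : 0 <= cos t ->
  pairing (mehler_at t f) g = pairing f (mehler_at t g).
Proof. by move=> c0; apply: pairing_mehler => //; exact: cos2Dsin2. Qed.

Lemma P_ge_mehler_at (t : R) d f : 0 <= cos t -> P_ge d.+1 f ->
  P_ge d.+1 (mehler_at t f).
Proof. by move=> c0; apply: P_ge_mehler => //; exact: cos2Dsin2. Qed.

Definition F_feasible C := forall d f, P_ge d.+1 f ->
  Num.sqrt d.+1%:R * N q f <= C * D q f.

(** The infimum over [phi] is replaced by approximate minimizers. *)
Definition J_feasible C := forall d g (e : R), (0 < d)%N -> 0 < e ->
  exists2 phi, P_le d phi & N p (g - phi) <= C / Num.sqrt d%:R * D p g + e.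

(** Halving [f] by the Mehler transform costs [theta * D p g] in the pairing
    with [g]; the geometric series of these costs converges. *)
Lemma pairing_le_F C d f g : F_feasible C -> 0 <= C -> P_ge d.+1 f ->
  nc (pairing f g) <= 2 * (angle q (C / Num.sqrt d.+1%:R) * (K p * D p g)) * N q f.
Proof.
move=> FC C0.
set A := C / _; set t := angle q A; set X := t * _.
have s0 : 0 < Num.sqrt d.+1%:R :> R by rewrite sqrtr_gt0 ltr0n.
have A0 : 0 <= A by rewrite divr_ge0// ltW.
have a0 := angle_arg_ge0 q A0.
have c0 : 0 <= cos t := ltW (cos_atan_gt0 _).
have tI : 0 <= t <= pi / 2 := atan_itv a0.
have X0 : 0 <= X.
  by rewrite !mulr_ge0 ?Nr_ge0 ?(ltW (K0 _))//; case/andP: tI.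
have half f' : P_ge d.+1 f' -> N q (mehler_at t f') <= N q f' / 2.
  move=> f'd; apply: le_trans (grad_mehler_angle f' q1 A0).
  rewrite /A mulrAC ler_pdivlMr// mulrC.
  exact: FC (P_ge_mehler_at c0 f'd).
have step k f' : P_ge d.+1 f' ->
  nc (pairing f' g) <= (2^-1 ^+ k * N p g + 2 * X) * N q f'.
  elim: k f' => [|k IH] f' f'd.
    apply: le_trans (nc_pairing_le _ _ q0 p0 _) _; first by rewrite addrC.
    by rewrite expr0 mul1r mulrC ler_wpM2r ?Nr_ge0// lerDl mulr_ge0.
  have E : pairing f' g = pairing f' (g - mehler_at t g) + pairing (mehler_at t f') g.
    by rewrite pairingBr mehler_at_pairing// subrK.
  rewrite E; apply: le_trans (ncD _ _) _.
  have H1 : nc (pairing f' (g - mehler_at t g)) <= X * N q f'.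
    apply: le_trans (nc_pairing_le _ _ q0 p0 _) _; first by rewrite addrC.
    by rewrite mulrC ler_wpM2r ?Nr_ge0// mehler_at_close.
  have H2 : nc (pairing (mehler_at t f') g) <=
      (2^-1 ^+ k * N p g + 2 * X) * (N q f' / 2).
    apply: le_trans (IH _ (P_ge_mehler_at c0 f'd)) _.
    have b0 : 0 <= 2^-1 ^+ k * N p g + 2 * X.
      by apply: addr_ge0 (mulr_ge0 _ (Nr_ge0 _ _)) (mulr_ge0 _ X0).
    by apply: (ler_wpM2l b0); exact: half.
  apply: le_trans (lerD H1 H2) _; apply: le_of_eq.
  by rewrite exprS; field.
move=> fd; rewrite -subr_le0.
apply: (@le0_of_small _ _ (N p g * N q f)) => e /andP[e0 _].
(* [k] steps reduce the initial bound [N p g] below [e]. *)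
pose k := Num.bound e^-1.
have ke : 2^-1 ^+ k <= e.
  rewrite exprVn invf_ple ?posrE ?exprn_gt0//.
  have e1 : 0 <= e^-1 by rewrite invr_ge0 ltW.
  rewrite (le_trans (ltW (archi_boundP e1)))// -natrX ler_nat.
  by rewrite ltnW// ltn_expl.
have H := step k f fd.
have H' : 2^-1 ^+ k * (N p g * N q f) <= e * (N p g * N q f).
  by rewrite ler_wpM2r// mulr_ge0 ?Nr_ge0.
by rewrite lerBlDr; apply: le_trans H _; rewrite mulrDl lerD2r -[leLHS]mulrA.
Qed.

(** The angle is at most its tangent, which is of order [C / sqrt d]. *)
Lemma J_of_F C : 0 <= C -> F_feasible C -> J_feasible (4 * K p ^+ 2 * C).
Proof.
move=> C0 FC d g e d0 e0.
pose A := C / Num.sqrt d.+1%:R.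
have s0 : 0 < Num.sqrt d.+1%:R :> R by rewrite sqrtr_gt0 ltr0n.
have s1 : 0 < Num.sqrt d%:R :> R by rewrite sqrtr_gt0 ltr0n.
have A0 : 0 <= A by rewrite divr_ge0// ltW.
have a0 := angle_arg_ge0 q A0.
have t0 : 0 <= angle q A := atan_ge0 a0.
have B0 : 0 <= 2 * (angle q A * (K p * D p g)).
  by rewrite !mulr_ge0 ?Nr_ge0 ?(ltW (K0 _)).
have [phi phid H] := dist_le_dual p1 q1 pq B0 e0
  (fun f (fd : P_ge d.+1 f) => pairing_le_F g FC C0 fd).
exists phi => //; apply: le_trans H _; rewrite lerD2r.
have H1 : angle q A <= 2 * (K p * (C / Num.sqrt d%:R)).
  apply: le_trans (atan_le a0) _.
  rewrite pE !ler_wpM2l ?(ltW (K0 _))// lef_pV2 ?posrE//.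
  by rewrite ler_wsqrtr// ler_nat.
apply: le_trans (ler_wpM2l _ (ler_wpM2r _ H1)) _ => //.
  by rewrite mulr_ge0 ?Nr_ge0 ?(ltW (K0 _)).
apply: le_of_eq; ring.
Qed.

(** At the angle [pi / 2] the Mehler transform is the expectation. *)
Lemma poincare d f : P_ge d.+1 f -> N q f <= pi / 2 * (K q * D q f).
Proof.
move=> fd; have pi0 : 0 <= pi / 2 :> R by rewrite divr_ge0// pi_ge0.
have := @mehler_at_close R n q (pi / 2) f q1.
rewrite lexx pi0 => /(_ isT); apply: le_trans.
apply: le_of_eq; apply: eq_Nr => x.
rewrite /norm_poly /mehler_at cos_pihalf sin_pihalf /peval mevalB -!/(peval _ _).
rewrite (_ : peval (mehler 0 1 f) x = 0) ?subr0// mehlerE.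
transitivity (pairing f 1); last first.
  exact: P_ge_orth fd (P_le1 _).
rewrite pairingE; apply: eq_EC => y.
rewrite [peval 1 y]meval1 mulr1; congr (peval f _).
by apply: eq_from_tnth => j; rewrite tnth_lincomb mul0r add0r mul1r.
Qed.

(** Half of [N q f] is absorbed on the left. *)
Lemma F_of_J_pos C d f : 0 <= C -> J_feasible C -> (0 < d)%N -> P_ge d.+1 f ->
  Num.sqrt d.+1%:R * N q f <= 8 * K q ^+ 2 * C * D q f.
Proof.
move=> C0 JC d0 fd.
pose A := C / Num.sqrt d%:R; pose t := angle p A.
have s1 : 0 < Num.sqrt d%:R :> R by rewrite sqrtr_gt0 ltr0n.
have A0 : 0 <= A by rewrite divr_ge0// ltW.
have a0 := angle_arg_ge0 p A0.
have c0 : 0 <= cos t := ltW (cos_atan_gt0 _).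
have tI : 0 <= t <= pi / 2 := atan_itv a0.
have t0 : 0 <= t by case/andP: tI.
pose B := t * (K q * D q f) + N q f / 2.
have B0 : 0 <= B.
  by rewrite addr_ge0 ?mulr_ge0 ?divr_ge0 ?Nr_ge0 ?(ltW (K0 _)).
have pairB g : nc (pairing f g) <= B * N p g.
  have E : pairing f g = pairing (f - mehler_at t f) g + pairing f (mehler_at t g).
    by rewrite pairingBl mehler_at_pairing// subrK.
  rewrite E; apply: le_trans (ncD _ _) _.
  have qp : q^-1 + p^-1 = 1 by rewrite addrC.
  have H1 : nc (pairing (f - mehler_at t f) g) <= t * (K q * D q f) * N p g.
    apply: le_trans (nc_pairing_le _ _ q0 p0 qp) _.
    by rewrite ler_wpM2r ?Nr_ge0// mehler_at_close.
  have H2 : nc (pairing f (mehler_at t g)) <= N q f * (N p g / 2).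
    rewrite -subr_le0; apply: (@le0_of_small _ _ (N q f)) => e /andP[e0 _].
    have [phi phid He] := JC d (mehler_at t g) e d0 e0.
    have -> : pairing f (mehler_at t g) = pairing f (mehler_at t g - phi).
      by rewrite pairingBr (P_ge_orth fd phid) subr0.
    rewrite lerBlDr.
    apply: le_trans (nc_pairing_le _ _ q0 p0 qp) _.
    rewrite [e * _]mulrC -mulrDr ler_wpM2l ?Nr_ge0//.
    apply: le_trans He _; rewrite addrC lerD2l.
    exact: grad_mehler_angle.
  apply: le_trans (lerD H1 H2) _.
  apply: le_of_eq; rewrite /B; ring.
have qp : q^-1 + p^-1 = 1 by rewrite addrC.
have H := norm_le_dual q1 p1 qp B0 pairB.
have H1 : N q f <= 2 * (t * (K q * D q f)) by exact: le_double H.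
have H2 : t <= 2 * (K q * A) by rewrite -qE; exact: atan_le a0.
have KD : 0 <= K q * D q f by rewrite mulr_ge0 ?Nr_ge0 ?(ltW (K0 _)).
have H3 : N q f <= 4 * K q ^+ 2 * D q f * A.
  apply: le_trans H1 _; apply: le_trans (ler_wpM2l _ (ler_wpM2r KD H2)) _ => //.
  apply: le_of_eq; ring.
have s2 := @sqrt_succ_le R _ d0.
apply: le_trans (ler_wpM2r (Nr_ge0 _ _) s2) _.
apply: le_trans (ler_wpM2l _ H3) _; first by rewrite mulr_ge0// ltW.
apply: le_of_eq; rewrite /A; field.
by rewrite gt_eqF.
Qed.

End comparison.

Section test_polynomial.
Context {R : realType} {n : nat}.
Local Notation G := (gaussian R n).
Variable j : 'I_n.
Implicit Types (a : multinom n) (r : R).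
Local Notation K := lin_const.

Lemma P_ge_hpoly d a : (d <= mdeg a)%N -> P_ge d (hpoly a : cpoly R n).
Proof.
move=> da; exists [:: a], (fun=> 1); split.
  by move=> b; rewrite inE => /eqP ->.
by move=> x; rewrite big_seq1 mul1r hpolyE.
Qed.

Definition mnm2 : multinom n := mnm_add (mnm1 j) (mnm1 j).

Lemma mdeg_mnm2 : mdeg mnm2 = 2%N.
Proof. by rewrite /mnm2 mdegD mdeg1. Qed.

Lemma pairing_hermite2 : pairing (hpoly mnm2) (hpoly mnm2) = 2 :> R[i].
Proof.
rewrite {1}/mnm2 pairing_hermiteS {2}/mnm2 addmK.
have E1 : mnm1 j = mnm_add (mnm0 : multinom n) (mnm1 j) by rewrite add0m.
rewrite {1}E1 pairing_hermiteS.
rewrite (_ : mnm_sub (mnm1 j) (mnm1 j) = (mnm0 : multinom n)); last first.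
  by apply/mnmP => i; rewrite mnmBE subnn mnm0E.
rewrite (_ : pairing _ _ = 1); last first.
  rewrite pairingE -[RHS](EC_cst (mu := G)); apply: eq_EC => x.
  by rewrite !hpolyE hermite0 mulr1.
by rewrite /mnm2 mnmDE !mnm1E eqxx mulr1 mulr1.
Qed.

Lemma hermite1 (x : Rn R n) : hermite (mnm1 j) x = C_ R (tnth x j).
Proof.
have -> : mnm1 j = mnm_add (mnm0 : multinom n) (mnm1 j) by rewrite add0m.
by rewrite hermite_rec hermite0 mulr1 hermite_deriv mnm0E mul0r subr0.
Qed.

Lemma norm_grad_hermite2 (x : Rn R n) :
  norm_grad (hpoly mnm2) x = 2 * nc (C_ R (tnth x j)).
Proof.
rewrite /norm_grad (bigD1 j)//= big1 => [|i ij]; last first.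
  rewrite /norm_poly hermite_deriv /mnm2 mnmDE mnm1E eq_sym (negbTE ij) mul0r nc0.
  by rewrite expr0n.
rewrite addr0 sqrtr_sqr ger0_norm ?norm_poly_ge0// /norm_poly hermite_deriv.
rewrite {2}/mnm2 addmK hermite1 ncM /mnm2 mnmDE mnm1E eqxx; congr (_ * _).
by rewrite -(rmorph_nat (C_ R)) nc_real ger0_norm.
Qed.

Lemma Nr_grad_hermite2 r : 0 < r -> Nr G r (norm_grad (hpoly mnm2)) <= 2 * K r.
Proof.
move=> r0; pose v (i : 'I_n) : R[i] := (i == j)%:R.
have cE (x : Rn R n) : cdot v x = C_ R (tnth x j).
  rewrite /cdot (bigD1 j)//= big1 => [|i ij]; last by rewrite /v (negbTE ij) mul0r.
  by rewrite /v eqxx mul1r addr0.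
have eE : enorm v = 1.
  rewrite /enorm (bigD1 j)//= big1 => [|i ij].
    by rewrite /v eqxx nc1 expr1n addr0 sqrtr1.
  by rewrite /v (negbTE ij) nc0 expr0n.
have H := Nr_cdot v r0; rewrite eE mulr1 in H.
have tc : tame wt (fun x : Rn R n => nc (cdot v x)) by apply: tame_nc; exact: ctame_cdot.
have E : Nr G r (fun x => 2 * nc (cdot v x)) = `|2| * Nr G r (fun x => nc (cdot v x)).
  exact: NrZ.
rewrite (@eq_Nr _ _ _ G r _ (fun x => 2 * nc (cdot v x))).
  by rewrite E ger0_norm// ler_wpM2l.
by move=> x; rewrite norm_grad_hermite2 cE.
Qed.

End test_polynomial.

Lemma half_mul_double {R : realFieldType} (a k : R) : a / 2 * (k * (2 * k)) = a * k ^+ 2.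
Proof. by field. Qed.

Lemma lower_arith {R : realFieldType} (a b c d : R) : a * b * (c * (2 * d)) = 2 * (a * (b * d) * c).
Proof. by ring. Qed.

Section conclusion.
Context {R : realType} {n : nat}.
Local Notation G := (gaussian R n).
Variables p q : R.
Hypotheses (p1 : 1 < p) (q1 : 1 < q) (pq : p^-1 + q^-1 = 1).
Local Notation N r f := (Nr G r (norm_poly f)).
Local Notation D r f := (Nr G r (norm_grad f)).
Local Notation K := lin_const.

Let p0 : 0 < p. Proof. exact: lt_trans p1. Qed.
Let q0 : 0 < q. Proof. exact: lt_trans q1. Qed.
Let K0 r : 0 < K r :> R. Proof. exact: lin_const_gt0. Qed.

Definition J_lower : R := pi * (K q ^+ 2 * K p).

Lemma J_lower_gt0 : 0 < J_lower.
Proof. by rewrite /J_lower !mulr_gt0// ?pi_gt0 ?exprn_gt0. Qed.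

(** Testing with the second Hermite polynomial in one coordinate bounds the
    admissible constants from below independently of the dimension. *)
Lemma J_feasible_lb C : (0 < n)%N -> 0 <= C -> @J_feasible R n p C -> 1 <= J_lower * C.
Proof.
move=> n0 C0 JC; pose j : 'I_n := Ordinal n0; pose h : cpoly R n := hpoly (mnm2 j).
have hd : P_ge 2 h by apply: P_ge_hpoly; rewrite mdeg_mnm2.
have Nh : N q h <= pi * K q ^+ 2.
  apply: le_trans (poincare q1 hd) _.
  have H := ler_wpM2l (ltW (K0 q)) (Nr_grad_hermite2 j q0).
  have pi0 : 0 <= pi / 2 :> R by rewrite divr_ge0// pi_ge0.
  apply: le_trans (ler_wpM2l pi0 H) _.
  by rewrite half_mul_double.
have : 2 <= 2 * (J_lower * C).
  rewrite -subr_le0; apply: (@le0_of_small _ _ (N q h)) => e /andP[e0 _].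
  have [phi phid He] := JC 1%N h e isT e0.
  have E : pairing h (h - phi) = 2.
    by rewrite pairingBr (P_ge_orth hd phid) subr0 pairing_hermite2.
  have qp : q^-1 + p^-1 = 1 by rewrite addrC.
  have := nc_pairing_le h (h - phi) q0 p0 qp.
  rewrite E (_ : nc 2 = 2); last by rewrite -(rmorph_nat (C_ R)) nc_real ger0_norm.
  move=> H; rewrite lerBlDr; apply: le_trans H _.
  apply: le_trans (ler_wpM2l (Nr_ge0 _ _) He) _.
  rewrite sqrtr1 divr1 mulrDr addrC [N q h * e]mulrC lerD2l.
  have D0 : 0 <= C * D p h by rewrite mulr_ge0// Nr_ge0.
  apply: le_trans (ler_wpM2r D0 Nh) _.
  have DC := ler_wpM2l C0 (Nr_grad_hermite2 j p0).
  have k0 : 0 <= pi * K q ^+ 2 by rewrite mulr_ge0 ?pi_ge0 ?exprn_ge0 ?ltW.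
  apply: le_trans (ler_wpM2l k0 DC) _.
  by apply: le_of_eq; exact: lower_arith.
by rewrite ler_pMr.
Qed.

Definition F_factor : R := 8 * K q ^+ 2 + pi / 2 * K q * J_lower.

Lemma F_factor_gt0 : 0 < F_factor.
Proof.
by rewrite addr_gt0 ?mulr_gt0 ?exprn_gt0 ?J_lower_gt0 ?invr_gt0 ?pi_gt0.
Qed.

Lemma F_of_J C : (0 < n)%N -> 0 <= C -> @J_feasible R n p C ->
  @F_feasible R n q (F_factor * C).
Proof.
move=> n0 C0 JC d f fd.
have a1 : 0 <= 8 * K q ^+ 2 * C * D q f.
  by rewrite !mulr_ge0 ?exprn_ge0 ?Nr_ge0 ?(ltW (K0 _)).
have Jl := ltW J_lower_gt0.
have a2 : 0 <= pi / 2 * K q * D q f.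
  by rewrite !mulr_ge0 ?Nr_ge0 ?invr_ge0 ?pi_ge0 ?(ltW (K0 _)).
have E : F_factor * C * D q f =
  8 * K q ^+ 2 * C * D q f + pi / 2 * K q * D q f * (J_lower * C).
  by rewrite /F_factor; ring.
have JC0 : 0 <= J_lower * C by rewrite mulr_ge0.
rewrite E; case: d fd => [|d] fd.
  rewrite sqrtr1 mul1r; apply: le_trans (poincare q1 fd) _.
  rewrite ler_wpDl// mulrA ler_peMr//; exact: J_feasible_lb.
apply: le_trans (F_of_J_pos p1 q1 pq C0 JC _ fd) _ => //.
by rewrite lerDl mulr_ge0.
Qed.

Lemma Lp_norm_poly r f : 0 < r -> Lp_norm r (norm_poly f) = (N r f)%:E.
Proof. by move=> r0; apply: Lnorm_Nr r0 (tame_norm_poly f). Qed.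

Lemma Lp_norm_grad r f : 0 < r -> Lp_norm r (norm_grad f) = (D r f)%:E.
Proof. by move=> r0; apply: Lnorm_Nr r0 (tame_norm_grad f). Qed.

Lemma F_const_le C : 0 <= C -> @F_feasible R n q C -> (F_const n q <= C%:E)%E.
Proof.
move=> C0 FC; apply: ereal_inf_lbound; exists C => //; split => // d f fd.
by rewrite Lp_norm_poly// Lp_norm_grad// -!EFinM lee_fin; exact: FC.
Qed.

Lemma F_const_ge (x : \bar R) :
  (forall C, 0 <= C -> @F_feasible R n q C -> (x <= C%:E)%E) -> (x <= F_const n q)%E.
Proof.
move=> H; apply: le_ereal_inf_tmp => _ [C [C0 FC] <-]; apply: H => // d f fd.
have := FC d f fd.
by rewrite Lp_norm_poly// Lp_norm_grad// -!EFinM lee_fin.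
Qed.

Lemma J_const_le C : 0 <= C -> @J_feasible R n p C -> (J_const n p <= C%:E)%E.
Proof.
move=> C0 JC; apply: ereal_inf_lbound; exists C => //; split => // d g d0.
apply/lee_addgt0Pr => e e0; have [phi phid H] := JC d g e d0 e0.
apply: (@le_trans _ _ (Lp_norm p (norm_poly (g - phi)))).
  by apply: ereal_inf_lbound; exists phi.
by rewrite Lp_norm_poly// Lp_norm_grad// -EFinM -EFinD lee_fin.
Qed.

Lemma J_const_ge (x : \bar R) :
  (forall C, 0 <= C -> @J_feasible R n p C -> (x <= C%:E)%E) -> (x <= J_const n p)%E.
Proof.
move=> H; apply: le_ereal_inf_tmp => _ [C [C0 JC] <-]; apply: H => // d g e d0 e0.
have := JC d g d0; rewrite Lp_norm_grad// -EFinM => Hinf.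
have lt : (ereal_inf [set Lp_norm p (norm_poly (g - phi)%R) | phi in @P_le R n d]
   < (C / Num.sqrt d%:R * D p g + e)%:E)%E.
  by apply: le_lt_trans Hinf _; rewrite lte_fin ltrDl.
have [_ [phi phid <-] Hphi] := ereal_inf_lt lt.
by exists phi => //; move: Hphi; rewrite Lp_norm_poly// lte_fin => /ltW.
Qed.

End conclusion.

Theorem theorem1 :
  forall (R : realType) (p : R), 1 < p ->
  exists c C : R, 0 < c /\ 0 < C /\
    forall n : nat, (1 <= n)%N ->
      (c%:E * F_const n (p / (p - 1)) <= J_const n p)%E /\
      (J_const n p <= C%:E * F_const n (p / (p - 1)))%E.
Proof.
move=> R p p1; have [p0 q1 pq] := conj_exp p1; set q := p / (p - 1) in q1 pq *.
have c0 := F_factor_gt0 p q.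
have C0 : 0 < 4 * lin_const p ^+ 2 :> R by rewrite mulr_gt0// exprn_gt0// lin_const_gt0.
exists (F_factor p q)^-1, (4 * lin_const p ^+ 2).
split; first by rewrite invr_gt0.
split=> // n n1; split.
  apply: J_const_ge => // C C1 JC; rewrite lee_pdivrMl// -EFinM.
  apply: F_const_le => //; first by rewrite mulr_ge0// ltW.
  exact: F_of_J.
rewrite -lee_pdivrMl//; apply: F_const_ge => // C C1 FC.
rewrite lee_pdivrMl// -EFinM; apply: J_const_le => //.
  by rewrite mulr_ge0// ltW.
exact: J_of_F FC.
Qed.
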